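(* Assume that $H:\mathbb{R}^3\to\mathbb{R}$ satisfies (A0)-(A5) and either (B-i) or (B-ii) (all listed in the context), and let $\bar H_L,\bar H_R$ be the homogenized Hamiltonians and $\bar A$ the effective flux limiter defined in the context. There exists a solution $w$ of $$\begin{cases}w_t+H(t,x,w_x)=\bar A,\quad (t,x)\in\mathbb{R}\times\mathbb{R},\\ w\text{ is $1$-periodic with respect to }t,\end{cases}$$ such that the function $$w^\varepsilon(t,x)=\varepsilon\, w(\varepsilon^{-1}t,\varepsilon^{-1}x)$$ converges locally uniformly (along a subsequence $\varepsilon_n\to0$) towards a function $W=W(x)$ which satisfies $W(0)=0$ and, for all $x\in\mathbb{R}$, $$\hat p_R\,x\,1_{\{x>0\}}+\hat p_L\,x\,1_{\{x<0\}}\ \ge\ W(x)\ \ge\ \bar p_R\,x\,1_{\{x>0\}}+\bar p_L\,x\,1_{\{x<0\}},$$ where $$\bar p_R=\min E_R,\quad \hat p_R=\max E_R,\quad E_R:=\{p\in\mathbb{R}:\ \bar H_R^+(p)=\bar H_R(p)=\bar A\},$$ $$\bar p_L=\max E_L,\quad \hat p_L=\min E_L,\quad E_L:=\{p\in\mathbb{R}:\ \bar H_L^-(p)=\bar H_L(p)=\bar A\}.$$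
   Context: Assumptions on $H=H(t,x,p)$. (A0) $H:\mathbb{R}^3\to\mathbb{R}$ is continuous. (A1) $H(t+k,x,p)=H(t,x,p)$ for all $k\in\mathbb{Z}$, $(t,x,p)\in\mathbb{R}^3$. (A2) There is a modulus of continuity $\omega$ such that $H(t,x,p)-H(s,x,p)\le\omega\big(|t-s|(1+\max(H(s,x,p),0))\big)$ for all $t,s,x,p\in\mathbb{R}$. (A3) $\lim_{|q|\to+\infty}H(t,x,q)=+\infty$ uniformly in $(t,x)$. (A4) There is $\rho_0>0$ such that for all $x\in\mathbb{R}\setminus(-\rho_0,\rho_0)$ there is a continuous map $t\mapsto p^0(t,x)$ such that $H(t,x,\cdot)$ is non-increasing on $(-\infty,p^0(t,x))$ and non-decreasing on $(p^0(t,x),+\infty)$. (A5) There are two Hamiltonians $H_L,H_R$ such that $H(t,x+k,p)-H_L(t,x,p)\to0$ as $\mathbb{Z}\ni k\to-\infty$ and $H(t,x+k,p)-H_R(t,x,p)\to0$ as $\mathbb{Z}\ni k\to+\infty$, uniformly in $(t,x,p)\in[0,1]^2\times\mathbb{R}$, and $H_\alpha(t+k,x+j,p)=H_\alpha(t,x,p)$ for all $k,j\in\mathbb{Z}$, $(t,x,p)\in\mathbb{R}^3$, $\alpha\in\{L,R\}$. (B-i) For each $\alpha=L,R$, $H_\alpha$ does not depend on time and there is $p^0_\alpha$ (independent of $(t,x)$) such that $H_\alpha(x,\cdot)$ is non-increasing on $(-\infty,p^0_\alpha)$ and non-decreasing on $(p^0_\alpha,+\infty)$. (B-ii) For each $\alpha=L,R$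 and all $(t,x)$, $p\mapsto H_\alpha(t,x,p)$ is convex. Viscosity solutions. For a locally bounded function $u$, $u^*$ and $u_*$ are its upper and lower semi-continuous envelopes. $u$ is a sub-solution (resp. super-solution) of an equation if, whenever a $C^1$ test function $\varphi$ touches $u^*$ from above (resp. $u_*$ from below) at a point, $\varphi$ satisfies the equation at that point with $\le$ (resp. $\ge$). A solution is both; solutions may be discontinuous. Homogenized Hamiltonians. For $p\in\mathbb{R}$, $\alpha\in\{L,R\}$, $\bar H_\alpha(p)$ is the unique $\lambda\in\mathbb{R}$ for which there is a bounded $\mathbb{Z}^2$-periodic (in $(t,x)$) viscosity solution $v^\alpha$ of $v^\alpha_t+H_\alpha(t,x,p+v^\alpha_x)=\lambda$ in $\mathbb{R}\times\mathbb{R}$; the functions $\bar H_\alpha$ are continuous, coercive and quasi-convex (sublevel sets are convex). Let $\bar p^0_\alpha\in\operatorname{argmin}\bar H_\alpha$; set $\bar H_\alpha^-(p)=\bar H_\alpha(p)$ if $p<\bar p^0_\alpha$ and $\bar H_\alpha^-(p)=\bar H_\alpha(\bar p^0_\alpha)$ if $p\ge\bar p^0_\alpha$; $\bar H_\alpha^+(p)=\bar H_\alpha(\bar p^0_\alpha)$ if $p\le\bar p^0_\alpha$ and $\bar H_\alpha^+(p)=\bar H_\alpha(p)$ if $p>\bar p^0_\alpha$. Effective flux limiter. $\bar A$ is the infimum of the set of $\lambda\in\mathbb{R}$ for which there is a sub-solution $w$, $1$-periodic in $t$, of $w_t+H(t,x,w_x)=\lambda$ in $\mathbb{R}\times\mathbb{R}$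 (this set is non-empty and bounded from below, and $\bar A\ge\max_{\alpha=L,R}\min\bar H_\alpha$). *)

(* Defs.v *)
From HB Require Import structures.
From mathcomp Require Import all_boot all_order all_algebra.
From mathcomp Require Import all_classical all_reals all_analysis.
Import Order.TTheory GRing.Theory Num.Theory.
Import numFieldNormedType.Exports.

Set Implicit Arguments.
Unset Strict Implicit.
Unset Printing Implicit Defensive.

Local Open Scope classical_set_scope.
Local Open Scope ring_scope.

(** Points of the space-time plane are pairs [(t, x) : R * R]; Hamiltonians are
    curried functions [H t x p]. *)

Section Viscosity.
Context {R : realType}.

Definition locally_bdd (u : R * R -> R) :=
  forall z : R * R, exists M : R, \forall y \near z, `|u y| <= M.

(** The neighbourhoods of [z] contain [z] itself, so that these limsup and
    liminf are the semicontinuous envelopes of [u]. *)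
Definition usc_env (u : R * R -> R) (z : R * R) : \bar R :=
  limf_esup (EFin \o u) (nbhs z).
Definition lsc_env (u : R * R -> R) (z : R * R) : \bar R :=
  limf_einf (EFin \o u) (nbhs z).

Definition dt (phi : R * R -> R) (z : R * R) : R :=
  derive1 (fun s : R => phi (s, z.2)) z.1.
Definition dx (phi : R * R -> R) (z : R * R) : R :=
  derive1 (fun y : R => phi (z.1, y)) z.2.

(** [phi] is of class C^1 on the plane: both partial derivatives exist
    everywhere and are jointly continuous. *)
Definition C1 (phi : R * R -> R) :=
  [/\ forall z, derivable (fun s : R => phi (s, z.2)) z.1 1,
      forall z, derivable (fun y : R => phi (z.1, y)) z.2 1,
      continuous (dt phi) & continuous (dx phi)].

Definition touches_above (phi u : R * R -> R) (z : R * R) :=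
  usc_env u z = (phi z)%:E /\ \forall y \near z, (usc_env u y <= (phi y)%:E)%E.
Definition touches_below (phi u : R * R -> R) (z : R * R) :=
  lsc_env u z = (phi z)%:E /\ \forall y \near z, ((phi y)%:E <= lsc_env u y)%E.

(** Viscosity sub- and super-solutions of [u_t + H(t,x,u_x) = lam] in the
    whole plane. *)
Definition subsolution (H : R -> R -> R -> R) (lam : R) (u : R * R -> R) :=
  locally_bdd u /\
  forall (phi : R * R -> R) (z : R * R), C1 phi -> touches_above phi u z ->
    dt phi z + H z.1 z.2 (dx phi z) <= lam.
Definition supersolution (H : R -> R -> R -> R) (lam : R) (u : R * R -> R) :=
  locally_bdd u /\
  forall (phi : R * R -> R) (z : R * R), C1 phi -> touches_below phi u z ->
    lam <= dt phi z + H z.1 z.2 (dx phi z).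
Definition solution (H : R -> R -> R -> R) (lam : R) (u : R * R -> R) :=
  subsolution H lam u /\ supersolution H lam u.

Definition t_periodic (u : R * R -> R) := forall t x, u (t + 1, x) = u (t, x).
Definition Z2_periodic (u : R * R -> R) :=
  forall (k j : int) t x, u (t + k%:~R, x + j%:~R) = u (t, x).

End Viscosity.

Section Assumptions.
Context {R : realType}.
Implicit Types H HL HR Ha : R -> R -> R -> R.

Definition assA0 H := continuous (fun z : R * R * R => H z.1.1 z.1.2 z.2).

Definition assA1 H := forall (k : int) t x p, H (t + k%:~R) x p = H t x p.

(** Only the values on the nonnegative half-line matter; a modulus in this sense
    always has a continuous modulus above it. *)
Definition modulus (om : R -> R) :=
  [/\ om 0 = 0, {in `[0, +oo[ &, {homo om : r s / r <= s}}
    & om r @[r --> 0^'+] --> (0 : R)].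

Definition assA2 H := exists om : R -> R, modulus om /\
  forall t s x p,
    H t x p - H s x p <= om (`|t - s| * (1 + Num.max (H s x p) 0)).

Definition assA3 H :=
  forall M : R, exists K : R, forall t x q, K <= `|q| -> M <= H t x q.

Definition valley (f : R -> R) (p0 : R) :=
  {in `]-oo, p0[ &, {homo f : p q /~ p <= q}} /\
  {in `]p0, +oo[ &, {homo f : p q / p <= q}}.

Definition assA4 H := exists rho0 : R, 0 < rho0 /\
  forall x, ~ (- rho0 < x < rho0) ->
    exists p0 : R -> R, continuous p0 /\ forall t, valley (H t x) (p0 t).

Definition assA5 H HL HR :=
  [/\ forall e : R, 0 < e -> exists N : int, forall k : int, (k <= N)%R ->
        forall t x p, 0 <= t <= 1 -> 0 <= x <= 1 ->
          `|H t (x + k%:~R) p - HL t x p| < e,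
      forall e : R, 0 < e -> exists N : int, forall k : int, (N <= k)%R ->
        forall t x p, 0 <= t <= 1 -> 0 <= x <= 1 ->
          `|H t (x + k%:~R) p - HR t x p| < e,
      forall (k j : int) t x p, HL (t + k%:~R) (x + j%:~R) p = HL t x p
    & forall (k j : int) t x p, HR (t + k%:~R) (x + j%:~R) p = HR t x p].

Definition assBi Ha :=
  (forall t s x p, Ha t x p = Ha s x p) /\
  exists p0 : R, forall t x, valley (Ha t x) p0.

Definition assBii Ha := forall t x, convex_function [set: R^o] (Ha t x).

End Assumptions.

Section Effective.
Context {R : realType}.
Implicit Types H Ha : R -> R -> R -> R.

Definition cell_values Ha (p : R) : set R :=
  [set lam | exists v : R * R -> R,
    [/\ exists M : R, forall z, `|v z| <= M, Z2_periodic v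
      & solution (fun t x q => Ha t x (p + q)) lam v]].

(** The homogenized Hamiltonian at [p] is the (unique) element of
    [cell_values Ha p]. *)
Definition Hbar Ha (p : R) : R := xget 0 (cell_values Ha p).

Definition argmin (f : R -> R) : set R := [set p0 | forall p, f p0 <= f p].

Definition nonincr_part (f : R -> R) (p0 p : R) : R :=
  if p < p0 then f p else f p0.
Definition nondecr_part (f : R -> R) (p0 p : R) : R :=
  if p <= p0 then f p0 else f p.

Definition flux_limiter H : R :=
  inf [set lam | exists w : R * R -> R, subsolution H lam w /\ t_periodic w].

Definition levelR (f : R -> R) (p0 A : R) : set R :=
  [set p | nondecr_part f p0 p = f p /\ f p = A].
Definition levelL (f : R -> R) (p0 A : R) : set R :=
  [set p | nonincr_part f p0 p = f p /\ f p = A].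

Definition is_min (E : set R) (m : R) := E m /\ lbound E m.
Definition is_max (E : set R) (m : R) := E m /\ ubound E m.

Definition rescale (w : R * R -> R) (eps : R) (z : R * R) : R :=
  eps * w (eps^-1 * z.1, eps^-1 * z.2).

End Effective.

(* Main.v *)
Require Import Defs.
From mathcomp Require Import all_boot all_order all_algebra.
From mathcomp Require Import all_classical all_reals all_analysis.
From mathcomp Require Import lra ring.
Import Order.TTheory GRing.Theory Num.Theory.
Import numFieldNormedType.Exports.
Local Open Scope classical_set_scope.
Local Open Scope ring_scope.
Set Implicit Arguments.
Unset Strict Implicit.
Unset Printing Implicit Defensive.

(** Fix a strip [|x| < rho] and the discount [rho ^- 2]. Perron's method between
    constants, with a large constant value imposed outside the strip, yields a
    state-constrained solution of the discounted equation there. Normalised to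
    vanish at the origin, these solutions [w n] have a uniform modulus up to an
    additive constant; along an ultrafilter their levels converge to some
    [lamb], and a second use of Perron's method, between the half-relaxed
    limits, gives a solution [u] of level [lamb] within a bounded distance of
    the upper limit [U].

    Everything else is a comparison with the [w n], whose values outside
    the strip exceed any affine growth. A periodic sub-solution of
    smaller level would be below them everywhere, so [lamb] is the flux
    limiter. A corrector of slope [p] with [Hbar HR p < lamb] lies below [w n]
    for large [x], which bounds the growth of [U] from below. Conversely, if
    [q] is an extremal mean slope of [U] over long intervals of the right tail
    (Fekete), comparing [U] there with the corrector of slope [q], tilted by a
    small parabola, gives [Hbar HR q <= lamb]. The left side follows by
    reflection, and compactness turns the ultrafilter limit of the rescaled
    [u] into a subsequence. *)

(** * Semicontinuous envelopes and half-relaxed limits *)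

Section Envelopes.
Context {R : realType}.
Implicit Types (u v U V phi : R * R -> R) (z y : R * R).

(** The oscillation estimates hold only up to an additive constant, since solutions may jump; the
    [w n] are therefore not equicontinuous, and their upper and lower half-relaxed limits may differ
    by a bounded amount. Hence the second Perron construction. Slopes at infinity are insensitive to
    bounded errors and are read off the upper limit [U]. The delicate point is comparison: tail
    slopes are detected on windows of arbitrary length and position, so its constants must not
    depend on the functions compared, whereas (A2) controls the variation of [H] in time only
    through a modulus of |t - s| (1 + max(H, 0)), which must be made small uniformly. Working along
    an ultrafilter makes every bounded sequence converge, so that [w n] has a limit at every point
    of the plane without diagonal extraction. *)

Definition box z (r : R) : set (R * R) :=
  [set y | `|y.1 - z.1| < r /\ `|y.2 - z.2| < r].

Lemma box_center z (r : R) : 0 < r -> box z r z.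
Proof. by move=> r0; rewrite /box /= !subrr normr0. Qed.

Lemma box_sub z (r s : R) : r <= s -> box z r `<=` box z s.
Proof. by move=> rs y [h1 h2]; split; lra. Qed.

Lemma near_box z (P : set (R * R)) :
  (\forall y \near z, P y) <-> exists2 r : R, 0 < r & box z r `<=` P.
Proof.
split.
  move=> /nbhs_ballP [r r0 h]; exists r => // y [h1 h2]; apply: h.
  by split; rewrite -ball_normE /= distrC.
move=> [r r0 h]; apply/nbhs_ballP; exists r => // y [].
by rewrite -!ball_normE /= => h1 h2; apply: h; split; rewrite distrC.
Qed.

Definition usc (U : R * R -> R) := forall z (e : R), 0 < e ->
  exists2 r : R, 0 < r & forall y, box z r y -> U y < U z + e.

Section Relaxed.
Context {I : Type} (F : set_system I).

Definition evb (w : I -> R * R -> R) z (M : R) :=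
  exists2 r : R, 0 < r & F [set i | forall y, box z r y -> w i y <= M].

(** This is the upper half-relaxed limit of the family along [F]; lower ones are always taken
    through negation. The infimum is meaningful under [lbd]. *)
Definition ulim (w : I -> R * R -> R) z : R := inf [set M | evb w z M].

Definition lbd (w : I -> R * R -> R) := forall z, exists M : R,
  exists2 r : R, 0 < r & F [set i | forall y, box z r y -> `|w i y| <= M].

Hypothesis PF : ProperFilter F.
Variable w : I -> R * R -> R.
Hypothesis bw : lbd w.

Let evb_inf z : has_inf [set M | evb w z M].
Proof.
have [M0 [r r0 FM]] := bw z; split.
  exists M0; exists r => //; apply: filterS FM => i h y /h.
  by move=> h1; exact: le_trans (ler_norm _) h1.
exists (- M0) => M [s s0 FM'].
have [i [h1 h2]] := filter_ex (filterI FM FM').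
have := h1 z (box_center z r0); have := h2 z (box_center z s0).
rewrite ler_norml => ? /andP[? ?]; lra.
Qed.

Lemma ulim_lt z (e : R) : 0 < e ->
  exists2 r : R, 0 < r & F [set i | forall y, box z r y -> w i y < ulim w z + e].
Proof.
move=> e0; have [M [r r0 FM] Me] := inf_adherent e0 (evb_inf z).
exists r => //; apply: filterS FM => i h y /h ?; exact: le_lt_trans Me.
Qed.

Lemma ulim_le z (M : R) : evb w z M -> ulim w z <= M.
Proof. by move=> h; apply: ge_inf => //; case: (evb_inf z). Qed.

Lemma ulim_ge z (b : R) : (forall M, evb w z M -> b <= M) -> b <= ulim w z.
Proof. by move=> h; apply: lb_le_inf; [case: (evb_inf z)|move=> M /h]. Qed.

Lemma ulim_freq z (e r : R) S : 0 < e -> 0 < r -> F S ->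
  exists i, S i /\ exists2 y, box z r y & ulim w z - e < w i y.
Proof.
move=> e0 r0 FS; apply: contrapT => h.
suff : ulim w z <= ulim w z - e by lra.
apply: ulim_le; exists r => //; apply: filterS FS => i Si y By.
by rewrite leNgt; apply/negP => hy; apply: h; exists i; split => //; exists y.
Qed.

Lemma usc_ulim : usc (ulim w).
Proof.
move=> z e e0; have e2 : 0 < e / 2 by lra.
have [r r0 Fr] := ulim_lt z e2; exists (r / 2); first lra.
move=> y [y1 y2]; suff : ulim w y <= ulim w z + e / 2 by lra.
apply: ulim_le; exists (r / 2); first lra.
apply: filterS Fr => i h x [x1 x2]; apply/ltW/h; split.
  rewrite (_ : x.1 - z.1 = (x.1 - y.1) + (y.1 - z.1)); last by ring.
  by apply: le_lt_trans (ler_normD _ _) _; lra.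
rewrite (_ : x.2 - z.2 = (x.2 - y.2) + (y.2 - z.2)); last by ring.
by apply: le_lt_trans (ler_normD _ _) _; lra.
Qed.

End Relaxed.

(** Seen as the half-relaxed limit of a constant family over a one-point filter, the upper
    semicontinuous envelope inherits the facts about [ulim]. *)
Definition star u : R * R -> R := ulim (globally [set tt]) (fun=> u).

Lemma tt_proper : ProperFilter (globally [set tt]).
Proof. exact: globally_properfilter. Qed.

Lemma locally_bddP u : locally_bdd u <->
  forall z, exists M r : R, 0 < r /\ forall y, box z r y -> `|u y| <= M.
Proof.
split=> h z; have [M] := h z.
  by move=> /near_box[r r0 hr]; exists M, r.
by move=> [r [r0 hr]]; exists M; apply/near_box; exists r.
Qed.

Lemma lbd_tt u : locally_bdd u -> lbd (globally [set tt]) (fun=> u).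
Proof.
move=> /locally_bddP h z; have [M [r [r0 hr]]] := h z.
by exists M, r => // i _ y; exact: hr.
Qed.

Lemma locally_bddN u : locally_bdd u -> locally_bdd (fun z => - u z).
Proof.
move=> /locally_bddP h; apply/locally_bddP => z; have [M [r [r0 hr]]] := h z.
by exists M, r; split => // y; rewrite normrN; exact: hr.
Qed.

Lemma star_lt u z (e : R) : locally_bdd u -> 0 < e ->
  exists2 r : R, 0 < r & forall y, box z r y -> u y < star u z + e.
Proof.
move=> bu e0; have [r r0 h] := ulim_lt tt_proper (lbd_tt bu) z e0.
by exists r => // y; exact: (h tt).
Qed.

Lemma star_le u z (r M : R) : locally_bdd u -> 0 < r ->
  (forall y, box z r y -> u y <= M) -> star u z <= M.
Proof.
move=> bu r0 h; apply: (ulim_le tt_proper (lbd_tt bu)).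
by exists r => // i _.
Qed.

Lemma star_freq u z (e r : R) : locally_bdd u -> 0 < e -> 0 < r ->
  exists2 y, box z r y & star u z - e < u y.
Proof.
move=> bu e0 r0.
have [i [_ [y h1 h2]]] := ulim_freq tt_proper (lbd_tt bu) z e0 r0 filterT.
by exists y.
Qed.

Lemma le_star u z : locally_bdd u -> u z <= star u z.
Proof.
move=> bu; apply/ler_addgt0Pr => e e0; have [r r0 h] := star_lt z bu e0.
by apply/ltW/h; exact: box_center.
Qed.

Lemma star_ge u z (b : R) : locally_bdd u ->
  (forall r, 0 < r -> exists2 y, box z r y & b <= u y) -> b <= star u z.
Proof.
move=> bu h; apply/ler_addgt0Pr => e e0; have [r r0 hr] := star_lt z bu e0.
by have [y /hr ? ?] := h r r0; lra.
Qed.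

Lemma usc_star u : locally_bdd u -> usc (star u).
Proof. by move=> bu; apply: usc_ulim; [exact: tt_proper|exact: lbd_tt]. Qed.

Lemma le_star2 u v z (r : R) : locally_bdd u -> locally_bdd v -> 0 < r ->
  (forall y, box z r y -> u y <= v y) -> star u z <= star v z.
Proof.
move=> bu bv r0 h; apply/ler_addgt0Pr => e e0; have [s s0 hs] := star_lt z bv e0.
have m0 : 0 < Num.min r s by rewrite lt_min r0.
apply: (star_le bu m0) => y [y1 y2].
move: y1 y2; rewrite !lt_min => /andP[? ?] /andP[? ?].
by apply: (le_trans (h y _)); [split|apply/ltW/hs; split].
Qed.

Lemma star_id u : usc u -> locally_bdd u -> star u = u.
Proof.
move=> uu bu; apply/funext => z; apply/eqP; rewrite eq_le le_star // andbT.
apply/ler_addgt0Pr => e e0; have [r r0 h] := uu z e e0.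
by apply: (star_le bu r0) => y /h /ltW.
Qed.

(** Local boundedness makes the extended-real envelope finite; viscosity conditions can then be
    handled with the real-valued [star]. *)
Lemma usc_envE u z : locally_bdd u -> usc_env u z = (star u z)%:E.
Proof.
move=> bu; rewrite /usc_env /limf_esup; apply/eqP; rewrite eq_le; apply/andP; split.
  apply/lee_addgt0Pr => e e0; have [r r0 h] := star_lt z bu e0.
  apply: (@le_trans _ _ (ereal_sup ((EFin \o u) @` box z r))).
    apply: ereal_inf_lbound; exists (box z r) => //.
    by apply/near_box; exists r.
  apply: ub_ereal_sup => _ [y By <-] /=.
  by rewrite -EFinD lee_fin; apply/ltW/h.
apply: le_ereal_inf_tmp => _ [V Vz <-].
have [r r0 rV] := (near_box z V).1 Vz.
case E : (ereal_sup _) => [s| |]; [|by rewrite leey|].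
  rewrite lee_fin; apply: (star_le bu r0) => y /rV Vy.
  by rewrite -lee_fin -E; apply: ereal_sup_ubound; exists y.
have : ((u z)%:E <= ereal_sup ((EFin \o u) @` V))%E.
  by apply: ereal_sup_ubound; exists z => //; apply: rV; exact: box_center.
by rewrite E leeNy_eq.
Qed.

Lemma lsc_envE u z : locally_bdd u ->
  lsc_env u z = (- star (fun z => - u z) z)%:E.
Proof.
move=> bu; rewrite EFinN -usc_envE; last exact: locally_bddN.
by [].
Qed.

End Envelopes.

(** * Calculus of C^1 test functions *)

Section TestFunctions.
Context {R : realType}.
Implicit Types (phi chi : R * R -> R) (z y : R * R).

Lemma derivable_cont (f : R -> R) x : derivable f x 1 -> {for x, continuous f}.
Proof. by move=> /derivable1_diffP; exact: differentiable_continuous. Qed.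

(** [C1] speaks only of partial derivatives, so joint continuity has to be recovered: a step in [t]
    along the line through [z], then a step in [x] by the mean value theorem, with [dx phi] bounded
    near [z]. *)
Lemma C1_cont phi : C1 phi -> continuous phi.
Proof.
move=> [d1 d2 c1 c2] z; apply/cvgrPdist_lt => e e0.
have /cvgrPdist_lt /(_ 1 ltr01) /near_box [r r0 hr] := c2 z.
have /cvgrPdist_lt /(_ (e / 2)) : {for z.1, continuous (fun s => phi (s, z.2))}.
  exact/derivable_cont/d1.
have e2 : 0 < e / 2 by lra.
move=> /(_ e2) /nbhs_ballP [s s0 hs].
set K := `|dx phi z| + 1; have K0 : 0 < K by rewrite ltr_wpDl.
set q := Num.min (Num.min r s) (e / (2 * K)).
have q0 : 0 < q by rewrite !lt_min r0 s0 divr_gt0 // mulr_gt0.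
apply/near_box; exists q => // y [y1 y2].
move: (y1) (y2); rewrite !lt_min => /andP[/andP[a1 a2] a3] /andP[/andP[b1 b2] b3].
have h1 : `|phi (y.1, z.2) - phi z| < e / 2.
  rewrite distrC [phi z](_ : _ = phi (z.1, z.2)); last by case: (z).
  by apply: hs; rewrite -ball_normE /= distrC.
suff h2 : `|phi y - phi (y.1, z.2)| <= K * `|y.2 - z.2|.
  rewrite (_ : phi z - phi y = - ((phi y - phi (y.1, z.2)) + (phi (y.1, z.2) - phi z))); last by ring.
  rewrite normrN; apply: le_lt_trans (ler_normD _ _) _.
  suff : K * `|y.2 - z.2| < e / 2 by lra.
  rewrite mulrC -ltr_pdivlMr //.
  by apply: lt_le_trans b3 _; rewrite invfM mulrA.
have der (x : R) : is_derive x 1 (fun x => phi (y.1, x)) (dx phi (y.1, x)).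
  by apply: DeriveDef; [exact: (d2 (y.1, x))|rewrite -derive1E].
have [c [cb ->]] : exists c, `|c - z.2| <= `|y.2 - z.2| /\
    phi y - phi (y.1, z.2) = dx phi (y.1, c) * (y.2 - z.2).
  have cc a b : {within `[a, b], continuous (fun x => phi (y.1, x))}.
    by apply: derivable_within_continuous => x _; exact: (d2 (y.1, x)).
  rewrite [phi y](_ : _ = phi (y.1, y.2)); last by case: (y).
  have [lt|gt|->] := ltgtP z.2 y.2.
  - have [c] := MVT lt (fun x _ => der x) (cc _ _).
    rewrite in_itv /= => /andP[c1' c2'] ->; exists c; split => //.
    by rewrite !ger0_norm ?subr_ge0; clear -c1' c2' lt; lra.
  - have [c] := MVT gt (fun x _ => der x) (cc _ _).
    rewrite in_itv /= => /andP[c1' c2'] E; exists c; split; last by lra.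
    by rewrite !ler0_norm ?subr_le0; clear -c1' c2' gt; lra.
  - by exists y.2; rewrite !subrr mulr0.
rewrite normrM ler_wpM2r //.
have : `|dx phi z - dx phi (y.1, c)| < 1.
  by apply: hr; split => /=; lra.
rewrite /K => h.
rewrite (_ : dx phi (y.1, c) = dx phi z - (dx phi z - dx phi (y.1, c))); last by ring.
by apply: le_trans (ler_normB _ _) _; lra.
Qed.

(** Explicit test functions below separate the variables, so that derivatives are only ever computed
    in one variable. *)
Lemma C1_sep (a b a' b' : R -> R) :
  (forall t : R, is_derive t 1 a (a' t)) -> (forall x : R, is_derive x 1 b (b' x)) ->
  continuous a' -> continuous b' ->
  let phi := fun z : R * R => a z.1 + b z.2 in
  [/\ C1 phi, forall z, dt phi z = a' z.1 & forall z, dx phi z = b' z.2].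
Proof.
move=> da db ca cb phi.
have D1 z : is_derive z.1 1 (fun s : R => phi (s, z.2)) (a' z.1).
  by rewrite -[a' _]addr0; apply: (is_deriveD (da z.1) (is_derive_cst (b z.2) z.1 1)).
have D2 z : is_derive z.2 1 (fun s : R => phi (z.1, s)) (b' z.2).
  by rewrite -[b' _]add0r; apply: (is_deriveD (is_derive_cst (a z.1) z.2 1) (db z.2)).
have E1 : dt phi = a' \o fst.
  by apply/funext => z; rewrite /dt derive1E; have [] := D1 z.
have E2 : dx phi = b' \o snd.
  by apply/funext => z; rewrite /dx derive1E; have [] := D2 z.
split; [|by rewrite E1|by rewrite E2].
split=> [z|z||]; [by have [] := D1 z|by have [] := D2 z|rewrite E1|rewrite E2].
  by move=> z; apply: continuous_comp; [exact: cvg_fst|exact: ca].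
by move=> z; apply: continuous_comp; [exact: cvg_snd|exact: cb].
Qed.

Lemma C1_add phi chi : C1 phi -> C1 chi ->
  [/\ C1 (fun z => phi z + chi z),
      forall z, dt (fun z => phi z + chi z) z = dt phi z + dt chi z
    & forall z, dx (fun z => phi z + chi z) z = dx phi z + dx chi z].
Proof.
move=> [a1 a2 a3 a4] [b1 b2 b3 b4].
have E1 z : dt (fun z => phi z + chi z) z = dt phi z + dt chi z.
  by rewrite /dt !derive1E; apply: (deriveD (a1 z) (b1 z)).
have E2 z : dx (fun z => phi z + chi z) z = dx phi z + dx chi z.
  by rewrite /dx !derive1E; apply: (deriveD (a2 z) (b2 z)).
split; [split|exact: E1|exact: E2].
- by move=> z; apply: (derivableD (a1 z) (b1 z)).
- by move=> z; apply: (derivableD (a2 z) (b2 z)).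
- by rewrite (funext E1) => z; apply: continuousD; [exact: a3|exact: b3].
- by rewrite (funext E2) => z; apply: continuousD; [exact: a4|exact: b4].
Qed.

Lemma C1_opp phi : C1 phi ->
  [/\ C1 (fun z => - phi z),
      forall z, dt (fun z => - phi z) z = - dt phi z
    & forall z, dx (fun z => - phi z) z = - dx phi z].
Proof.
move=> [a1 a2 a3 a4].
have E1 z : dt (fun z => - phi z) z = - dt phi z.
  by rewrite /dt !derive1E; apply: (deriveN (a1 z)).
have E2 z : dx (fun z => - phi z) z = - dx phi z.
  by rewrite /dx !derive1E; apply: (deriveN (a2 z)).
split; [split|exact: E1|exact: E2].
- by move=> z; apply: (derivableN (a1 z)).
- by move=> z; apply: (derivableN (a2 z)).
- by rewrite (funext E1) => z; apply: continuousN; exact: a3.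
- by rewrite (funext E2) => z; apply: continuousN; exact: a4.
Qed.

(** The difference has an interior maximum in each variable. Consequently a C^1 function that
    satisfies the inequality classically is a viscosity sub-solution: any test function above it
    carries the same derivatives. *)
Lemma C1_touch phi chi z (r : R) : C1 phi -> C1 chi -> 0 < r ->
  chi z = phi z -> (forall y, box z r y -> chi y <= phi y) ->
  dt chi z = dt phi z /\ dx chi z = dx phi z.
Proof.
move=> cp cc r0 E h.
have crit (f : R -> R) (x : R) : (forall y : R, derivable f y 1) ->
    (forall y : R, `|y - x| < r -> f y <= f x) -> f^`()%classic x = 0.
  move=> df hm; rewrite derive1E.
  have ab : x - r <= x + r by lra.
  have xi : x \in `]x - r, x + r[ by rewrite in_itv /=; lra.
  have mx t : t \in `]x - r, x + r[ -> f t <= f x.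
    by rewrite in_itv /= => ht; apply: hm; rewrite ltr_norml; lra.
  by have [] := derive1_at_max ab (fun t _ => df t) xi mx.
have [cn tn xn] := C1_opp cp; have [cs ts xs] := C1_add cc cn.
have [s1 s2 _ _] := cs.
have : dt (fun y => chi y + - phi y) z = 0.
  apply: crit => [y|y hy]; first exact: (s1 (y, z.2)).
  by move: E (h (y, z.2)); case: z hy {h} => z1 z2 /= hy -> H; rewrite subrr subr_le0 H //; split; rewrite //= subrr normr0.
have : dx (fun y => chi y + - phi y) z = 0.
  apply: crit => [y|y hy]; first exact: (s2 (z.1, y)).
  by move: E (h (z.1, y)); case: z hy {h} => z1 z2 /= hy -> H; rewrite subrr subr_le0 H //; split; rewrite //= subrr normr0.
by rewrite ts xs tn xn; lra.
Qed.

Definition quad z0 (y : R * R) : R := (y.1 - z0.1) ^+ 2 + (y.2 - z0.2) ^+ 2.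

Lemma is_derive_sqr (c x : R) : is_derive x 1 (fun s : R => (s - c) ^+ 2) (2 * (x - c)).
Proof.
have -> : (fun s : R => (s - c) ^+ 2) = (fun s : R => s - c) ^+ 2.
  by apply/funext => s; rewrite !fctE.
apply: is_derive_eq; rewrite subr0.
by rewrite scaler1 expr1 mulr_natl mulr2n; lra.
Qed.

Lemma C1_quad z0 : [/\ C1 (quad z0), forall z, dt (quad z0) z = 2 * (z.1 - z0.1)
  & forall z, dx (quad z0) z = 2 * (z.2 - z0.2)].
Proof.
have cc c : continuous (fun x : R => 2 * (x - c)).
  by move=> x; apply: cvgM; [exact: cvg_cst|apply: cvgB; [exact: cvg_id|exact: cvg_cst]].
exact: (C1_sep (is_derive_sqr _) (is_derive_sqr _) (cc _) (cc _)).
Qed.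

(** A one-sided C^1 penalty: added to a line, it leaves the part before a given point untouched and
    bends the rest upwards. *)
Definition posq (x : R) : R := (Num.max x 0) ^+ 2.

Lemma posq_taylor (x h : R) :
  `|posq (h + x) - posq x - 2 * Num.max x 0 * h| <= h ^+ 2.
Proof.
rewrite /posq; case: (leP x 0) => x0; case: (leP (h + x) 0) => h0.
- by rewrite !expr0n /= subrr mulr0 mul0r subrr normr0 sqr_ge0.
- rewrite ger0_norm; nra.
- rewrite ger0_norm; nra.
- by rewrite (_ : _ - _ = h ^+ 2) ?ger0_norm ?sqr_ge0 //; ring.
Qed.

Lemma is_derive_posq (x : R) : is_derive x 1 posq (2 * Num.max x 0).
Proof.
have H : (fun h : R => h^-1 *: (posq (h *: 1 + x) - posq x)) h @[h --> 0^'] --> 2 * Num.max x 0.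
  apply/cvgrPdist_le => e e0; near=> h.
  have hn0 : h != 0 by near: h; exact: nbhs_dnbhs_neq.
  have he : `|h| <= e by near: h; apply: dnbhs0_le.
  apply: le_trans he; rewrite -[h *: 1]/(h * 1) mulr1.
  rewrite -[_ *: _]/(_ * _) distrC.
  rewrite (_ : _ - _ = h^-1 * (posq (h + x) - posq x - 2 * Num.max x 0 * h)); last by field.
  rewrite normrM normfV ler_pdivrMl ?normr_gt0 // -expr2 real_normK ?num_real //.
  exact: posq_taylor.
apply: DeriveDef; first by apply: cvgP H.
exact: cvg_lim H.
Unshelve. all: by end_near. Qed.

End TestFunctions.

(** * Maxima of upper semicontinuous functions on compact sets *)

Section UscMax.
Context {R : realType}.

(** If the supremum were not attained, each point would have a neighbourhood on which [f] stays
    below a level smaller than the supremum, and compactness would make that level uniform.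
    Boundedness is the same argument with levels tending to infinity. *)
Lemma usc_compact_max (T : topologicalType) (K : set T) (f : T -> R) :
  compact K -> K !=set0 ->
  (forall z e, 0 < e -> \forall y \near z, f y < f z + e) ->
  exists2 z, K z & forall y, K y -> f y <= f z.
Proof.
move=> cK [k0 Kk0] hf.
have /compact_near_coveringP cv := cK.
have [M hM] : exists M : R, forall y, K y -> f y <= M.
  have FF : Filter (pinfty_nbhs R) by typeclasses eauto.
  have /cv /filter_ex [M hM] : forall x, K x -> \forall x' \near x & i \near (pinfty_nbhs R), f x' < i.
    move=> x Kx; exists ([set y | f y < f x + 1], [set i | f x + 1 <= i]) => /=.
      by split; [exact: hf|exact: (nbhs_pinfty_ge (num_real _))].
    by move=> [a b] /= [h1 h2]; exact: lt_le_trans h2.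
  by exists M => y /hM /ltW.
have hs : has_sup (f @` K) by split; [exists (f k0), k0|exists M => _ [y /hM ? <-]].
set s := sup (f @` K).
have le y : K y -> f y <= s by move=> Ky; apply: sup_upper_bound => //; exists y.
apply: contrapT => h.
have lt y : K y -> f y < s.
  move=> Ky; rewrite lt_neqAle le // andbT; apply/eqP => E; apply: h.
  by exists y => // x /le; rewrite E.
have /cv /filter_ex [c hc] : forall x, K x ->
    \forall x' \near x & i \near s^'-, i < s /\ f x' < i.
  move=> x Kx; have fx := lt x Kx.
  exists ([set y | f y < f x + (s - f x) / 2], [set i | f x + (s - f x) / 2 <= i < s]) => /=.
    split; first by apply: hf; lra.
    by near=> i; apply/andP; split; near: i; [apply: nbhs_left_ge; lra|exact: nbhs_left_lt].
  by move=> [a b] /= [h1 /andP[h2 h3]]; split => //; exact: lt_le_trans h2.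
have : s <= c.
  by apply: ge_sup; [exists (f k0), k0|move=> _ [y /hc [_ /ltW ?] <-]].
by have [+ _] := hc _ Kk0; lra.
Unshelve. all: by end_near. Qed.

End UscMax.

Lemma cvg_to_pair (T : Type) (X Y : topologicalType) (F : set_system T)
    (f : T -> X) (g : T -> Y) (a : X) (b : Y) : Filter F ->
  f @ F --> a -> g @ F --> b -> (fun x => (f x, g x)) @ F --> (a, b).
Proof. move=> FF fa gb; exact: (cvg_pair fa gb). Qed.

(** * Stability of sub-solutions and affine changes of variables *)

Section Viscosity.
Context {R : realType}.
Implicit Types (u v w U V phi chi : R * R -> R) (z : R * R).
Implicit Types (G H : R -> R -> R -> R) (al lam : R) (Om D : set R).

Lemma minr_gt0 (a b : R) : 0 < a -> 0 < b -> 0 < Num.min a b.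
Proof. by move=> a0 b0; rewrite lt_min a0. Qed.

(** Here [U] is meant to be semicontinuous already, the envelope being inserted by the caller; [al]
    is the discount. The pointwise form lets the region of validity vary. *)
Definition vsub_at al G lam U z := forall phi, C1 phi -> U z = phi z ->
  (exists2 r : R, 0 < r & forall y, box z r y -> U y <= phi y) ->
  al * U z + dt phi z + G z.1 z.2 (dx phi z) <= lam.

Definition vsub Om al G lam U := forall z, Om z.2 -> vsub_at al G lam U z.

Definition neg u : R * R -> R := fun z => - u z.

(** Under a change of sign, super-solutions of [G] at level [lam] become sub-solutions of this
    operator at level [- lam]. Only sub-solutions are studied; super-solutions enter through
    [star (neg u)]. *)
Definition Gneg G : R -> R -> R -> R := fun t x p => - G t x (- p).

Definition Eop al G phi : R * R -> R :=
  fun z => al * phi z + dt phi z + G z.1 z.2 (dx phi z).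

Lemma Eop_cont al G phi : assA0 G -> C1 phi -> continuous (Eop al G phi).
Proof.
move=> cG cp; have cc := C1_cont cp; have [_ _ c1 c2] := cp => z.
apply: cvgD; first by apply: cvgD; [apply: cvgM; [exact: cvg_cst|exact: cc]|exact: c1].
pose h := fun z : R * R => (z, dx phi z).
apply: (@continuous_comp _ _ _ h (fun z : R * R * R => G z.1.1 z.1.2 z.2)).
  by rewrite /continuous_at /h; apply: cvg_to_pair; [exact: cvg_id|exact: c2].
exact: cG.
Qed.

Lemma cont_box phi z (e : R) : continuous phi -> 0 < e ->
  exists2 r : R, 0 < r & forall y, box z r y -> `|phi y - phi z| < e.
Proof.
move=> /(_ z) /cvgrPdist_lt h e0; have /near_box [r r0 hr] := h e e0.
by exists r => // y /hr; rewrite distrC.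
Qed.

Lemma box_trans z (a b : R) y x : box z a y -> box y b x -> box z (a + b) x.
Proof.
move=> [y1 y2] [x1 x2]; split.
  rewrite (_ : x.1 - z.1 = (x.1 - y.1) + (y.1 - z.1)); last by ring.
  by apply: le_lt_trans (ler_normD _ _) _; lra.
rewrite (_ : x.2 - z.2 = (x.2 - y.2) + (y.2 - z.2)); last by ring.
by apply: le_lt_trans (ler_normD _ _) _; lra.
Qed.

Lemma box_open z (r : R) y : box z r y ->
  exists2 s : R, 0 < s & box y s `<=` box z r.
Proof.
move=> [y1 y2]; exists (r - Num.max `|y.1 - z.1| `|y.2 - z.2|).
  by rewrite subr_gt0 gt_max y1.
move=> x; set m := Num.max _ _ => Bx.
have m1 : `|y.1 - z.1| <= m by rewrite le_max lexx.
have m2 : `|y.2 - z.2| <= m by rewrite le_max lexx orbT.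
case: Bx => x1 x2; split.
  rewrite (_ : x.1 - z.1 = (x.1 - y.1) + (y.1 - z.1)); last by ring.
  by apply: le_lt_trans (ler_normD _ _) _; lra.
rewrite (_ : x.2 - z.2 = (x.2 - y.2) + (y.2 - z.2)); last by ring.
by apply: le_lt_trans (ler_normD _ _) _; lra.
Qed.

Lemma boxN z (r : R) y : 0 <= r -> ~ box z r y -> r ^+ 2 <= quad z y.
Proof.
move=> r0 h; rewrite leNgt; apply/negP => hq; apply: h.
have s (a : R) : a ^+ 2 < r ^+ 2 -> `|a| < r.
  by rewrite -[X in X < _]real_normK ?num_real // => ha; rewrite -ltr_sqr ?nnegrE.
rewrite /quad in hq.
have q1 := sqr_ge0 (y.1 - z.1); have q2 := sqr_ge0 (y.2 - z.2).
by split; apply: s; lra.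
Qed.

Lemma C1_cst (k : R) : [/\ C1 (fun _ : R * R => k),
  forall z, dt (fun _ : R * R => k) z = 0 & forall z, dx (fun _ : R * R => k) z = 0].
Proof.
have d (c x : R) : is_derive x 1 (fun _ : R => c) ((fun _ : R => 0) x).
  exact: is_derive_cst.
have c0 : continuous (fun _ : R => 0 : R) by move=> x; exact: cvg_cst.
have [] := C1_sep (d k) (d 0) c0 c0.
by rewrite (_ : (fun z : R * R => k + 0) = fun=> k) //; apply/funext => z; rewrite addr0.
Qed.

Definition cbox z (r : R) : set (R * R) :=
  `[z.1 - r, z.1 + r]%classic `*` `[z.2 - r, z.2 + r]%classic.

Lemma cboxP z (r : R) y : cbox z r y <-> `|y.1 - z.1| <= r /\ `|y.2 - z.2| <= r.
Proof.
by rewrite /cbox /= !in_itv /= !ler_norml; split=> -[h1 h2]; split; lra.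
Qed.

Lemma compact_cbox z (r : R) : compact (cbox z r).
Proof. by apply: compact_setX; exact: segment_compact. Qed.

(** The common core of stability under suprema, for Perron's method, and under half-relaxed limits:
    both provide sub-solutions that are almost below [phi] on a box and almost touch it at some
    point near [z]. *)
Lemma stab_pt al G lam U phi z (r : R) :
  assA0 G -> C1 phi -> U z = phi z -> 0 < r ->
  (forall e : R, 0 < e -> exists u al' lam' z',
    [/\ usc u, forall y, box z r y -> u y <= phi y + e, box z e z'
      & U z - e <= u z'] /\
    [/\ `|al' - al| <= e, `|lam' - lam| <= e
      & forall y, box z r y -> vsub_at al' G lam' u y]) ->
  al * U z + dt phi z + G z.1 z.2 (dx phi z) <= lam.
Proof.
move=> cG cp Uz r0 h; rewrite leNgt; apply/negP => hlt.
(* Adding [quad] makes the contact strict, which traps the maximum points of [u - psi] near [z]. *)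
have [cq tq xq] := C1_quad z; have [cs ts xs] := C1_add cp cq.
set psi := (fun y => phi y + quad z y) in cs ts xs.
(* The excess is cut into five shares: one for the continuity of [Eop], one for replacing [al] by
   [al'], two for the term [al' * k], one for replacing [lam] by [lam']. *)
set c := (al * U z + dt phi z + G z.1 z.2 (dx phi z) - lam) / 5.
have c0 : 0 < c by rewrite divr_gt0 // subr_gt0.
have qz : quad z z = 0 by rewrite /quad !subrr !expr0n addr0.
have Ez : Eop al G psi z = lam + 5 * c.
  by rewrite /Eop ts xs tq xq /psi qz !subrr !mulr0 !addr0 -Uz /c; field.
have [r1 r10 h1] := cont_box z (Eop_cont (al := al) cG cs) c0.
have cpsi := C1_cont cs.
have [r2 r20 h2] := cont_box z cpsi (ltr01 : 0 < 1 :> R).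
have psiz : psi z = U z by rewrite /psi qz addr0.
set B := `|psi z| + 1; have B0 : 0 < B by rewrite ltr_wpDl.
set A := `|al| + 1; have A0 : 0 < A by rewrite ltr_wpDl.
set s := Num.min (Num.min r1 r2) (r / 2).
have s0 : 0 < s by rewrite !lt_min r10 r20 divr_gt0.
have [ss1 ss2 ss3] : [/\ s <= r1, s <= r2 & s <= r / 2].
  by rewrite !ge_min !lexx !orbT.
(* As [e <= eta], a maximum point satisfies [quad z z1 <= 2 * e + eta < (s / 2) ^+ 2] and stays in
   the half-size box; the bound [c / A] controls the constant [k]. *)
set eta := Num.min ((s / 2) ^+ 2 / 4) (c / A).
have ss0 : 0 < (s / 2) ^+ 2 by rewrite exprn_gt0 // divr_gt0.
have eta0 : 0 < eta by rewrite lt_min; apply/andP; split; apply: divr_gt0.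
have [et1 et2] : eta <= (s / 2) ^+ 2 / 4 /\ eta <= c / A by rewrite !ge_min !lexx orbT.
clearbody eta.
have [r3 r30 h3] := cont_box z cpsi eta0.
set e := Num.min (Num.min (Num.min eta r3) (Num.min c (c / B))) (Num.min 1 s).
have e0 : 0 < e by do ![apply: minr_gt0 => //]; exact: divr_gt0.
have [[e1 e2 e3] [e4 e5 e6]] : [/\ e <= eta, e <= r3 & e <= c] /\ [/\ e <= c / B, e <= 1 & e <= s].
  by clearbody s; split; split; rewrite !ge_min !lexx ?orbT.
have [u [al' [lam' [z' [[uu ule Bz' uz'] [hal hlam hsub]]]]]] := h e e0.
have K0 : cbox z s !=set0.
  by exists z; apply/cboxP; rewrite !subrr normr0; split; exact: ltW.
have [z1 Kz1 hmax] : exists2 z1, cbox z s z1 &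
    forall y, cbox z s y -> u y - psi y <= u z1 - psi z1.
  apply: (@usc_compact_max _ _ _ (fun y => u y - psi y) (@compact_cbox z s) K0) => x d d0.
  have d2 : 0 < d / 2 by lra.
  have [a a0 ha] := uu x _ d2; have [b b0 hb] := cont_box x cpsi d2.
  apply/near_box; exists (Num.min a b); first by rewrite lt_min a0.
  move=> y By.
  have := ha y (box_sub (_ : Num.min a b <= a) By).
  have := hb y (box_sub (_ : Num.min a b <= b) By).
  rewrite !ge_min !lexx orbT ltr_norml => /(_ isT) /andP[q1 q2] /(_ isT) q3.
  by clear -q1 q2 q3; lra.
have Kz' : cbox z s z'.
  by case: (Bz') => a1 a2; apply/cboxP; split; exact: le_trans (ltW _) e6.
set k := u z1 - psi z1.
have k_lo : - (e + eta) <= k.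
  have := hmax z' Kz'; have := h3 z' (box_sub e2 Bz').
  rewrite psiz ltr_norml -/k => /andP[q1 q2] q3; clear -q1 q2 q3 uz'; lra.
have Bz1 : box z r z1.
  move/cboxP : Kz1 => [a1 a2]; have sr : s < r by clear -ss3 r0; lra.
  by split; [exact: le_lt_trans a1 sr|exact: le_lt_trans a2 sr].
have uz1 := ule z1 Bz1.
have q0 : 0 <= quad z z1 by rewrite addr_ge0 // sqr_ge0.
have k_hi : k <= e.
  by rewrite /k /psi; clear -uz1 q0; lra.
have qz1 : quad z z1 < (s / 2) ^+ 2.
  have : quad z z1 <= 2 * e + eta by move: k_lo; rewrite /k /psi; clear -uz1; lra.
  by clear -e1 et1 ss0; lra.
have Bsz1 : box z (s / 2) z1.
  apply: contrapT => /(boxN (ltW (divr_gt0 s0 (ltr0Sn _ 1)) : 0 <= s / 2)).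
  by rewrite leNgt qz1.
have [cc tc xc] := C1_cst k; have [ck tk xk] := C1_add cs cc.
have inn : box z1 (s / 2) `<=` cbox z s.
  move=> y By; have [] := box_trans Bsz1 By.
  rewrite (_ : s / 2 + s / 2 = s); last by field.
  by move=> q1 q2; apply/cboxP; split; exact: ltW.
have E' : u z1 = psi z1 + k by rewrite /k; ring.
have := hsub z1 Bz1 _ ck E'; rewrite tk xk tc xc !addr0.
have tch : exists2 r : R, 0 < r & forall y, box z1 r y -> u y <= psi y + k.
  exists (s / 2); first by clear -s0; lra.
  by move=> y /inn /hmax; rewrite -/k; clear -k; lra.
move=> /(_ tch) hle.
have := h1 z1 (box_sub (_ : s / 2 <= r1) Bsz1); rewrite (_ : s / 2 <= r1); last by clear -ss1 s0; lra.
move=> /(_ isT); rewrite Ez /Eop ltr_norml => /andP[hE _].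
have := h2 z1 (box_sub (_ : s / 2 <= r2) Bsz1); rewrite (_ : s / 2 <= r2); last by clear -ss2 s0; lra.
move=> /(_ isT) hB.
have hpB : `|psi z1| <= B.
  rewrite /B -(subrK (psi z) (psi z1)).
  by apply: le_trans (ler_normD _ _) _; clear -hB; lra.
have t1 : `|(al' - al) * psi z1| <= c.
  rewrite normrM; apply: le_trans (ler_pM _ _ hal hpB) _ => //.
  by move: e4; rewrite ler_pdivlMr.
have t2 : `|al' * k| <= 2 * c.
  have kk : `|k| <= e + eta by rewrite ler_norml; clear -k_lo k_hi eta0; lra.
  have aa : `|al'| <= A.
    by rewrite /A -(subrK al al'); apply: le_trans (ler_normD _ _) _; clear -hal e5; lra.
  rewrite normrM; apply: le_trans (ler_pM _ _ aa kk) _ => //.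
  have : e + eta <= 2 * c / A by rewrite mulrAC; clear -e1 et2; lra.
  by rewrite ler_pdivlMr // mulrC.
move: hlam t1 t2 hle; rewrite E' !ler_norml => /andP[_ q1] /andP[q2 _] /andP[q3 _] q4.
move: q2 q3 q4 hE; set a := dt _ _; set b := G _ _ _ => q2 q3 q4 hE.
by clear -q1 q2 q3 q4 hE e3 c0; nra.
Qed.

(** The hypotheses force [U z = V z], so a test function above [U] is also above [V]. It serves in
    Perron's method at points where the bump does not raise the envelope. *)
Lemma vsub_at_mono al G lam U V z : vsub_at al G lam V z -> U z <= V z ->
  (exists2 r : R, 0 < r & forall y, box z r y -> V y <= U y) ->
  vsub_at al G lam U z.
Proof.
move=> h hz [r r0 hr] phi cp E [s s0 hs].
have EU : U z = V z.
  by apply/eqP; rewrite eq_le hz hr //; exact: box_center.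
rewrite EU; apply: h => //; first by rewrite -EU.
exists (Num.min r s); first by rewrite lt_min r0.
move=> y By; apply: le_trans (hr y _) (hs y _); apply: box_sub By.
  by rewrite ge_min lexx.
by rewrite ge_min lexx orbT.
Qed.

Lemma star_mono_at u v z y (r : R) : locally_bdd u -> locally_bdd v ->
  (forall x, box z r x -> u x <= v x) -> box z r y -> star u y <= star v y.
Proof.
move=> bu bv h By; have [s s0 hs] := box_open By.
by apply: (le_star2 bu bv s0) => x /hs /h.
Qed.

Lemma locally_bdd_between u U1 U2 : locally_bdd U1 -> locally_bdd U2 ->
  (forall z, U1 z <= u z <= U2 z) -> locally_bdd u.
Proof.
move=> /locally_bddP b1 /locally_bddP b2 h; apply/locally_bddP => z.
have [M1 [r1 [r10 h1]]] := b1 z; have [M2 [r2 [r20 h2]]] := b2 z.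
exists (M1 + M2), (Num.min r1 r2); split; first by rewrite lt_min r10.
move=> y By; have := h y.
have := h1 y (box_sub _ By); rewrite ge_min lexx => /(_ isT).
have := h2 y (box_sub _ By); rewrite ge_min lexx orbT => /(_ isT).
rewrite !ler_norml => /andP[? ?] /andP[? ?] /andP[? ?].
have : 0 <= M1 /\ 0 <= M2 by split; lra.
by move=> [? ?]; apply/andP; split; lra.
Qed.

Lemma locally_bdd_star u : locally_bdd u -> locally_bdd (star u).
Proof.
move=> bu; apply/locally_bddP => z.
have [M [r [r0 hr]]] := (locally_bddP u).1 bu z; exists M, r; split => // y By.
have [s s0 hs] := box_open By; rewrite ler_norml; apply/andP; split.
  by apply: le_trans (le_star y bu); have := hr y By; rewrite ler_norml => /andP[].
by apply: (star_le bu s0) => x /hs /hr; rewrite ler_norml => /andP[].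
Qed.

(** The affine changes of variables used are the translations ([k = 1]) and
    the reflection of the space variable ([k = -1]). *)
Definition aff (k a b : R) z : R * R := (z.1 + a, k * z.2 + b).

Lemma C1_aff (k a b : R) phi : C1 phi ->
  [/\ C1 (phi \o aff k a b), forall z, dt (phi \o aff k a b) z = dt phi (aff k a b z)
    & forall z, dx (phi \o aff k a b) z = k * dx phi (aff k a b z)].
Proof.
move=> [d1 d2 c1 c2].
have ca : continuous (aff k a b).
  move=> z; apply: cvg_to_pair.
    by apply: cvgD; [exact: cvg_fst|exact: cvg_cst].
  apply: cvgD; last exact: cvg_cst.
  by apply: cvgM; [exact: cvg_cst|exact: cvg_snd].
have D1 z : is_derive z.1 1 (fun s : R => (phi \o aff k a b) (s, z.2)) (dt phi (aff k a b z)).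
  rewrite -[dt _ _]mulr1.
  have dl : is_derive (z.1 : R) 1 (fun s : R => s + a) 1.
    by rewrite -[X in is_derive _ _ _ X]addr0; apply: is_deriveD.
  apply: (@is_derive1_comp _ (fun s : R => phi (s, k * z.2 + b)) (fun s : R => s + a) z.1 _ _ _ dl).
  by apply: DeriveDef; [exact: (d1 (aff k a b z))|rewrite -derive1E].
have D2 z : is_derive z.2 1 (fun s : R => (phi \o aff k a b) (z.1, s)) (k * dx phi (aff k a b z)).
  rewrite mulrC.
  have dl : is_derive (z.2 : R) 1 (fun s : R => k * s + b) k.
    rewrite -[X in is_derive _ _ _ X]addr0; apply: is_deriveD.
    rewrite -[X in is_derive _ _ _ X]mulr1; exact: is_deriveZ.
  apply: (@is_derive1_comp _ (fun s : R => phi (z.1 + a, s)) (fun s : R => k * s + b) z.2 _ _ _ dl).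
  by apply: DeriveDef; [exact: (d2 (aff k a b z))|rewrite -derive1E].
have E1 z : dt (phi \o aff k a b) z = dt phi (aff k a b z).
  by rewrite /dt derive1E; have [] := D1 z.
have E2 z : dx (phi \o aff k a b) z = k * dx phi (aff k a b z).
  by rewrite /dx derive1E; have [] := D2 z.
split; [split=> [z|z||]|exact: E1|exact: E2].
- by have [] := D1 z.
- by have [] := D2 z.
- rewrite (funext E1) => z; apply: (@continuous_comp _ _ _ (aff k a b) (dt phi)); [exact: ca|exact: c1].
- rewrite (funext E2) => z; apply: cvgM; first exact: cvg_cst.
  by apply: (@continuous_comp _ _ _ (aff k a b) (dx phi)); [exact: ca|exact: c2].
Qed.

Lemma affK (k a b : R) : k * k = 1 -> cancel (aff k a b) (aff k (- a) (- (k * b))).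
Proof.
move=> kk [t x]; rewrite /aff /=; congr pair; first by rewrite addrK.
by rewrite mulrDr mulrA kk mul1r addrK.
Qed.

Lemma affK' (k a b : R) : k * k = 1 -> cancel (aff k (- a) (- (k * b))) (aff k a b).
Proof.
move=> kk [t x]; rewrite /aff /=; congr pair; first by rewrite addrNK.
by rewrite mulrDr mulrA kk mul1r mulrN mulrA kk mul1r addrNK.
Qed.

Lemma box_aff (k a b : R) z y (r : R) : k * k = 1 ->
  box (aff k a b z) r (aff k a b y) <-> box z r y.
Proof.
move=> kk; have k1 : `|k| = 1.
  have : `|k| * `|k| = 1 by rewrite -normrM kk normr1.
  have := normr_ge0 k; nra.
rewrite /box /aff /= (_ : y.1 + a - _ = y.1 - z.1); last by ring.
rewrite (_ : k * y.2 + b - _ = k * (y.2 - z.2)); last by ring.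
by rewrite normrM k1 mul1r.
Qed.

Lemma locally_bdd_aff (k a b : R) u : k * k = 1 -> locally_bdd u ->
  locally_bdd (u \o aff k a b).
Proof.
move=> kk /locally_bddP h; apply/locally_bddP => z.
have [M [r [r0 hr]]] := h (aff k a b z); exists M, r; split => // y By.
by apply: hr; apply/box_aff.
Qed.

Lemma star_aff (k a b : R) u z : k * k = 1 -> locally_bdd u ->
  star (u \o aff k a b) z = star u (aff k a b z).
Proof.
move=> kk bu; have bua := locally_bdd_aff a b kk bu.
apply/eqP; rewrite eq_le; apply/andP; split; apply/ler_addgt0Pr => e e0.
  have [r r0 h] := star_lt (aff k a b z) bu e0.
  by apply: (star_le bua r0) => y By; apply/ltW/h/box_aff.
have [r r0 h] := star_lt z bua e0.
apply: (star_le bu r0) => y By; apply/ltW.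
rewrite -(affK' a b kk y); apply: h.
by apply/(box_aff a b _ _ _ kk); rewrite affK'.
Qed.

Lemma vsub_at_aff (k a b al lam : R) G U z : k * k = 1 ->
  vsub_at al G lam U (aff k a b z) ->
  vsub_at al (fun t x p => G (t + a) (k * x + b) (k * p)) lam (U \o aff k a b) z.
Proof.
move=> kk h phi cp E [r r0 hr].
have [cb tb xb] := C1_aff k (- a) (- (k * b)) cp.
have := h _ cb; rewrite tb xb /= affK //; apply => //.
exists r => // y By; rewrite -[X in U X](affK' a b kk); apply: hr.
by apply/(box_aff a b _ _ _ kk); rewrite affK'.
Qed.

(** * Perron's method between two barriers *)

Section Perron.
Variables (Om D : set R) (al lam : R) (G : R -> R -> R -> R) (U1 U2 : R * R -> R).
Hypotheses (al0 : 0 <= al) (cG : assA0 G).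
Hypotheses (oOm : forall x, Om x -> exists2 r : R, 0 < r & forall y, `|y - x| < r -> Om y).
Hypotheses (b1 : locally_bdd U1) (b2 : locally_bdd U2).
Hypotheses (U12 : forall z, U1 z <= U2 z).
Hypotheses (sub1 : vsub Om al G lam (star U1)).
Hypotheses (sup2 : vsub D al (Gneg G) (- lam) (star (neg U2))).

Definition perron_family : set (R * R -> R) :=
  [set u | (forall z, U1 z <= u z <= U2 z) /\ vsub Om al G lam (star u)].

Definition perron z : R := sup [set u z | u in perron_family].

Let mem_bdd u : perron_family u -> locally_bdd u.
Proof. by move=> [h _]; exact: locally_bdd_between b1 b2 h. Qed.

Let mem1 : perron_family U1.
Proof. by split => // z; rewrite lexx U12. Qed.

Let perron_sup z : has_sup [set u z | u in perron_family].
Proof.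
split; first by exists (U1 z), U1.
by exists (U2 z) => _ [u [h _] <-]; case/andP: (h z).
Qed.

Lemma le_perron u z : perron_family u -> u z <= perron z.
Proof. by move=> fu; apply: sup_upper_bound => //; exists u. Qed.

Lemma perron_between z : U1 z <= perron z <= U2 z.
Proof.
rewrite le_perron //=; apply: ge_sup; first by case: (perron_sup z).
by move=> _ [u [h _] <-]; case/andP: (h z).
Qed.

Lemma perron_bdd : locally_bdd perron.
Proof. exact: locally_bdd_between b1 b2 perron_between. Qed.

Lemma perron_sub : vsub Om al G lam (star perron).
Proof.
move=> z Omz phi cp E [r r0 hr].
have [s s0 hs] := oOm Omz.
have m0 : 0 < Num.min r s by rewrite lt_min r0.
apply: (stab_pt cG cp E m0) => e e0.
have e2 : 0 < e / 2 by lra.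
have [y By hy] := star_freq z perron_bdd e2 e0.
have [_ [u fu <-] hu] := sup_adherent e2 (perron_sup y).
have bu := mem_bdd fu.
exists (star u), al, lam, y; split; split.
- exact: usc_star.
- move=> x Bx; have Bx' : box z r x by apply: box_sub Bx; rewrite ge_min lexx.
  have : star u x <= star perron x.
    by apply: (le_star2 bu perron_bdd ltr01) => w _; exact: le_perron.
  by have := hr x Bx'; lra.
- by [].
- by have := le_star y bu; move: hu; rewrite -/(perron y); lra.
- by rewrite subrr normr0 ltW.
- by rewrite subrr normr0 ltW.
- move=> x [_ Bx]; case: fu => _; apply; apply: hs; apply: lt_le_trans Bx _.
  by rewrite ge_min lexx orbT.
Qed.

(** A failure at [z0] would leave room for a small bump within the family. Members are tested on
    [Om] only, so the bump is admissible for [z0] anywhere in [D], inside [Om] or not: this is the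
    source of the state constraint. *)
Lemma perron_super : vsub D al (Gneg G) (- lam) (star (neg perron)).
Proof.
have bN := locally_bddN perron_bdd; have b2N := locally_bddN b2.
have NU2 z : star (neg U2) z <= star (neg perron) z.
  apply: (le_star2 b2N bN ltr01) => y _.
  by rewrite lerN2; case/andP: (perron_between y).
move=> z0 Dz phi cp E [r0 r00 hr0].
(* Where the envelopes of [neg perron] and [neg U2] agree, the inequality is inherited from [U2];
   elsewhere there is room below [U2]. *)
have := NU2 z0; rewrite E le_eqVlt => /predU1P[E2|lt2].
  rewrite -E2; apply: sup2 => //; exists r0 => // y /hr0; exact: le_trans.
rewrite leNgt; apply/negP => hlt.
have [cn tn xn] := C1_opp cp; have [cq tq xq] := C1_quad z0.
have [cqn tqn xqn] := C1_opp cq; have [cc tc xc] := C1_add cn cqn.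
set chi := (fun y => _) in cc tc xc.
have qz : quad z0 z0 = 0 by rewrite /quad !subrr !expr0n addr0.
have chiz : chi z0 = - phi z0 by rewrite /chi qz oppr0 addr0.
have Ez : Eop al G chi z0 < lam.
  rewrite /Eop tc xc tn xn tqn xqn tq xq chiz !subrr !mulr0 !oppr0 !addr0.
  by move: hlt; rewrite /Gneg; lra.
set c := (lam - Eop al G chi z0) / 2; have c0 : 0 < c by rewrite /c; lra.
have [r1 r10 h1] := cont_box z0 (Eop_cont (al := al) cG cc) c0.
(* A third of the room: one share for the oscillation of [phi], one for that of [neg U2], one for
   the height [de], so that the bump stays below [U2]. *)
set ka := (phi z0 - star (neg U2) z0) / 3; have ka0 : 0 < ka by rewrite /ka; lra.
have [r3 r30 h3] := star_lt z0 b2N ka0.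
have [r4 r40 h4] := cont_box z0 (C1_cont cp) ka0.
set r := Num.min (Num.min r0 r1) (Num.min r3 r4).
have rp : 0 < r by rewrite !lt_min r00 r10 r30 r40.
have [rr0 rr1 [rr3 rr4]] : [/\ r <= r0, r <= r1 & r <= r3 /\ r <= r4].
  by rewrite !ge_min !lexx !orbT.
have r2p : 0 < (r / 2) ^+ 2 by rewrite exprn_gt0 // divr_gt0.
have al1 : 0 < al + 1 by rewrite ltr_wpDl.
set de := Num.min (Num.min ka ((r / 2) ^+ 2)) (c / (al + 1)).
have de0 : 0 < de by rewrite !lt_min ka0 r2p divr_gt0.
have [dka dr dc] : [/\ de <= ka, de <= (r / 2) ^+ 2 & de <= c / (al + 1)].
  by rewrite !ge_min !lexx !orbT.
have {}dc : al * de <= c.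
  by move: dc; rewrite ler_pdivlMr //; nra.
have qge y : 0 <= quad z0 y by rewrite addr_ge0 // sqr_ge0.
have [cd td xd] := C1_cst de; have [cde tde xde] := C1_add cc cd.
(* Outside the half-size box [quad] is at least [(r / 2) ^+ 2 >= de], so [chi + de] is below
   [perron] there and the maximum glues with [perron] before the edge of the box. *)
pose w' y := if `[< box z0 r y >] then Num.max (perron y) (chi y + de) else perron y.
have w'in y : box z0 r y -> w' y = Num.max (perron y) (chi y + de).
  by move=> By; rewrite /w' asboolT.
have w'out y : ~ box z0 (r / 2) y -> w' y = perron y.
  rewrite /w' => Ny; case: asboolP => // By.
  apply/max_idPl.
  have q2 := boxN (ltW (divr_gt0 rp (ltr0Sn _ 1)) : 0 <= r / 2) Ny.
  have := le_star y bN; have := hr0 y (box_sub rr0 By); rewrite /neg /chi; lra.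
have perle y : perron y <= w' y.
  by rewrite /w'; case: ifP => // _; rewrite le_max lexx.
have w'U y : U1 y <= w' y <= U2 y.
  have /andP[p1 p2] := perron_between y.
  rewrite (le_trans p1 (perle y)) /= /w'; case: asboolP => // By.
  rewrite ge_max p2 /=.
  have := h3 y (box_sub rr3 By); have := h4 y (box_sub rr4 By).
  have := qge y; rewrite /neg /chi ltr_norml => ? /andP[? ?] ?.
  have Eka : 3 * ka = phi z0 - star (neg U2) z0 by rewrite /ka; field.
  lra.
have bw' := locally_bdd_between b1 b2 w'U.
have fw' : perron_family w'.
  split => // y Omy.
  (* Where the envelope is raised, it equals the smooth function [chi + de], a classical
     sub-solution; elsewhere the property of [perron] is reused. *)
  have [le|lt] := leP (star w' y) (star perron y).
    apply: (vsub_at_mono (perron_sub Omy) le); exists 1 => // x _.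
    by apply: (le_star2 perron_bdd bw' ltr01) => v _; exact: perle.
  have By : box z0 r y.
    apply: contrapT => Ny; move: lt; rewrite ltNge => /negP; apply.
    apply: (@le_star2 _ _ _ _ (r / 2) bw' perron_bdd); first lra.
    move=> x Bx; rewrite w'out // => Bx'; apply: Ny.
    have Bs : box x (r / 2) y by case: Bx => ? ?; split; rewrite distrC.
    by have := box_trans Bx' Bs; rewrite (_ : r / 2 + r / 2 = r) //; field.
  have [s s0 hs] := box_open By.
  have Ew : star w' y = chi y + de.
    apply/eqP; rewrite eq_le; apply/andP; split; last first.
      by apply: le_trans (le_star y bw'); rewrite w'in // le_max lexx orbT.
    apply: contrapT => /negP; rewrite -ltNge => lt'.
    have : Num.max (star perron y) (chi y + de) < star w' y by rewrite gt_max lt.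
    set m := Num.max _ _ => hm.
    have hm0 : 0 < (star w' y - m) / 2 by lra.
    have [a a0 ha] := star_lt y perron_bdd hm0.
    have [b b0 hb] := cont_box y (C1_cont cc) hm0.
    suff : star w' y <= m + (star w' y - m) / 2 by lra.
    apply: (star_le bw' (r := Num.min s (Num.min a b))); first by rewrite !lt_min s0 a0.
    move=> x Bx.
    have Bs : box y s x by apply: box_sub Bx; rewrite ge_min lexx.
    have Ba : box y a x by apply: box_sub Bx; rewrite !ge_min lexx !orbT.
    have Bb : box y b x by apply: box_sub Bx; rewrite !ge_min lexx !orbT.
    rewrite w'in; last exact: hs.
    have m1 : star perron y <= m by rewrite le_max lexx.
    have m2 : chi y + de <= m by rewrite le_max lexx orbT.
    have := ha x Ba; have := hb x Bb; rewrite ltr_norml ge_max => /andP[q1 q2] q3.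
    by clear -m1 m2 q1 q2 q3; apply/andP; split; lra.
  move=> psi cpsi Epsi [t t0 ht].
  have tch : forall x, box y (Num.min s t) x -> chi x + de <= psi x.
    move=> x Bx; have Bs : box y s x by apply: box_sub Bx; rewrite ge_min lexx.
    have Bt : box y t x by apply: box_sub Bx; rewrite !ge_min lexx !orbT.
    apply: le_trans (ht x Bt); apply: le_trans (le_star x bw').
    by rewrite w'in ?le_max ?lexx ?orbT //; exact: hs.
  have st0 : 0 < Num.min s t by rewrite lt_min s0.
  have [<- <-] := C1_touch cpsi cde st0 (etrans (esym Ew) Epsi) tch.
  rewrite tde xde td xd !addr0 Ew.
  have := h1 y (box_sub rr1 By); rewrite ltr_norml => /andP[_ +].
  have Ec : 2 * c = lam - Eop al G chi z0 by rewrite /c; field.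
  by rewrite {1}/Eop; lra.
have [s s0 hs] := cont_box z0 (C1_cont cc) (divr_gt0 de0 (ltr0Sn _ 1) : 0 < de / 2).
suff : star (neg perron) z0 <= phi z0 - de / 2 by rewrite E; lra.
apply: (star_le bN (r := Num.min r s)); first by rewrite lt_min rp.
move=> y By.
have Br : box z0 r y by apply: box_sub By; rewrite ge_min lexx.
have Bs : box z0 s y by apply: box_sub By; rewrite ge_min lexx orbT.
have := le_perron y fw'; rewrite w'in // ge_max => /andP[_].
have := hs y Bs; rewrite ltr_norml chiz /neg => /andP[? ?] ?; lra.
Qed.

(** An upper semicontinuous [U2] also dominates [star perron], which is then a member of the family
    and cannot exceed [perron]. *)
Lemma perron_usc : usc U2 -> usc perron.
Proof.
move=> u2; suff -> : perron = star perron by exact: usc_star perron_bdd.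
have bp := perron_bdd; have bs := locally_bdd_star bp.
apply/funext => z; apply/eqP; rewrite eq_le le_star //=.
apply: le_perron; split => [y|].
  have /andP[p1 _] := perron_between y.
  rewrite (le_trans p1 (le_star y bp)) /= -[X in _ <= X y](star_id u2 b2).
  by apply: (le_star2 bp b2 ltr01) => x _; case/andP: (perron_between x).
by rewrite star_id; [exact: perron_sub|exact: usc_star|].
Qed.

(** Translation maps the family into itself. Used for a vector and its opposite, the inequality
    gives invariance. *)
Lemma perron_shift (a b : R) :
  (forall t x p, G (t + a) (x + b) p = G t x p) ->
  (forall x, Om (x - b) <-> Om x) ->
  (forall z, U1 (z.1 - a, z.2 - b) = U1 z) -> (forall z, U2 (z.1 - a, z.2 - b) = U2 z) ->
  forall z, perron z <= perron (z.1 + a, z.2 + b).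
Proof.
move=> hG hOm h1 h2 z; apply: ge_sup; first by case: (perron_sup z).
move=> _ [u [hu su] <-].
have kk : 1 * 1 = 1 :> R by rewrite mulr1.
have bu := mem_bdd (conj hu su).
have E y : aff 1 (- a) (- b) y = (y.1 - a, y.2 - b) by rewrite /aff mul1r.
have -> : u z = (u \o aff 1 (- a) (- b)) (z.1 + a, z.2 + b).
  by rewrite /= E /= !addrK; case: (z).
apply: le_perron; split.
  by move=> y; rewrite /= E -(h1 y) -(h2 y).
move=> y Omy phi cp.
have -> : star (u \o aff 1 (- a) (- b)) = star u \o aff 1 (- a) (- b).
  by apply/funext => x; rewrite star_aff.
have Oy : Om (aff 1 (- a) (- b) y).2 by rewrite E; apply/hOm.
have := vsub_at_aff kk (su _ Oy) cp.
have EG t x p : G (t - a) (1 * x - b) (1 * p) = G t x p.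
  by rewrite !mul1r -hG !subrK.
by rewrite EG.
Qed.

End Perron.

End Viscosity.

(** * Oscillation estimates for time-periodic sub-solutions *)

Section Estimates.
Context {R : realType}.
Implicit Types (u v w U V phi chi : R * R -> R) (z : R * R).
Implicit Types (G H : R -> R -> R -> R) (al lam : R) (Om D : set R).

(** The bound [ulim_lt] is local around each point; compactness of the closed box makes it the
    one-sided uniform bound required by [stab_pt], while [ulim_freq] supplies a point where the
    limit is almost reached. *)
Lemma ulim_sub (I : Type) (F : set_system I) (w : I -> R * R -> R)
    (Omi : I -> set R) (ali lami : I -> R) Om al lam G :
  ProperFilter F -> lbd F w -> assA0 G -> (forall i, usc (w i)) ->
  ali i @[i --> F] --> al -> lami i @[i --> F] --> lam ->
  (forall x, Om x -> exists2 r : R, 0 < r & F [set i | forall y, `|y - x| < r -> Omi i y]) ->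
  (forall i, vsub (Omi i) (ali i) G (lami i) (w i)) ->
  vsub Om al G lam (ulim F w).
Proof.
move=> PF bw cG uw hal hlam hOm hsub z Omz phi cp E [r0 r00 hr0].
have [s s0 hs] := hOm _ Omz.
set r := Num.min (r0 / 2) s.
have rp : 0 < r by apply: minr_gt0 => //; exact: divr_gt0.
have [rr rs] : r <= r0 / 2 /\ r <= s by rewrite !ge_min !lexx orbT.
clearbody r.
apply: (stab_pt cG cp E rp) => e e0.
have e2 : 0 < e / 2 by lra.
have /compact_near_coveringP cv := @compact_cbox _ z r.
have S1 : F [set i | cbox z r `<=` [set y | w i y <= phi y + e]].
  apply: (cv _ F (fun i y => w i y <= phi y + e)) => y /cboxP [y1 y2].
  have [a a0 ha] := ulim_lt PF bw y e2.
  have [b b0 hb] := cont_box y (C1_cont cp) e2.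
  exists (box y (Num.min a b), [set i | forall x, box y a x -> w i x < ulim F w y + e / 2]).
    by split => //; apply/near_box; exists (Num.min a b) => //; exact: minr_gt0.
  move=> [x i] [/= Bx hi].
  have Ba : box y a x by apply: box_sub Bx; rewrite ge_min lexx.
  have Bb : box y b x by apply: box_sub Bx; rewrite ge_min lexx orbT.
  have By : box z r0 y by split; lra.
  have := hi x Ba; have := hb x Bb; have := hr0 y By.
  by rewrite ltr_norml => ? /andP[? ?] ?; lra.
have S2 : F [set i | `|ali i - al| <= e].
  by move/cvgrPdist_le : hal => /(_ e e0); apply: filterS => i; rewrite distrC.
have S3 : F [set i | `|lami i - lam| <= e].
  by move/cvgrPdist_le : hlam => /(_ e e0); apply: filterS => i; rewrite distrC.
have [i [[h1 [h2 [h3 h4]]] [y By hy]]] :=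
  ulim_freq PF bw z e0 e0 (filterI S1 (filterI S2 (filterI S3 hs))).
exists (w i), (ali i), (lami i), y; split; split => //.
- by move=> x [x1 x2]; apply: h1; apply/cboxP; split; exact: ltW.
- exact: ltW.
- by move=> x [_ Bx]; apply: hsub; apply: h4; lra.
Qed.

Lemma periodic_int U : t_periodic U -> forall (k : int) t x, U (t + k%:~R, x) = U (t, x).
Proof.
move=> pU.
have pn (n : nat) t x : U (t + n%:R, x) = U (t, x).
  by elim: n => [|n IH]; rewrite ?addr0 // -natr1 addrA pU.
case=> n t x; first exact: pn.
rewrite NegzE mulrNz -[in RHS](subrK (n.+1%:R) t) pn.
by [].
Qed.

Lemma periodic_in U (s t x : R) : t_periodic U ->
  exists t', [/\ s <= t', t' < s + 1 & forall x, U (t', x) = U (t, x)].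
Proof.
move=> pU; exists (t + (- Num.floor (t - s))%:~R); split; last exact: periodic_int.
  by have := floor_le (t - s); rewrite mulrNz; lra.
by have := floorD1_gt (t - s); rewrite mulrNz intrD; lra.
Qed.

Lemma usc_rect_max U phi (a b c d : R) : usc U -> continuous phi -> a <= b -> c <= d ->
  exists z, [/\ a <= z.1 <= b, c <= z.2 <= d &
    forall t x, a <= t <= b -> c <= x <= d -> U (t, x) - phi (t, x) <= U z - phi z].
Proof.
move=> uU cp ab cd.
have K0 : (`[a, b]%classic `*` `[c, d]%classic) !=set0.
  by exists (a, c); split; rewrite /= in_itv /= lexx.
have cK : compact (`[a, b]%classic `*` `[c, d]%classic).
  by apply: compact_setX; exact: segment_compact.
have [x e e0|z [z1 z2] hz] := @usc_compact_max _ _ _ (fun y => U y - phi y) cK K0.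
  have e2 : 0 < e / 2 by lra.
  have [p p0 hp] := uU x _ e2; have [q q0 hq] := cont_box x cp e2.
  apply/near_box; exists (Num.min p q); first exact: minr_gt0.
  move=> y By.
  have := hp y (box_sub (_ : Num.min p q <= p) By).
  have := hq y (box_sub (_ : Num.min p q <= q) By).
  rewrite !ge_min !lexx orbT ltr_norml => /(_ isT) /andP[? ?] /(_ isT) ?; lra.
exists z; split; [by move: z1; rewrite /= in_itv|by move: z2; rewrite /= in_itv|].
by move=> t x ht hx; apply: hz; split; rewrite /= in_itv.
Qed.

Lemma posq_ge0 (x : R) : 0 <= posq x. Proof. exact: sqr_ge0. Qed.

Lemma posq_le0 (x : R) : x <= 0 -> posq x = 0.
Proof. by move=> x0; rewrite /posq; move/max_idPr : x0 => ->; rewrite expr0n. Qed.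

Lemma posq_gt0 (x : R) : 0 <= x -> posq x = x ^+ 2.
Proof. by move=> x0; rewrite /posq; move/max_idPl : x0 => ->. Qed.

Definition steep (C s k t : R) : R -> R := fun x => C * (x - s) + k * posq (x - t).

Definition steep' (C k t : R) : R -> R := fun x => C + k * (2 * Num.max (x - t) 0).

Lemma is_derive_steep (C s k t x : R) :
  is_derive x 1 (steep C s k t) (steep' C k t x).
Proof.
have sh (a y : R) : is_derive y 1 (fun y : R => y - a) 1.
  by rewrite -[X in is_derive _ _ _ X]addr0; apply: is_deriveD.
apply: is_deriveD.
  by rewrite -[X in is_derive _ _ _ X]mulr1; apply: is_deriveZ.
apply: is_deriveZ; rewrite -[X in is_derive _ _ _ X]mulr1.
exact: (@is_derive1_comp _ posq (fun x => x - t) x _ _ (is_derive_posq _) (sh t x)).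
Qed.

Lemma cont_scale (c : R) (f : R -> R) : continuous f -> continuous (fun x => c * f x).
Proof. by move=> cf x; apply: cvgM; [exact: cvg_cst|exact: cf]. Qed.

Lemma cont_shift (c : R) : continuous (fun x : R => x - c).
Proof. by move=> x; apply: cvgB; [exact: cvg_id|exact: cvg_cst]. Qed.

Lemma cont_steep' (C k t : R) : continuous (steep' C k t).
Proof.
have cm : continuous (fun x : R => Num.max (x - t) 0).
  have -> : (fun x : R => Num.max (x - t) 0) = (fun x : R => 2^-1 * ((x - t) + `|x - t|)).
    by apply/funext => y; rewrite maxr_absE addr0 subr0 mulrC.
  apply: cont_scale => x.
  by apply: cvgD; [exact: cont_shift|apply: cvg_norm; exact: cont_shift].
move=> x; apply: cvgD; first exact: cvg_cst.
exact: (cont_scale (cont_scale cm)).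
Qed.

Lemma C1_steep (C s k t M x0 : R) :
  let phi := fun z : R * R => steep C s k t z.1 + M * (z.2 - x0) ^+ 2 in
  [/\ C1 phi, forall z, dt phi z = steep' C k t z.1
    & forall z, dx phi z = M * (2 * (z.2 - x0))].
Proof.
apply: (@C1_sep _ (steep C s k t) (fun x => M * (x - x0) ^+ 2)
  (steep' C k t) (fun x => M * (2 * (x - x0)))).
- by move=> x; exact: is_derive_steep.
- by move=> x; apply: is_deriveZ; exact: is_derive_sqr.
- exact: cont_steep'.
- by do 2 apply: cont_scale; exact: cont_shift.
Qed.

(** Because [H >= - C0], the time derivative is at most [lam + C0] in the viscosity sense, and
    periodicity reduces the time lag to less than one period. The added 1 makes the slope [C]
    strictly larger. *)
Lemma time_osc H U lam (C0 x0 r : R) : usc U -> t_periodic U -> 0 < r ->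
  (forall z, `|z.2 - x0| < r -> vsub_at 0 H lam U z) ->
  (forall t x p, - C0 <= H t x p) ->
  forall t s, U (t, x0) - U (s, x0) <= `|lam + C0| + 1.
Proof.
move=> uU pU r0 hsub hH t0 s; set C := `|lam + C0| + 1.
have [t [st ts Et]] := periodic_in s t0 x0 pU; rewrite -Et {t0 Et}.
have C1 : 1 <= C by rewrite /C lerDr.
suff : U (t, x0) - U (s, x0) <= C * (t - s) by nra.
rewrite leNgt; apply/negP => hlt.
have {}st : s < t.
  by rewrite lt_neqAle st andbT; apply: contraL hlt => /eqP ->; rewrite !subrr mulr0 ltxx.
set eta := U (t, x0) - U (s, x0) - C * (t - s); have eta0 : 0 < eta by rewrite /eta; lra.
have [r1 r10 hr1] := uU (s, x0) eta eta0.
set r2 := Num.min r r1 / 2.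
have r20 : 0 < r2 by apply: divr_gt0 => //; exact: minr_gt0.
have [r2r r2r1] : r2 < r /\ r2 < r1.
  have [? ?] : Num.min r r1 <= r /\ Num.min r r1 <= r1 by rewrite !ge_min !lexx orbT.
  by rewrite /r2 in r20 *; split; lra.
have c0 : continuous (fun _ : R * R => 0 : R) by move=> ?; exact: cvg_cst.
have st1 : s <= t + 1 by lra.
have xr : x0 - r2 <= x0 + r2 by lra.
have [zB [_ _ hB]] := usc_rect_max uU c0 st1 xr.
set B := U zB - 0 in hB.
(* The constant [k] exceeds the range of [U - C * (. - s)], so the penalties keep the maximum off
   the sides [t + 1] and [|x - x0| = r2]; the side [s] is excluded by semicontinuity at
   [(s, x0)]. *)
set k := `|B| + `|U (t, x0)| + C + 1.
have k0 : C + 1 <= k by rewrite /k; have := normr_ge0 B; have := normr_ge0 (U (t, x0)); lra.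
have kB : B - U (t, x0) + C < k.
  rewrite /k; have := ler_norm B; have := ler_norm (- U (t, x0)); rewrite normrN; lra.
have [cp tp xp] := C1_steep C s k t (k / r2 ^+ 2) x0.
set phi := (fun z : R * R => _) in cp tp xp.
have [z [z1 z2 hz]] := usc_rect_max uU (C1_cont cp) st1 xr.
have := hz t x0; rewrite {1}/phi /steep /= !subrr posq_le0 // expr0n /= !mulr0 !addr0.
have -> : s <= t <= t + 1 by lra.
have -> : x0 - r2 <= x0 <= x0 + r2 by lra.
move=> /(_ isT isT) h0.
have p0 : 0 <= posq (z.1 - t) by exact: posq_ge0.
have q0 : 0 <= k / r2 ^+ 2 * (z.2 - x0) ^+ 2.
  by rewrite mulr_ge0 ?sqr_ge0 // divr_ge0 ?sqr_ge0 //; lra.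
have kp : 0 <= k * posq (z.1 - t) by apply: mulr_ge0 => //; lra.
have hBz : U z <= B by have := hB z.1 z.2 z1 z2; rewrite -surjective_pairing subr0.
have ts1 : C * (t - s) <= C by nra.
have hz0 : U (t, x0) - C * (t - s) <= U z - C * (z.1 - s) - k * posq (z.1 - t)
    - k / r2 ^+ 2 * (z.2 - x0) ^+ 2 by move: h0; rewrite /phi /steep; lra.
have Cz : 0 <= C * (z.1 - s) by apply: mulr_ge0; clear -C1 z1; lra.
have zs : s < z.1.
  rewrite lt_neqAle; case/andP: z1 => -> _; rewrite andbT; apply/eqP => Es.
  have Bz : box (s, x0) r1 z.
    by split; rewrite /= -?Es ?subrr ?normr0 // ltr_norml; lra.
  by have := hr1 z Bz; move: hz0; rewrite /eta; lra.
have zt : z.1 < t + 1.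
  rewrite lt_neqAle; case/andP: z1 => _ ->; rewrite andbT; apply/eqP => Es.
  have E1 : posq (z.1 - t) = 1.
    by rewrite Es (_ : t + 1 - t = 1); [rewrite posq_gt0 ?expr1n|ring].
  by move: hz0; rewrite E1 mulr1; lra.
have zx : `|z.2 - x0| < r2.
  rewrite lt_neqAle ler_norml; apply/andP; split; last by lra.
  apply/eqP => Es.
  have E1 : k / r2 ^+ 2 * (z.2 - x0) ^+ 2 = k.
    rewrite -[(z.2 - x0) ^+ 2]real_normK ?num_real // Es mulfVK //.
    by rewrite expf_neq0 // gt_eqF.
  by move: hz0; rewrite E1; lra.
have tch : exists2 r : R, 0 < r & forall y, box z r y -> U y <= phi y + (U z - phi z).
  exists (Num.min (Num.min (z.1 - s) (t + 1 - z.1)) (r2 - `|z.2 - x0|)).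
    by rewrite !lt_min !subr_gt0 zs zt zx.
  move=> y []; rewrite !lt_min => /andP[/andP[a1 a2] _] /andP[_ a3].
  have y1 : s <= y.1 <= t + 1.
    by move: a1 a2; rewrite !ltr_norml => /andP[b1 b2] /andP[b3 b4]; clear -b1 b2 b3 b4; lra.
  have y2 : x0 - r2 <= y.2 <= x0 + r2.
    have : `|y.2 - x0| < r2.
      rewrite (_ : y.2 - x0 = (y.2 - z.2) + (z.2 - x0)); last by ring.
      by apply: le_lt_trans (ler_normD _ _) _; clear -a3; lra.
    by rewrite ltr_norml => /andP[b1 b2]; clear -b1 b2; lra.
  by have := hz y.1 y.2 y1 y2; rewrite -surjective_pairing; clear -phi; lra.
have [cc tc xc] := C1_cst (U z - phi z); have [cs ts' xs] := C1_add cp cc.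
have Ez : U z = phi z + (U z - phi z) by ring.
have zr : `|z.2 - x0| < r by exact: lt_trans r2r.
have := hsub z zr _ cs Ez tch; rewrite ts' xs tc xc !addr0 mul0r add0r tp /steep'.
have m0 : 0 <= k * (2 * Num.max (z.1 - t) 0).
  by rewrite mulr_ge0 //; [lra|rewrite mulr_ge0 // le_max lexx orbT].
have := hH z.1 z.2 (dx phi z).
have : lam + C0 < C by rewrite /C; have := ler_norm (lam + C0); lra.
lra.
Qed.

(** By coercivity a line of slope [K] is a strict super-solution. Periodicity removes the time
    boundary and a penalty beyond [x] removes the right end; there remains the left end, hence a
    bound by the maximum over times of [U] at [y], attained at [s]. *)
Lemma space_lip_right H U lam (K a b : R) : usc U -> t_periodic U -> 0 < K ->
  (forall z, a < z.2 < b -> vsub_at 0 H lam U z) ->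
  (forall t x p, K <= `|p| -> lam < H t x p) ->
  forall t x y, a < y -> y < x -> x < b -> exists s, U (t, x) <= U (s, y) + K * (x - y).
Proof.
move=> uU pU K0 hsub hH t x y ay yx xb.
have c0 : continuous (fun _ : R * R => 0 : R) by move=> ?; exact: cvg_cst.
have [[s y'] [_ /= yy hs]] := usc_rect_max uU c0 (ler01 : 0 <= 1 :> R) (lexx y).
have {yy} Ey : y' = y by apply/eqP; rewrite eq_le andbC.
rewrite Ey in hs; exists s; rewrite leNgt; apply/negP => hlt.
set x2 := (x + b) / 2.
have [xx2 x2b] : x < x2 /\ x2 < b by rewrite /x2; split; lra.
have yx2 : y <= x2 by lra.
have [zB [_ _ hB]] := usc_rect_max uU c0 (ler01 : 0 <= 1 :> R) yx2.
set B := U zB - 0 in hB.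
set k := `|B - U (s, y)| / (x2 - x) ^+ 2.
have k0 : 0 <= k by rewrite divr_ge0 // sqr_ge0.
have d0 (u : R) : is_derive u 1 (fun _ : R => 0 : R) ((fun _ : R => 0) u) by exact: is_derive_cst.
have d1 := is_derive_steep K y k x; have cd1 := @cont_steep' K k x.
have cd0 : continuous (fun _ : R => 0 : R) by move=> ?; exact: cvg_cst.
have [cp tp xp] := C1_sep d0 d1 cd0 cd1.
set phi := (fun z : R * R => _) in cp tp xp.
have [z [z1 z2 hz]] := usc_rect_max uU (C1_cont cp) (ler01 : 0 <= 1 :> R) yx2.
have [t' [t0 t1 Et]] := periodic_in 0 t x pU.
have h0 := hz t' x; rewrite Et {1}/phi /steep /= subrr posq_le0 // mulr0 addr0 add0r in h0.
have {h0} : U (t, x) - K * (x - y) <= U z - phi z by apply: h0; lra.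
rewrite /phi /steep add0r => h0.
have p0 : 0 <= k * posq (z.2 - x) by rewrite mulr_ge0 // posq_ge0.
have Kz : 0 <= K * (z.2 - y) by apply: mulr_ge0; lra.
have zy : y < z.2.
  rewrite lt_neqAle; case/andP: (z2) => -> _; rewrite andbT; apply/eqP => Es.
  have := hs z.1 y z1; rewrite lexx => /(_ isT); rewrite {1}Es -surjective_pairing; lra.
have zx : z.2 < x2.
  rewrite lt_neqAle; case/andP: (z2) => _ ->; rewrite andbT; apply/eqP => Es.
  have E1 : k * posq (z.2 - x) = `|B - U (s, y)|.
    rewrite Es posq_gt0; last by lra.
    by rewrite /k mulfVK // expf_neq0 // subr_eq0 gt_eqF.
  have := hB z.1 z.2 z1 z2; rewrite -surjective_pairing subr0.
  have := ler_norm (B - U (s, y)); rewrite -E1; lra.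
have tch : exists2 r : R, 0 < r & forall v : R * R, box z r v -> U v <= phi v + (U z - phi z).
  exists (Num.min (z.2 - y) (x2 - z.2)); first by rewrite lt_min !subr_gt0 zy.
  move=> v [_]; rewrite lt_min !ltr_norml => /andP[/andP[a1 _] /andP[_ a2]].
  have [v1 [v10 v11 Ev]] := periodic_in 0 v.1 x pU.
  have v2 : y <= v.2 <= x2 by lra.
  have v1i : 0 <= v1 <= 1 by lra.
  by have := hz v1 v.2 v1i v2; rewrite Ev -surjective_pairing /phi /=; lra.
have [cc tc xc] := C1_cst (U z - phi z); have [cs ts' xs] := C1_add cp cc.
have Ez : U z = phi z + (U z - phi z) by ring.
have zr : a < z.2 < b by lra.
have := hsub z zr _ cs Ez tch; rewrite ts' xs tc xc !addr0 mul0r add0r tp add0r.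
apply/negP; rewrite -ltNge; apply: hH; rewrite xp /steep' ger0_norm.
  by rewrite lerDl mulr_ge0 // mulr_ge0 // le_max lexx orbT.
by rewrite addr_ge0 ?(ltW K0) // mulr_ge0 // mulr_ge0 // le_max lexx orbT.
Qed.

Lemma t_periodic_aff (k b : R) U : t_periodic U -> t_periodic (U \o aff k 0 b).
Proof. by move=> pU t x; rewrite /aff /= !addr0 pU. Qed.

Lemma usc_aff (k a b : R) U : k * k = 1 -> usc U -> usc (U \o aff k a b).
Proof.
move=> kk uU z e e0; have [r r0 h] := uU (aff k a b z) e e0.
by exists r => // y By; apply: h; apply/box_aff.
Qed.

(** One direction in space is [space_lip_right], the other follows by reflection; the uncontrolled
    time [s1] is paid for with [time_osc]. *)
Lemma sub_osc H U lam (K C0 a b : R) : usc U -> t_periodic U -> 0 < K ->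
  (forall z, a < z.2 < b -> vsub_at 0 H lam U z) ->
  (forall t x p, K <= `|p| -> lam < H t x p) ->
  (forall t x p, - C0 <= H t x p) ->
  forall t s x y, a < x < b -> a < y < b ->
    U (t, x) - U (s, y) <= K * `|x - y| + (`|lam + C0| + 1).
Proof.
move=> uU pU K0 hsub hH hC t s x y ax ay.
have T s1 s2 : U (s1, y) - U (s2, y) <= `|lam + C0| + 1.
  have r0 : 0 < Num.min (y - a) (b - y) by rewrite lt_min !subr_gt0.
  apply: (time_osc uU pU r0 _ hC) => z; rewrite lt_min !ltr_norml => hz.
  by apply: hsub; lra.
have [xy|xy|->] := ltgtP x y; last by rewrite subrr normr0 mulr0 add0r.
- have kk : (-1) * (-1) = 1 :> R by rewrite mulrNN mulr1.
  have [||z hz|t1 x1 p1 hp||||s1] := @space_lip_right (fun t x p => H (t + 0) (-1 * x + 0) (-1 * p))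
    (U \o aff (-1) 0 0) lam K (- b) (- a) _ _ K0 _ _ t (- x) (- y).
  + exact: usc_aff.
  + exact: t_periodic_aff.
  + by apply: (vsub_at_aff kk); apply: hsub; rewrite /aff /=; lra.
  + by apply: hH; rewrite mulN1r normrN.
  + by lra.
  + by lra.
  + by lra.
  rewrite /aff /= !mulN1r !opprK !addr0 => h1.
  have -> : `|x - y| = - x + y by rewrite ltr0_norm ?subr_lt0 //; ring.
  by have := T s1 s; lra.
- case/andP: (ax) => _ xb; case/andP: (ay) => ay' _.
  have [s1 h1] := space_lip_right uU pU K0 hsub hH t ay' xy xb.
  have -> : `|x - y| = x - y by rewrite gtr0_norm ?subr_gt0.
  by have := T s1 s; lra.
Qed.

End Estimates.

(** * Doubling of variables and comparison on space intervals *)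

Section Comparison.
Context {R : realType}.
Implicit Types (u v w U V W phi chi : R * R -> R) (z : R * R).
Implicit Types (G H : R -> R -> R -> R) (al lam : R) (Om D : set R).

Lemma ultra_lim (I : Type) (F : set_system I) (f : I -> R) (a b : R) :
  UltraFilter F -> F [set i | a <= f i <= b] ->
  exists2 l : R, a <= l <= b & f i @[i --> F] --> l.
Proof.
move=> UF h; have PF : ProperFilter F by exact: ultra_proper.
have Fab : (f i @[i --> F]) `[a, b]%classic.
  by change (F (f @^-1` `[a, b]%classic)); apply: filterS h => i /= hi; rewrite in_itv.
have [l [+ cl]] := @segment_compact R a b (f i @[i --> F]) _ Fab.
rewrite /= in_itv /= => lab; exists l => // V Vl.
have [//|nV] := in_ultra_setVsetC (f @^-1` V) UF.
by have [x [/= nVx Vx]] := cl (~` V) V nV Vl.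
Qed.

Lemma le_lim (I : Type) (F : set_system I) (f g : I -> R) (a b : R) :
  ProperFilter F -> f i @[i --> F] --> a -> g i @[i --> F] --> b ->
  F [set i | f i <= g i] -> a <= b.
Proof.
move=> PF fa gb h; rewrite -subr_ge0; apply: (cvgr_to_ge (cvgB gb fa)).
by apply: filterS h => i; rewrite subr_ge0.
Qed.

Lemma usc_lim (I : Type) (F : set_system I) (f g : I -> R) U (t x e : R) :
  ProperFilter F -> f i @[i --> F] --> t -> g i @[i --> F] --> x -> usc U ->
  0 < e -> F [set i | U (f i, g i) < U (t, x) + e].
Proof.
move=> PF ft gx uU e0; have [r r0 hr] := uU (t, x) e e0.
move/cvgrPdist_lt : ft => /(_ r r0) ft; move/cvgrPdist_lt : gx => /(_ r r0) gx.
apply: filterS (filterI ft gx) => i [h1 h2]; apply: hr.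
by split; rewrite distrC.
Qed.

Lemma cvg_cont3 (I : Type) (F : set_system I) (f g h : I -> R) H (t x p : R) :
  ProperFilter F -> assA0 H -> f i @[i --> F] --> t -> g i @[i --> F] --> x ->
  h i @[i --> F] --> p -> H (f i) (g i) (h i) @[i --> F] --> H t x p.
Proof.
move=> PF cH ft gx hp.
have := cH ((t, x), p); rewrite /continuous_at /= => c.
apply: (cvg_comp (fun i => ((f i, g i), h i)) _ _ c).
by apply: cvg_to_pair => //; exact: cvg_to_pair.
Qed.

Lemma ultra_oo : exists2 F : set_system nat, UltraFilter F & \oo `<=` F.
Proof. by have [F [UF h]] := ultraFilterLemma (eventually_filter : ProperFilter \oo); exists F. Qed.

Lemma cvg_oo_sub (F : set_system nat) (f : nat -> R) (l : R) :
  \oo `<=` F -> f n @[n --> \oo] --> l -> f n @[n --> F] --> l.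
Proof. by move=> oF fl V /fl /oF. Qed.

Lemma cvg_sqr (I : Type) (F : set_system I) (f : I -> R) (a : R) : ProperFilter F ->
  f i @[i --> F] --> a -> (f i) ^+ 2 @[i --> F] --> a ^+ 2.
Proof. by move=> PF fa; rewrite expr2; under eq_fun do rewrite expr2; exact: cvgM. Qed.

Lemma cvg_cont1 (I : Type) (F : set_system I) (f : I -> R) (g : R -> R) (l : R) :
  ProperFilter F -> continuous g -> f i @[i --> F] --> l -> g (f i) @[i --> F] --> g l.
Proof. by move=> PF cg fl; apply: continuous_cvg => //; exact: cg. Qed.

Lemma sqr_dist_far (S t s : R) : 2 <= S -> 0 <= t <= 1 -> ~~ (- S <= s <= S) ->
  (S - 1) ^+ 2 <= (t - s) ^+ 2.
Proof. by move=> S2 ht; rewrite negb_and -!ltNge => /orP[hs|hs]; nra. Qed.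

Lemma le_sqr_succ (d : R) : 0 <= d -> d <= (2 + d - 1) ^+ 2.
Proof. by move=> d0; nra. Qed.

Section Doubling.
Variables (H : R -> R -> R -> R) (U W : R * R -> R) (be la lb nu a b : R).
Variables (psi psi' : R -> R) (t0 x0 : R).
Hypotheses (cH : assA0 H) (uU : usc U) (uW : usc W).
Hypotheses (pU : t_periodic U) (pW : t_periodic W) (nu0 : 0 < nu) (be0 : 0 <= be).
Hypotheses (dpsi : forall x : R, is_derive x 1 psi (psi' x)) (cpsi' : continuous psi').
Hypothesis subU : forall z, a < z.2 < b -> vsub_at 0 H la U z.
Hypothesis subW : forall z, a < z.2 < b -> vsub_at be (Gneg H) (- lb) W z.
Hypotheses (coH : assA3 H) (x0ab : a <= x0 <= b).
Hypothesis bd : forall t s x, x = a \/ x = b ->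
  U (t, x) + W (s, x) - psi x < U (t0, x0) + W (t0, x0) - psi x0.

Let m0 := U (t0, x0) + W (t0, x0) - psi x0.
Let ab : a <= b. Proof. by case/andP: x0ab => h1 h2; exact: le_trans h2. Qed.
Let Psi t s x := U (t, x) + W (s, x) - (t - s) ^+ 2 / (2 * nu) - psi x.
Let Phi n t s x y := U (t, x) + W (s, y) - (t - s) ^+ 2 / (2 * nu)
  - (n.+1%:R / 2 * (x - y) ^+ 2) - psi x.

Let cpsi : continuous psi.
Proof. by move=> x; apply: derivable_cont; have [] := dpsi x. Qed.

Let bounds : exists D : R, forall t s x y, a <= x <= b -> a <= y <= b ->
  U (t, x) + W (s, y) - psi x <= m0 + D.
Proof.
have c0 : continuous (fun _ : R * R => 0 : R) by move=> ?; exact: cvg_cst.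
have cp : continuous (fun z : R * R => psi z.2).
  by move=> z; apply: continuous_comp; [exact: cvg_snd|exact: cpsi].
have [z [_ _ hz]] := usc_rect_max uU cp (ler01 : 0 <= 1 :> R) ab.
have [z' [_ _ hz']] := usc_rect_max uW c0 (ler01 : 0 <= 1 :> R) ab.
exists ((U z - psi z.2) + (W z' - 0) - m0) => t s x y xab yab.
have [t' [t0' t1' Et]] := periodic_in 0 t x0 pU.
have [s' [s0' s1' Es]] := periodic_in 0 s x0 pW.
have h1 := hz t' x; rewrite Et /= in h1; have h2 := hz' s' y; rewrite Es in h2.
have {h1} : U (t, x) - psi x <= U z - psi z.2 by apply: h1 => //; lra.
have {h2} : W (s, y) - 0 <= W z' - 0 by apply: h2 => //; lra.
lra.
Qed.

Let maximizers : exists S : R, forall n, exists Z : (R * R) * (R * R),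
  [/\ 0 <= Z.1.1 <= 1, a <= Z.1.2 <= b, - S <= Z.2.1 <= S, a <= Z.2.2 <= b &
   forall t s x y, a <= x <= b -> a <= y <= b ->
     Phi n t s x y <= Phi n Z.1.1 Z.2.1 Z.1.2 Z.2.2].
Proof.
have [D hD] := bounds.
(* A common integer shift puts [t] in [0, 1]. If [s] then leaves [-S, S], the time penalty exceeds
   [D] and the value cannot beat [m0]. *)
set S := 2 + 2 * nu * `|D|.
have S2 : 2 <= S by rewrite lerDl mulr_ge0 // mulr_ge0 // ltW.
exists S => n.
pose K := (`[0, 1]%classic `*` `[a, b]%classic) `*` (`[- S, S]%classic `*` `[a, b]%classic) : set ((R * R) * (R * R)).
have cK : compact K by do ! apply: compact_setX; exact: segment_compact.
have K0 : K !=set0.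
  have ab1 : a <= b by exact: ab.
  by exists ((0, a), (0, a)); split; split; rewrite /= in_itv /=; lra.
pose f (Z : (R * R) * (R * R)) := Phi n Z.1.1 Z.2.1 Z.1.2 Z.2.2.
pose q (Z : (R * R) * (R * R)) := (Z.1.1 - Z.2.1) ^+ 2 / (2 * nu)
  + (n.+1%:R / 2 * (Z.1.2 - Z.2.2) ^+ 2) + psi Z.1.2.
have cq : continuous q.
  move=> Z.
  have c11 : {for Z, continuous (fun Z' : (R * R) * (R * R) => Z'.1.1)}.
    by apply: (@continuous_comp _ _ _ fst fst); [exact: cvg_fst|exact: cvg_fst].
  have c12 : {for Z, continuous (fun Z' : (R * R) * (R * R) => Z'.1.2)}.
    by apply: (@continuous_comp _ _ _ fst snd); [exact: cvg_fst|exact: cvg_snd].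
  have c21 : {for Z, continuous (fun Z' : (R * R) * (R * R) => Z'.2.1)}.
    by apply: (@continuous_comp _ _ _ snd fst); [exact: cvg_snd|exact: cvg_fst].
  have c22 : {for Z, continuous (fun Z' : (R * R) * (R * R) => Z'.2.2)}.
    by apply: (@continuous_comp _ _ _ snd snd); [exact: cvg_snd|exact: cvg_snd].
  apply: cvgD; first apply: cvgD.
  - by apply: cvgM; [apply: cvg_sqr; exact: cvgB|exact: cvg_cst].
  - by apply: cvgM; [exact: cvg_cst|apply: cvg_sqr; exact: cvgB].
  - by apply: (@continuous_comp _ _ _ (fun Z' : (R * R) * (R * R) => Z'.1.2) psi); [exact: c12|exact: cpsi].
have [Z e e0|Z [[Z11 Z12] [Z21 Z22]] hZ] := @usc_compact_max _ _ _ f cK K0.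
  have e3 : 0 < e / 3 by lra.
  have [r r0 hr] := uU Z.1 e3; have [s s0 hs] := uW Z.2 e3.
  have hq : \forall Y \near Z, `|q Z - q Y| < e / 3 by move/cvgrPdist_lt : (cq Z); exact.
  have n1 : \forall Y \near Z, box Z.1 r Y.1.
    by apply: (@cvg_fst _ _ (nbhs Z.1) (nbhs Z.2)); apply/near_box; exists r.
  have n2 : \forall Y \near Z, box Z.2 s Y.2.
    by apply: (@cvg_snd _ _ (nbhs Z.1) (nbhs Z.2)); apply/near_box; exists s.
  apply: filterS (filterI hq (filterI n1 n2)) => Y [h1 [h2 h3]].
  have := hr _ h2; have := hs _ h3; move: h1; rewrite ltr_norml /f /Phi /q.
  rewrite -!surjective_pairing => /andP[q1 q2] q3 q4; lra.
move: Z11 Z12 Z21 Z22; rewrite /= !in_itv /= => Z11 Z12 Z21 Z22.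
exists Z; split => //.
have red t s x y : 0 <= t <= 1 -> a <= x <= b -> a <= y <= b -> - S <= s <= S ->
    Phi n t s x y <= f Z.
  move=> ht hx hy hs; apply: (hZ ((t, x), (s, y))).
  by split; split; rewrite /= in_itv.
have per (k : int) t s x y : Phi n (t + k%:~R) (s + k%:~R) x y = Phi n t s x y.
  rewrite /Phi !periodic_int // (_ : t + k%:~R - (s + k%:~R) = t - s) //; ring.
have shift (t : R) : exists k : int, 0 <= t + k%:~R <= 1.
  exists (- Num.floor t); rewrite mulrNz.
  have := floor_le t; have := floorD1_gt t; rewrite intrD; lra.
have m0Z : m0 <= f Z.
  have [k hk] := shift t0.
  have -> : m0 = Phi n (t0 + k%:~R) (t0 + k%:~R) x0 x0.
    by rewrite per /Phi /m0 !subrr expr0n /= mulr0 mul0r !subr0.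
  by apply: red => //; lra.
move=> t s x y hx hy; have [k hk] := shift t; rewrite -(per k).
have [hs|hs] := boolP (- S <= s + k%:~R <= S); first exact: red.
apply: le_trans m0Z; rewrite per.
have far : 2 * nu * `|D| <= (t - s) ^+ 2.
  have -> : t - s = (t + k%:~R) - (s + k%:~R) by ring.
  set t' := t + _ in hk *; set s' := s + _ in hs *.
  have nD : 0 <= 2 * nu * `|D| by rewrite mulr_ge0 // mulr_ge0 // ltW.
  exact: le_trans (le_sqr_succ nD) (sqr_dist_far S2 hk hs).
have {far} : `|D| <= (t - s) ^+ 2 / (2 * nu).
  by rewrite ler_pdivlMr ?mulr_gt0 // mulrC.
have := hD t s x y hx hy; have := ler_norm D.
have : 0 <= n.+1%:R / 2 * (x - y) ^+ 2 by rewrite mulr_ge0 ?sqr_ge0 // divr_ge0.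
rewrite /Phi; lra.
Qed.

(** The space penalty is sent to infinity while [nu] stays fixed: only the space points merge, and
    the two Hamiltonians are left at different times, coupled by [(t - s) / nu]. The choice of [nu]
    is left to [comparison]. *)
Lemma doubling : exists t s x p, [/\ a < x < b,
   forall t' s' x', a <= x' <= b -> Psi t' s' x' <= Psi t s x,
   (t - s) / nu + H t x (p + psi' x) <= la
   & lb <= be * (- W (s, x)) + (t - s) / nu + H s x p].
Proof.
have [D hD] := bounds; have [S hS] := maximizers.
have [Z hZ] := choice hS; have [F UF oF] := ultra_oo.
have PF : ProperFilter F by exact: ultra_proper.
have FT (P : nat -> Prop) : (forall n, P n) -> F [set n | P n].
  by move=> h; apply: filterS filterT => n _; exact: h.
pose t n := (Z n).1.1; pose x n := (Z n).1.2; pose s n := (Z n).2.1; pose y n := (Z n).2.2.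
have hZm n : forall t' s' x' y', a <= x' <= b -> a <= y' <= b ->
    Phi n t' s' x' y' <= Phi n (t n) (s n) (x n) (y n) by have [] := hZ n.
have [th _ ct] : exists2 l : R, 0 <= l <= 1 & t n @[n --> F] --> l.
  by apply: ultra_lim; apply: FT => n; have [] := hZ n.
have [sh _ cs] : exists2 l : R, - S <= l <= S & s n @[n --> F] --> l.
  by apply: ultra_lim; apply: FT => n; have [] := hZ n.
have xab n : a <= x n <= b by have [] := hZ n.
have yab n : a <= y n <= b by have [] := hZ n.
have [xh xhab cx] : exists2 l : R, a <= l <= b & x n @[n --> F] --> l.
  by apply: ultra_lim; exact: FT.
have [yh _ cy] : exists2 l : R, a <= l <= b & y n @[n --> F] --> l.
  by apply: ultra_lim; exact: FT.
have nu2 : 0 < 2 * nu by rewrite mulr_gt0.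
have qpos (u : R) : 0 <= u ^+ 2 / (2 * nu) by rewrite divr_ge0 ?sqr_ge0 // ltW.
have npos n (u : R) : 0 <= n.+1%:R / 2 * u ^+ 2 :> R by rewrite mulr_ge0 ?sqr_ge0 // divr_ge0.
have diag n t' s' x' : a <= x' <= b -> Psi t' s' x' <= Phi n (t n) (s n) (x n) (y n).
  move=> hx; apply: le_trans (hZm n t' s' x' x' hx hx).
  by rewrite /Psi /Phi subrr expr0n /= mulr0 subr0.
have m0P : m0 = Psi t0 t0 x0 by rewrite /Psi subrr expr0n /= mul0r subr0.
have Eyx : yh = xh.
  have h : (xh - yh) ^+ 2 <= 0.
    have c0 : 2 * `|D| * n.+1%:R^-1 @[n --> F] --> (0 : R).
      rewrite -[X in _ --> X](mulr0 (2 * `|D|)); apply: cvgM; first exact: cvg_cst.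
      have h := @cvg_harmonic R; exact: (cvg_oo_sub oF h).
    apply: le_lim (cvg_sqr _ (cvgB cx cy)) c0 _; apply: FT => n /=.
    have := diag n t0 t0 x0 x0ab; rewrite -m0P /Phi.
    have := hD (t n) (s n) (x n) (y n) (xab n) (yab n); have := qpos (t n - s n).
    have := ler_norm D => q1 q2 q3 q4.
    have : n.+1%:R / 2 * (x n - y n) ^+ 2 <= `|D| by lra.
    by rewrite -[(_ + _) ^+ 2]/((x n - y n) ^+ 2) ler_pdivlMr // => ?; lra.
  have : (xh - yh) ^+ 2 = 0 by apply/eqP; rewrite eq_le h sqr_ge0.
  by move/eqP; rewrite sqrf_eq0 subr_eq0 => /eqP.
rewrite {}Eyx {yh} in cy.
have cq : (t n - s n) ^+ 2 / (2 * nu) @[n --> F] --> (th - sh) ^+ 2 / (2 * nu).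
  by apply: cvgM; [apply: cvg_sqr; exact: cvgB|exact: cvg_cst].
have cps : psi (x n) @[n --> F] --> psi xh by exact: cvg_cont1.
have maxP t' s' x' : a <= x' <= b -> Psi t' s' x' <= Psi th sh xh.
  move=> hx; apply/ler_addgt0Pr => e e0.
  have e2 : 0 < e / 2 by lra.
  have cR : (U (th, xh) + e / 2 + (W (sh, xh) + e / 2)) - (t n - s n) ^+ 2 / (2 * nu)
      - psi (x n) @[n --> F] --> (U (th, xh) + e / 2 + (W (sh, xh) + e / 2))
      - (th - sh) ^+ 2 / (2 * nu) - psi xh.
    by apply: cvgB => //; apply: cvgB => //; exact: cvg_cst.
  have -> : Psi th sh xh + e = (U (th, xh) + e / 2 + (W (sh, xh) + e / 2))
      - (th - sh) ^+ 2 / (2 * nu) - psi xh by rewrite /Psi; lra.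
  apply: le_lim (cvg_cst (Psi t' s' x')) cR _.
  have := usc_lim PF ct cx uU e2; have := usc_lim PF cs cy uW e2 => h1 h2.
  apply: filterS (filterI h1 h2) => n [/= k1 k2].
  by have := diag n t' s' x' hx; have := npos n (x n - y n); rewrite /Phi; lra.
have xin : a < xh < b.
  have h : ~ (xh = a \/ xh = b).
    move=> /(bd th sh); have := maxP t0 t0 x0 x0ab; rewrite -m0P /m0 /Psi.
    by have := qpos (th - sh); lra.
  case/andP: xhab => h1 h2; rewrite !lt_neqAle h1 h2 !andbT.
  by apply/andP; split; apply/eqP => E; apply: h; [left|right].
have nin (f : nat -> R) : f n @[n --> F] --> xh -> F [set n | a < f n < b].
  move=> cf; have r0 : 0 < Num.min (xh - a) (b - xh) by rewrite lt_min !subr_gt0.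
  move/cvgrPdist_lt : cf => /(_ _ r0); apply: filterS => n.
  by rewrite /= lt_min !ltr_norml => /andP[/andP[? ?] /andP[? ?]]; lra.
pose p n := n.+1%:R * (x n - y n).
have dq (c d u : R) : is_derive u 1 (fun v : R => c * (v - d) ^+ 2) ((fun v : R => c * (2 * (v - d))) u).
  by apply: is_deriveZ; exact: is_derive_sqr.
have cdq (c d : R) : continuous (fun v : R => c * (2 * (v - d))).
  by do 2 apply: cont_scale; exact: cont_shift.
have S1 n : a < x n < b -> (t n - s n) / nu + H (t n) (x n) (p n + psi' (x n)) <= la.
  move=> xn.
  have dd (v : R) : is_derive v 1 (fun v : R => n.+1%:R / 2 * (v - y n) ^+ 2 + psi v)
      ((fun v : R => n.+1%:R / 2 * (2 * (v - y n)) + psi' v) v).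
    exact: is_deriveD.
  have cdd : continuous (fun v : R => n.+1%:R / 2 * (2 * (v - y n)) + psi' v).
    by move=> v; apply: cvgD; [exact: cdq|exact: cpsi'].
  have [cp tp xp] := C1_sep (dq (2 * nu)^-1 (s n)) dd (cdq _ _) cdd.
  set phi := (fun z : R * R => _) in cp tp xp.
  have [cc tc xc] := C1_cst (U (t n, x n) - phi (t n, x n)).
  have [cs' ts' xs'] := C1_add cp cc.
  have E : U (t n, x n) = phi (t n, x n) + (U (t n, x n) - phi (t n, x n)) by ring.
  have tch : exists2 r : R, 0 < r & forall v : R * R, box (t n, x n) r v ->
      U v <= phi v + (U (t n, x n) - phi (t n, x n)).
    exists (Num.min (x n - a) (b - x n)); first by rewrite lt_min !subr_gt0.
    move=> v [_ /=]; rewrite lt_min !ltr_norml => hv.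
    have v2 : a <= v.2 <= b by lra.
    have := hZm n v.1 (s n) v.2 (y n) v2 (yab n); rewrite /Phi /phi -!surjective_pairing /=.
    by lra.
  have := subU (z := (t n, x n)) xn cs' E tch.
  rewrite ts' xs' tc xc tp xp mul0r add0r !addr0 /=.
  rewrite (_ : (2 * nu)^-1 * (2 * (t n - s n)) = (t n - s n) / nu); last by field; rewrite gt_eqF.
  by rewrite (_ : n.+1%:R / 2 * (2 * (x n - y n)) = p n) // /p; field.
have S2 n : a < y n < b ->
    be * W (s n, y n) - (t n - s n) / nu - H (s n) (y n) (p n) <= - lb.
  move=> yn.
  have [cp tp xp] := C1_sep (dq (2 * nu)^-1 (t n)) (dq (n.+1%:R / 2) (x n)) (cdq _ _) (cdq _ _).
  set phi := (fun z : R * R => _) in cp tp xp.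
  have [cc tc xc] := C1_cst (W (s n, y n) - phi (s n, y n)).
  have [cs' ts' xs'] := C1_add cp cc.
  have E : W (s n, y n) = phi (s n, y n) + (W (s n, y n) - phi (s n, y n)) by ring.
  have tch : exists2 r : R, 0 < r & forall v : R * R, box (s n, y n) r v ->
      W v <= phi v + (W (s n, y n) - phi (s n, y n)).
    exists (Num.min (y n - a) (b - y n)); first by rewrite lt_min !subr_gt0.
    move=> v [_ /=]; rewrite lt_min !ltr_norml => hv.
    have v2 : a <= v.2 <= b by lra.
    have := hZm n (t n) v.1 (x n) v.2 (xab n) v2; rewrite /Phi /phi -!surjective_pairing /=.
    have sq (c d : R) : (c - d) ^+ 2 = (d - c) ^+ 2 by ring.
    by rewrite (sq v.1) (sq v.2) (sq (s n)) (sq (y n)); lra.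
  have := subW (z := (s n, y n)) yn cs' E tch.
  rewrite ts' xs' tc xc tp xp !addr0 /= /Gneg.
  rewrite (_ : (2 * nu)^-1 * (2 * (s n - t n)) = - ((t n - s n) / nu)); last by field; rewrite gt_eqF.
  by rewrite (_ : - (n.+1%:R / 2 * (2 * (y n - x n))) = p n) // /p; field.
have cth : (t n - s n) / nu @[n --> F] --> (th - sh) / nu.
  by apply: cvgM; [exact: cvgB|exact: cvg_cst].
(* The sub-solution inequality caps [H] along the sequence, so coercivity bounds the gradients,
   which then converge along [F]. *)
have [K hK] := coH (la + `|(th - sh) / nu| + 2).
have [qh _ cqh] : exists2 l : R, - K <= l <= K & p n + psi' (x n) @[n --> F] --> l.
  apply: ultra_lim; move/cvgrPdist_lt : cth => /(_ 1 ltr01) hth.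
  apply: filterS (filterI (nin x cx) hth) => n [/S1 h1 h2].
  rewrite /= -ler_norml leNgt; apply/negP => /ltW /(hK (t n) (x n)).
  move: h2; rewrite ltr_norml; have := ler_norm (- ((th - sh) / nu)); rewrite normrN.
  move: h1; lra.
have cp' : psi' (x n) @[n --> F] --> psi' xh by exact: cvg_cont1.
have cph : p n @[n --> F] --> qh - psi' xh.
  have E : p = (fun n => (p n + psi' (x n)) - psi' (x n)).
    by apply/funext => n; rewrite addrK.
  by rewrite E; exact: cvgB.
exists th, sh, xh, (qh - psi' xh); split => //.
  rewrite subrK; apply: le_lim (cvgD cth (cvg_cont3 PF cH ct cx cqh)) (cvg_cst la) _.
  by apply: filterS (nin x cx) => n /S1.
apply/ler_addgt0Pr => e e0.
(* As [W] is only upper semicontinuous, the discount term needs a lower bound on [W (s n, y n)]. It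
   comes from maximality tested at the limit point and semicontinuity of [U], with an error [d] such
   that [be * d <= e]. *)
have e1 : 0 < e / (be + 1) by rewrite divr_gt0 // ltr_wpDl.
set d := e / (be + 1) in e1.
have ed : be * d <= e.
  by rewrite /d mulrCA ger_pMr // ler_pdivrMr ?ltr_wpDl // mul1r lerDl.
have cB : be * (Psi th sh xh - (U (th, xh) + d) + (t n - s n) ^+ 2 / (2 * nu) + psi (x n))
    - (t n - s n) / nu - H (s n) (y n) (p n) @[n --> F] -->
    be * (Psi th sh xh - (U (th, xh) + d) + (th - sh) ^+ 2 / (2 * nu) + psi xh)
    - (th - sh) / nu - H sh xh (qh - psi' xh).
  apply: cvgB; last exact: (cvg_cont3 PF cH cs cy cph).
  apply: cvgB => //; apply: cvgM; first exact: cvg_cst.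
  by apply: cvgD => //; apply: cvgD => //; exact: cvg_cst.
have : be * (Psi th sh xh - (U (th, xh) + d) + (th - sh) ^+ 2 / (2 * nu) + psi xh)
    - (th - sh) / nu - H sh xh (qh - psi' xh) <= - lb.
  apply: le_lim cB (cvg_cst (- lb)) _.
  have := usc_lim PF ct cx uU e1 => h1.
  apply: filterS (filterI (nin y cy) h1) => n [/S2 k1 /= k2].
  apply: le_trans k1; do 2 apply: lerB => //.
  apply: ler_wpM2l => //; have := diag n th sh xh xhab; have := npos n (x n - y n).
  by rewrite /Phi; lra.
rewrite /Psi; move: ed; nra.
Qed.

End Doubling.

Lemma archi_mul (k C : R) : 0 < k -> exists N : nat, C < N%:R * k.
Proof.
move=> k0; exists (Num.truncn `|C / k|).+1.
have := truncnS_gt `|C / k|; have := ler_norm (C / k).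
by rewrite -ltr_pdivrMr //; lra.
Qed.

(** The doubling parameter in time cannot simply tend to [0], since its
    threshold would depend on [U], [W] and [psi]: instead, a pigeonhole argument
    on the maxima along [nu = 2 ^- i] bounds it from below uniformly. *)
Lemma comparison H (C L eta : R) : assA0 H -> assA2 H -> assA3 H -> 0 < eta ->
  exists K : R, forall U W (be la lb a b : R) (psi psi' : R -> R) (t0 x0 : R),
  usc U -> usc W -> t_periodic U -> t_periodic W -> 0 <= be ->
  (forall x : R, is_derive x 1 psi (psi' x)) -> continuous psi' ->
  (forall z, a < z.2 < b -> vsub_at 0 H la U z) ->
  (forall z, a < z.2 < b -> vsub_at be (Gneg H) (- lb) W z) ->
  a <= x0 <= b ->
  (forall t s x, x = a \/ x = b ->
    U (t, x) + W (s, x) - psi x < U (t0, x0) + W (t0, x0) - psi x0) ->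
  la <= L -> (forall t s x, a <= x <= b -> U (t, x) - U (s, x) <= C) ->
  exists t s x p, [/\ a < x < b,
    U (t0, x0) + W (t0, x0) - psi x0 <= U (t, x) + W (s, x) - psi x,
    `|p + psi' x| <= K
    & lb - la - eta <= be * (- W (s, x)) + H s x p - H s x (p + psi' x)].
Proof.
move=> cH [om [[om0 omH om_cvg] hom]] coH eta0.
have [r0 [r00 hr0]] : exists r0, 0 < r0 /\ om r0 <= eta.
  have : \forall r \near (0 : R)^'+, `|0 - om r| < eta.
    by move/cvgrPdist_lt : om_cvg; exact.
  have : \forall r \near (0 : R)^'+, 0 < r by exact: nbhs_right_gt.
  move=> h1 h2; have [r [q1 q2]] := filter_ex (filterI h1 h2); exists r; split => //.
  by move: q2; rewrite sub0r normrN => q2; apply: le_trans (ler_norm _) (ltW q2).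
have L2 : 0 < 2 + `|L| by rewrite ltr_pwDl.
(* With [|t - s| <= ka] and [|t - s| * |(t - s) / nu| <= ka ^+ 2], the argument of the modulus is at
   most [ka * (1 + |L|) + ka ^+ 2 <= r0]. *)
set ka := Num.min 1 (r0 / (2 + `|L|)).
have ka0 : 0 < ka by apply: minr_gt0 => //; exact: divr_gt0.
have ka1 : ka <= 1 by rewrite ge_min lexx.
have kar : ka * (2 + `|L|) <= r0.
  by rewrite -ler_pdivlMr // ge_min lexx orbT.
clearbody ka.
have ka4 : 0 < ka ^+ 2 / 4 by rewrite divr_gt0 // exprn_gt0.
(* If no level up to [N] were good, each halving of [nu] would lower the maximum by [ka ^+ 2 / 4],
   in total by more than [C]. But merging the two times of the first maximum point costs at most
   [C], the time oscillation of [U]. *)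
have [N hN] := archi_mul C ka4.
(* At a good level [|(t - s) / nu| <= ka * 2 ^+ N], so [H], and with it the gradient, is bounded in
   terms of [H], [C], [L] and [eta] only. *)
have [K hK] := coH (L + ka * 2 ^+ N + 1).
exists K => U W be la lb a b psi psi' t0 x0 uU uW pU pW be0 dpsi cpsi' sU sW x0ab bd laL oscU.
pose nu (i : nat) : R := 2^-1 ^+ i.
have nu0 i : 0 < nu i by rewrite exprn_gt0 // invr_gt0.
have nuS i : nu i = 2 * nu i.+1 by rewrite /nu exprS mulVKf.
have nu1 i : nu i <= 1 by rewrite exprn_ile1 // ?invr_ge0 // invf_le1 // ler1n.
pose Psi i (q : R * R * R) := U (q.1.1, q.2) + W (q.1.2, q.2) - (q.1.1 - q.1.2) ^+ 2 / (2 * nu i) - psi q.2.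
have ex i : exists q : (R * R * R) * R, [/\ a < q.1.2 < b,
    forall q', a <= q'.2 <= b -> Psi i q' <= Psi i q.1,
    (q.1.1.1 - q.1.1.2) / nu i + H q.1.1.1 q.1.2 (q.2 + psi' q.1.2) <= la
    & lb <= be * (- W (q.1.1.2, q.1.2)) + (q.1.1.1 - q.1.1.2) / nu i + H q.1.1.2 q.1.2 q.2].
  have [t [s [x [p [h1 h2 h3 h4]]]]] := doubling cH uU uW pU pW (nu0 i) be0 dpsi cpsi' sU sW coH x0ab bd.
  by exists ((t, s, x), p); split => // q' hq'; exact: h2.
have [q hq] := choice ex.
have [i iN hi] : exists2 i, (0 < i <= N)%N &
    ((q i).1.1.1 - (q i).1.1.2) ^+ 2 <= ka ^+ 2 * nu i.
  apply: contrapT => hno.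
  have step i : (0 < i <= N)%N -> ka ^+ 2 * nu i < ((q i).1.1.1 - (q i).1.1.2) ^+ 2.
    by move=> iN; rewrite ltNge; apply/negP => hle; apply: hno; exists i.
  have dec i : (i <= N)%N -> Psi i (q i).1 + i%:R * (ka ^+ 2 / 4) <= Psi 0%N (q 0%N).1.
    elim: i => [|i IH] iN; first by rewrite mul0r addr0.
    apply: le_trans (IH (ltnW iN)).
    have [_ /(_ (q i.+1).1) h _ _] := hq i; have [/andP[a1 a2] _ _ _] := hq i.+1.
    have {}h := h (introT andP (conj (ltW a1) (ltW a2))).
    suff : Psi i.+1 (q i.+1).1 + ka ^+ 2 / 4 <= Psi i (q i.+1).1 by rewrite -natr1; lra.
    have := step i.+1 iN; rewrite /Psi (nuS i).
    set d := ((_ - _) ^+ 2); set n := nu i.+1 => hd.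
    have n0 : 0 < n := nu0 _.
    suff : ka ^+ 2 / 4 <= d / (2 * n) - d / (2 * (2 * n)) by lra.
    have -> : d / (2 * n) - d / (2 * (2 * n)) = (d / n) / 4 by field; rewrite gt_eqF.
    by rewrite ler_pM2r ?invr_gt0 // ler_pdivlMr // ltW.
  have := dec N (leqnn N).
  have [/andP[a1 a2] _ _ _] := hq 0%N; set w := (q 0%N).1 in a1 a2 *.
  have wab : a <= w.2 <= b by rewrite !ltW.
  have [_ /(_ ((w.1.2, w.1.2), w.2) wab) h _ _] := hq N.
  have h2 := oscU w.1.1 w.1.2 w.2 wab.
  have h3 : 0 <= (w.1.1 - w.1.2) ^+ 2 / (2 * nu 0%N).
    by rewrite divr_ge0 ?sqr_ge0 // mulr_ge0 // ltW.
  move: h; rewrite {1}/Psi /= subrr expr0n /= mul0r subr0 => h.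
  rewrite {2}/Psi; lra.
have [xab hmax h3 h4] := hq i.
move: hi xab hmax h3 h4; set t := (q i).1.1.1; set s := (q i).1.1.2; set x := (q i).1.2.
set p := (q i).2 => hi xab hmax h3 h4.
have n0 := nu0 i; set n := nu i in n0 hi h3 h4.
have n1 : n <= 1 := nu1 i.
have nN : 1 <= n * 2 ^+ N.
  rewrite /n /nu exprVn -ler_pdivrMl ?invr_gt0 ?exprn_gt0 // invrK mulr1.
  by apply: ler_weXn2l; [rewrite ler1n|case/andP: iN].
have ts : `|t - s| <= ka.
  rewrite -ler_sqr ?nnegrE ?(ltW ka0) // real_normK ?num_real //.
  by apply: le_trans hi _; rewrite ger_pMr // exprn_gt0.
have th1 : `|t - s| * `|(t - s) / n| <= ka ^+ 2.
  rewrite normrM mulrA -expr2 real_normK ?num_real // normfV (gtr0_norm n0).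
  by rewrite ler_pdivrMr.
have th2 : `|(t - s) / n| <= ka * 2 ^+ N.
  rewrite normrM normfV (gtr0_norm n0) ler_pdivrMr // -mulrA (mulrC _ n).
  by apply: le_trans ts _; rewrite ler_pMr.
have Hle : H t x (p + psi' x) <= L + `|(t - s) / n|.
  have := ler_norm (- ((t - s) / n)); rewrite normrN; lra.
exists t, s, x, p; split => //.
- have xab' : a <= x0 <= b := x0ab.
  have := hmax ((t0, t0), x0) x0ab; rewrite /Psi /= subrr expr0n /= mul0r subr0.
  rewrite -/t -/s -/x -/n.
  have : 0 <= (t - s) ^+ 2 / (2 * n) by rewrite divr_ge0 ?sqr_ge0 // mulr_ge0 // ltW.
  lra.
- rewrite leNgt; apply/negP => /ltW /(hK t x); lra.
- have := hom s t x (p + psi' x).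
  set r := `|s - t| * _ => hr.
  have r_ge : 0 <= r by rewrite mulr_ge0 // addr_ge0 // le_max lexx orbT.
  have rr0 : r <= r0.
    have hm : Num.max (H t x (p + psi' x)) 0 <= `|L| + `|(t - s) / n|.
      rewrite ge_max addr_ge0 // andbT; apply: le_trans Hle _.
      by rewrite lerD2r ler_norm.
    rewrite /r distrC; apply: (@le_trans _ _ (`|t - s| * (1 + (`|L| + `|(t - s) / n|)))).
      by apply: ler_wpM2l => //; rewrite lerD2l.
    rewrite addrA mulrDr; apply: le_trans kar.
    have e1 : `|t - s| * (1 + `|L|) <= ka * (1 + `|L|) by apply: ler_wpM2r.
    have e2 : ka ^+ 2 <= ka by rewrite expr2 ger_pMr.
    rewrite [X in _ <= ka * X](_ : _ = (1 + `|L|) + 1); last by ring.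
    by rewrite mulrDr mulr1; lra.
  have : om r <= om r0 by apply: omH; rewrite ?in_itv /= ?andbT // ltW.
  lra.
Qed.

End Comparison.

(** * State-constrained discounted problems and vanishing discount *)

Section Existence.
Context {R : realType}.
Implicit Types (u v w U V W phi chi : R * R -> R) (z : R * R).
Implicit Types (G H : R -> R -> R -> R) (al lam : R) (Om D : set R).

Lemma subsolutionP H lam u : locally_bdd u ->
  subsolution H lam u <-> vsub setT 0 H lam (star u).
Proof.
move=> bu; split=> [[_ h] z _ phi cp E tch|h]; last first.
  split=> // phi z cp [E] /near_box [r r0 hr].
  have := h z I phi cp; rewrite mul0r add0r; apply.
    by move: E; rewrite usc_envE // => -[].
  by exists r => // y /hr /=; rewrite usc_envE.
rewrite mul0r add0r; apply: h => //; split; first by rewrite usc_envE // E.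
by apply/near_box; have [r r0 hr] := tch; exists r => // y /hr; rewrite /= usc_envE.
Qed.

Lemma supersolutionP H lam u : locally_bdd u ->
  supersolution H lam u <-> vsub setT 0 (Gneg H) (- lam) (star (neg u)).
Proof.
move=> bu; split=> [[_ h] z _ phi cp E tch|h].
  have [cn tn xn] := C1_opp cp.
  have : lam <= dt (fun z => - phi z) z + H z.1 z.2 (dx (fun z => - phi z) z).
    apply: h => //; split; first by rewrite lsc_envE // -E.
    apply/near_box; have [r r0 hr] := tch; exists r => // y /hr.
    by rewrite /= lsc_envE // lee_fin lerN2.
  by rewrite tn xn /Gneg; lra.
split=> // phi z cp [E] /near_box [r r0 hr].
have [cn tn xn] := C1_opp cp.
have := h z I _ cn; rewrite tn xn /Gneg opprK => h'.
have E1 : star (neg u) z = - phi z by move: E; rewrite lsc_envE // => -[<-]; rewrite opprK.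
have E2 : exists2 r : R, 0 < r & forall y, box z r y -> star (neg u) y <= - phi y.
  by exists r => // y /hr /=; rewrite lsc_envE // lee_fin lerNr.
by have := h' E1 E2; lra.
Qed.

Lemma vsub_at_cst al G lam (c : R) z : al * c + G z.1 z.2 0 <= lam ->
  vsub_at al G lam (fun=> c) z.
Proof.
move=> h phi cp E [r r0 hr]; have [cc tc xc] := C1_cst c.
by have [<- <-] := C1_touch cp cc r0 E hr; rewrite tc xc addr0.
Qed.

Lemma vsub_at_addc al G lam (c : R) U z : vsub_at al G lam U z ->
  vsub_at al G (lam + al * c) (fun y => U y + c) z.
Proof.
move=> h phi cp E [r r0 hr]; have [cc tc xc] := C1_cst (- c).
have [cs ts xs] := C1_add cp cc.
have := h _ cs; rewrite ts xs tc xc !addr0 => h'.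
have E1 : U z = phi z + - c by rewrite -E; ring.
have E2 : exists2 r : R, 0 < r & forall y, box z r y -> U y <= phi y + - c.
  by exists r => // y /hr; lra.
by have := h' E1 E2; lra.
Qed.

Lemma vsub_at_undiscount al G lam (c : R) U z : vsub_at al G lam U z ->
  - c <= al * U z -> vsub_at 0 G (lam + c) U z.
Proof. by move=> h hc phi cp E tch; have := h phi cp E tch; lra. Qed.

Lemma vsub_at_slope G lam (p : R) U z :
  vsub_at 0 (fun t x q => G t x (p + q)) lam U z ->
  vsub_at 0 G lam (fun y => p * y.2 + U y) z.
Proof.
move=> h phi cp E [r r0 hr].
have dp (x : R) : is_derive x 1 (fun x : R => - p * x) ((fun _ : R => - p) x).
  by rewrite -[X in is_derive _ _ _ X]mulr1; apply: is_deriveZ.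
have d0 (x : R) : is_derive x 1 (fun _ : R => 0 : R) ((fun _ : R => 0 : R) x) by exact: is_derive_cst.
have [cc tc xc] := C1_sep d0 dp (fun x => @cvg_cst _ _ _ _ _) (fun x => @cvg_cst _ _ _ _ _).
have [cs ts xs] := C1_add cp cc.
have := h _ cs; rewrite ts xs tc xc !addr0.
rewrite (_ : p + (dx phi z - p) = dx phi z); last by ring.
rewrite !mul0r; apply; first by rewrite -E; ring.
by exists r => // y /hr; lra.
Qed.

Lemma star_eq_near u v z (r : R) y : locally_bdd u -> locally_bdd v ->
  (forall y, box z r y -> u y = v y) -> box z r y -> star u y = star v y.
Proof.
move=> bu bv h By; apply/eqP; rewrite eq_le.
by rewrite (star_mono_at bu bv _ By) ?(star_mono_at bv bu _ By) // => x /h ->.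
Qed.

Lemma locally_bdd_cst (c : R) : locally_bdd (fun _ : R * R => c).
Proof. by apply/locally_bddP => z; exists `|c|, 1. Qed.

Lemma locally_bdd_addc u (c : R) : locally_bdd u -> locally_bdd (fun z => u z + c).
Proof.
move=> /locally_bddP h; apply/locally_bddP => z; have [M [r [r0 hr]]] := h z.
by exists (M + `|c|), r; split => // y /hr ?; apply: le_trans (ler_normD _ _) _; lra.
Qed.

Lemma ulim_aff (I : Type) (F : set_system I) (w : I -> R * R -> R) (k a b : R) z :
  k * k = 1 -> Filter F -> (forall i z, w i (aff k a b z) = w i z) ->
  ulim F w (aff k a b z) = ulim F w z.
Proof.
move=> kk FF hw; congr inf; apply/seteqP; split=> M [r r0 h]; exists r => //.
  apply: filterS h => i h y By; rewrite -hw; apply: h.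
  by apply/box_aff.
apply: filterS h => i h y By; rewrite -(affK' a b kk y) hw; apply: h.
by apply/(box_aff a b _ _ _ kk); rewrite affK'.
Qed.

Lemma usc_cst (c : R) : usc (fun _ : R * R => c).
Proof. by move=> z e e0; exists 1 => // y _; rewrite ltrDl. Qed.

Lemma usc_addc U (c : R) : usc U -> usc (fun z => U z + c).
Proof.
move=> uU z e e0; have [r r0 hr] := uU z e e0.
by exists r => // y /hr; rewrite addrAC ltrD2r.
Qed.

(** The lower barrier is [- C1 / al] in [Om] and jumps to the upper barrier [C0 / al] outside, which
    forces that value on [u] there. It has to be a sub-solution in [Om] only, whereas the constant
    [C0 / al] is a super-solution everywhere; hence [u] is a super-solution in the whole plane, edge
    of [Om] included. *)
Lemma discount Om al G (C0 C1 : R) : 0 < al -> assA0 G ->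
  (forall t x p, - C0 <= G t x p) -> (forall t x, G t x 0 <= C1) ->
  (forall x, Om x -> exists2 r : R, 0 < r & forall y, `|y - x| < r -> Om y) ->
  exists u, [/\ usc u, forall z, - C1 / al <= u z <= C0 / al,
     forall z, ~ Om z.2 -> u z = C0 / al,
     vsub Om al G 0 u & vsub setT al (Gneg G) 0 (star (neg u))] /\
   forall a b, (forall t x p, G (t + a) (x + b) p = G t x p) ->
     (forall x, Om (x + b) <-> Om x) -> forall z, u (z.1 + a, z.2 + b) = u z.
Proof.
move=> al0 cG hC0 hC1 oOm.
have ale0 := ltW al0.
have C01 : - C1 / al <= C0 / al.
  by rewrite ler_pM2r ?invr_gt0 //; have := hC0 0 0 0; have := hC1 0 0; lra.
pose U1 z : R := if `[< Om z.2 >] then - C1 / al else C0 / al.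
pose U2 (z : R * R) : R := C0 / al.
have b2 : locally_bdd U2 by exact: locally_bdd_cst.
have U12 z : U1 z <= U2 z by rewrite /U1 /U2; case: ifP.
have b1 : locally_bdd U1.
  apply: (locally_bdd_between (locally_bdd_cst (- C1 / al)) b2) => z.
  by rewrite U12 andbT /U1; case: ifP.
have sub1 : vsub Om al G 0 (star U1).
  move=> z Omz phi cp E [r r0 hr]; have [s s0 hs] := oOm _ Omz.
  have Es y : box z s y -> star U1 y = - C1 / al.
    move=> By; have Ec : star (fun=> - C1 / al) y = - C1 / al.
      by rewrite (star_id (@usc_cst _) (locally_bdd_cst _)).
    rewrite -[RHS]Ec; apply: (star_eq_near b1 (locally_bdd_cst _) _ By) => x [_ x2].
    by rewrite /U1 asboolT //; apply: hs.
  have [cc tc xc] := C1_cst (- C1 / al).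
  rewrite Es in E *; last exact: box_center.
  have m0 : 0 < Num.min r s by exact: minr_gt0.
  have [|<- <-] := C1_touch cp cc m0 E.
    move=> y By; rewrite -(Es y); last by apply: box_sub By; rewrite ge_min lexx orbT.
    by apply: hr; apply: box_sub By; rewrite ge_min lexx.
  by rewrite tc xc addr0 mulrC divfK ?gt_eqF //; have := hC1 z.1 z.2; lra.
have sup2 : vsub setT al (Gneg G) (- 0) (star (neg U2)).
  have -> : star (neg U2) = (fun=> - (C0 / al)).
    rewrite (_ : neg U2 = (fun=> - (C0 / al))) //.
    exact: (star_id (@usc_cst (- (C0 / al))) (@locally_bdd_cst (- (C0 / al)))).
  move=> z _.
  apply: vsub_at_cst; rewrite /Gneg mulrN mulrC divfK ?gt_eqF // !oppr0.
  by have := hC0 z.1 z.2 0; lra.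
exists (perron Om al 0 G U1 U2); split; first split.
- exact: (perron_usc cG oOm b1 b2 U12 sub1 (@usc_cst _)).
- move=> z; have /andP[h1 ->] := perron_between U12 sub1 z.
  by rewrite andbT; apply: le_trans h1; rewrite /U1; case: ifP.
- move=> z nOm; have := perron_between U12 sub1 z.
  by rewrite {1}/U1 asboolF // => /andP[? ?]; apply/eqP; rewrite eq_le; apply/andP.
- have := perron_sub cG oOm b1 b2 U12 sub1.
  rewrite star_id; [by []| |exact: (perron_bdd b1 b2 U12 sub1)].
  exact: (perron_usc cG oOm b1 b2 U12 sub1 (@usc_cst _)).
- by have := perron_super ale0 cG oOm b1 b2 U12 sub1 sup2; rewrite oppr0.
- move=> a b hG hOm z.
  have hOm' x : Om (x - b) <-> Om x by rewrite -hOm subrK.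
  have hU1 (y : R * R) : U1 (y.1 - a, y.2 - b) = U1 y.
    by rewrite /U1 /=; congr (if _ then _ else _); apply: asbool_equiv_eq.
  have hU1' (y : R * R) : U1 (y.1 - - a, y.2 - - b) = U1 y.
    by rewrite -hU1 /= !opprK !addrK; case: y.
  have hG' t x p : G (t + - a) (x + - b) p = G t x p by rewrite -hG !subrK.
  have hOm'' x : Om (x - - b) <-> Om x by rewrite opprK.
  apply/eqP; rewrite eq_le; apply/andP; split; last first.
    by apply: (perron_shift b1 b2 U12 sub1).
  have := @perron_shift _ Om al 0 G U1 U2 b1 b2 U12 sub1 (- a) (- b) hG' hOm'' hU1' _ (z.1 + a, z.2 + b).
  by rewrite /= !addrK -surjective_pairing; apply.
Qed.

Section Limit.
Variables (F : set_system nat) (w : nat -> R * R -> R) (Om : nat -> set R).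
Variables (al lam : nat -> R) (G : R -> R -> R -> R) (lamb K C : R).
Hypotheses (UF : UltraFilter F) (cG : assA0 G) (K0 : 0 <= K).
Hypotheses (bw : forall n, locally_bdd (w n)) (uw : forall n, usc (w n)).
Hypotheses (sw : forall n, vsub (Om n) (al n) G (lam n) (w n)).
Hypotheses (Sw : forall n, vsub (Om n) (al n) (Gneg G) (- lam n) (star (neg (w n)))).
Hypotheses (al_cvg : al n @[n --> F] --> (0 : R)) (lam_cvg : lam n @[n --> F] --> lamb).
Hypotheses (exh : forall x, exists2 r : R, 0 < r & F [set n | forall y, `|y - x| < r -> Om n y]).
Hypotheses (osc : forall n z z', Om n z.2 -> Om n z'.2 ->
  w n z - w n z' <= K * `|z.2 - z'.2| + C).
Hypotheses (w0 : forall n, w n (0, 0) = 0).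

Let PF : ProperFilter F. Proof. exact: ultra_proper. Qed.

Let near_bd z (r : R) n y : 0 < r -> box z r y -> Om n 0 -> Om n y.2 ->
  `|w n y| <= K * (`|z.2| + r) + C.
Proof.
move=> r0 [_ y2] O0 Oy.
have yr : `|y.2| <= `|z.2| + r.
  by rewrite -[y.2](subrK z.2) addrC; apply: le_trans (ler_normD _ _) _; lra.
have Ky : K * `|y.2| <= K * (`|z.2| + r) by exact: ler_wpM2l.
have := osc (z := y) (z' := (0, 0)) Oy O0; have := osc (z := (0, 0)) (z' := y) O0 Oy.
by rewrite w0 /= !subr0 !sub0r normrN => h1 h2; rewrite ler_norml; apply/andP; split; lra.
Qed.

Let Om0 : F [set n | Om n 0].
Proof.
have [r r0 h] := exh 0; apply: filterS h => n h; apply: h.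
by rewrite subrr normr0.
Qed.

Let lw : lbd F w.
Proof.
move=> z; have [r r0 h] := exh z.2; exists (K * (`|z.2| + r) + C), r => //.
apply: filterS (filterI h Om0) => n [h1 h2] y By; apply: near_bd => //.
by apply: h1; case: By.
Qed.

Let lW : lbd F (fun n => star (neg (w n))).
Proof.
move=> z; have [r r0 h] := exh z.2; exists (K * (`|z.2| + r) + C), r => //.
apply: filterS (filterI h Om0) => n [h1 h2] y By.
have bn := locally_bddN (bw n).
have hb x : box z r x -> `|w n x| <= K * (`|z.2| + r) + C.
  by move=> Bx; apply: near_bd => //; apply: h1; case: Bx.
rewrite ler_norml; apply/andP; split.
  by apply: le_trans (le_star y bn); have := hb y By; rewrite /neg ler_norml; lra.
have [s s0 hs] := box_open By.
by apply: (star_le bn s0) => x /hs /hb; rewrite ler_norml; lra.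
Qed.

(** The half-relaxed limits need not agree. As the discount has vanished, constants may be added to
    solutions: the lower limit is lifted above the upper one and Perron's method runs in between. *)
Lemma relaxed_limit : exists U u, [/\ usc U, vsub setT 0 G lamb U,
    forall z z', U z - U z' <= K * `|z.2 - z'.2| + 2 * C,
    forall z, U z <= u z <= U z + 2 * C & solution G lamb u] /\
  [/\ forall z c, F [set n | c <= w n z] -> c <= U z
   & forall a b, (forall t x p, G (t + a) (x + b) p = G t x p) ->
     (forall n z, w n (z.1 + a, z.2 + b) = w n z) ->
     forall z, U (z.1 + a, z.2 + b) = U z /\ u (z.1 + a, z.2 + b) = u z].
Proof.
set U := ulim F w; set W := ulim F (fun n => star (neg (w n))).
have uU : usc U by exact: usc_ulim.
have uW : usc W by exact: usc_ulim.
have exh' x : setT x -> exists2 r : R, 0 < r & F [set n | forall y, `|y - x| < r -> Om n y].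
  by move=> _; exact: exh.
have sU : vsub setT 0 G lamb U by exact: (ulim_sub PF lw cG uw al_cvg lam_cvg exh' sw).
have cGn : assA0 (Gneg G).
  move=> z; rewrite /continuous_at /Gneg; apply: cvgN.
  apply: (@cvg_cont3 _ _ _ _ _ _ G z.1.1 z.1.2 (- z.2)) => //.
  - by apply: (@continuous_comp _ _ _ fst fst); exact: cvg_fst.
  - by apply: (@continuous_comp _ _ _ fst snd); [exact: cvg_fst|exact: cvg_snd].
  - by apply: cvgN; exact: cvg_snd.
have sW : vsub setT 0 (Gneg G) (- lamb) W.
  apply: (ulim_sub PF lW cGn _ al_cvg _ exh' Sw).
    by move=> n; apply: usc_star; exact: locally_bddN.
  exact: cvgN.
have near0 z (e : R) : 0 < e -> exists r : R, [/\ 0 < r, K * r <= e &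
    F [set n | (forall y, box z r y -> Om n y.2)]].
  move=> e0; have [r r0 h] := exh z.2.
  have K1 : 0 < K + 1 by rewrite ltr_wpDl.
  exists (Num.min r (e / (K + 1))); split.
  - by apply: minr_gt0 => //; exact: divr_gt0.
  - have h1 : Num.min r (e / (K + 1)) <= e / (K + 1) by rewrite ge_min lexx orbT.
    apply: le_trans (ler_wpM2l K0 h1) _; rewrite mulrCA ger_pMr //.
    by rewrite ler_pdivrMr // mul1r lerDl.
  - apply: filterS h => n h y [_ y2]; apply: h; apply: lt_le_trans y2 _.
    by rewrite ge_min lexx.
(* The limit [b] of the values at [z] is a common reference, from which [U] and [- W] deviate by at
   most [C] in opposite directions. *)
have blim z : exists b, [/\ w n z @[n --> F] --> b, b <= U z <= b + C & - b <= W z <= - b + C].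
  have [r0 r00 h0] := exh z.2.
  have Fw : F [set n | - (K * (`|z.2| + r0) + C) <= w n z <= K * (`|z.2| + r0) + C].
    apply: filterS (filterI h0 Om0) => n [h1 h2] /=; rewrite -ler_norml.
    apply: near_bd => //; first exact: box_center.
    by apply: h1; rewrite subrr normr0.
  have [b _ cb] := ultra_lim UF Fw; exists b; split => //; apply/andP; split.
  - apply: (ulim_ge PF lw) => M [r r_gt0 hM].
    apply: le_lim cb (cvg_cst M) _; apply: filterS hM => n; apply.
    exact: box_center.
  - apply/ler_addgt0Pr => e e0; have e2 : 0 < e / 2 by lra.
    have [r [r_gt0 Kr h]] := near0 z _ e2.
    apply: (ulim_le PF lw); exists r => //.
    move/cvgrPdist_lt : cb => /(_ _ e2) cb.
    apply: filterS (filterI cb h) => n [/= h1 h2] y By.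
    have := osc (h2 y By) (h2 z (box_center z r_gt0)).
    have : K * `|y.2 - z.2| <= K * r by apply: ler_wpM2l => //; case: By => _ /ltW.
    by move: h1; rewrite ltr_norml; lra.
  - apply: (ulim_ge PF lW) => M [r r_gt0 hM].
    apply: le_lim (cvgN cb) (cvg_cst M) _; apply: filterS hM => n /(_ z (box_center z r_gt0)).
    by apply: le_trans; apply: (le_star z (locally_bddN (bw n))).
  - apply/ler_addgt0Pr => e e0; have e2 : 0 < e / 2 by lra.
    have [r [r_gt0 Kr h]] := near0 z _ e2.
    apply: (ulim_le PF lW); exists r => //.
    move/cvgrPdist_lt : cb => /(_ _ e2) cb.
    apply: filterS (filterI cb h) => n [/= h1 h2] y By.
    have [s s0 hs] := box_open By.
    apply: (star_le (locally_bddN (bw n)) s0) => x /hs Bx.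
    have := osc (h2 z (box_center z r_gt0)) (h2 x Bx).
    have : K * `|z.2 - x.2| <= K * r.
      by rewrite distrC; apply: ler_wpM2l => //; case: Bx => _ /ltW.
    by move: h1; rewrite ltr_norml /neg; lra.
have oscU z z' : U z - U z' <= K * `|z.2 - z'.2| + 2 * C.
  have [b [cb hb _]] := blim z; have [b' [cb' hb' _]] := blim z'.
  have : b - b' <= K * `|z.2 - z'.2| + C.
    apply: le_lim (cvgB cb cb') (cvg_cst _) _.
    have [r [r_gt0 _ h]] := near0 z _ ltr01; have [r' [r'_gt0 _ h']] := near0 z' _ ltr01.
    apply: filterS (filterI h h') => n [h1 h2].
    by apply: osc; [apply: h1|apply: h2]; exact: box_center.
  lra.
have bU : locally_bdd U.
  apply/locally_bddP => z; exists (`|U z| + K + 2 * C), 1; split => // y [_ y2].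
  have := oscU y z; have := oscU z y; rewrite (distrC z.2).
  have : K * `|y.2 - z.2| <= K by apply: ler_piMr => //; exact: ltW.
  have := ler_norm (U z); have := ler_norm (- U z); rewrite normrN ler_norml.
  by move=> *; apply/andP; split; lra.
have bNU := locally_bddN bU.
have bW : locally_bdd W.
  apply: (locally_bdd_between bNU (locally_bdd_addc (2 * C) bNU)) => z.
  by have [b [_ hb hb']] := blim z; lra.
(* Since [- W <= b <= U], the order is wrong for Perron; as [U <= b + C] and [- W >= b - C], a lift
   by [2 * C] repairs it. *)
set U2 := fun z => - (W z + - (2 * C)).
have U12 z : U z <= U2 z by have [b [_ hb hb']] := blim z; rewrite /U2; lra.
have U2U z : U2 z <= U z + 2 * C by have [b [_ hb hb']] := blim z; rewrite /U2; lra.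
have b2 : locally_bdd U2 by apply: locally_bddN; exact: locally_bdd_addc.
have oT x : setT x -> exists2 r : R, 0 < r & forall y : R, `|y - x| < r -> setT y by exists 1.
have sub1 : vsub setT 0 G lamb (star U) by rewrite star_id.
have sup2 : vsub setT 0 (Gneg G) (- lamb) (star (neg U2)).
  have -> : neg U2 = (fun z => W z + - (2 * C)).
    by apply/funext => z; rewrite /neg /U2 opprK.
  rewrite star_id; [|exact: usc_addc|].
    by move=> z zT; have := vsub_at_addc (c := - (2 * C)) (sW z zT); rewrite mul0r addr0.
  have := locally_bddN b2; congr locally_bdd.
  by apply/funext => z; rewrite /U2 opprK.
set u := perron setT 0 lamb G U U2.
have btw := perron_between U12 sub1.
have bu := perron_bdd bU b2 U12 sub1.
exists U, u; split; split => //.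
- by move=> z; have := btw z; have := U2U z; rewrite -/u; lra.
- split.
    by apply/(subsolutionP _ _ bu); exact: (perron_sub cG oT bU b2 U12 sub1).
  by apply/(supersolutionP _ _ bu); exact: (perron_super (lexx 0) cG oT bU b2 U12 sub1 sup2).
- move=> z c h; have [b [cb hb _]] := blim z.
  suff : c <= b by lra.
  exact: le_lim (cvg_cst c) cb h.
- move=> a b hG hw.
  have kk : 1 * 1 = 1 :> R by rewrite mulr1.
  have FF : Filter F by exact: filter_filter.
  have Ea z : aff 1 a b z = (z.1 + a, z.2 + b) by rewrite /aff mul1r.
  have hw' n z : w n (aff 1 a b z) = w n z by rewrite Ea.
  have hU z : U (z.1 + a, z.2 + b) = U z by rewrite -Ea; exact: ulim_aff.
  have hW z : W (z.1 + a, z.2 + b) = W z.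
    rewrite -Ea; apply: ulim_aff => // n y.
    rewrite -star_aff //; last exact: locally_bddN.
    by congr star; apply/funext => x; rewrite /neg /= hw'.
  have hU' z : U (z.1 - a, z.2 - b) = U z by rewrite -hU /= !subrK -surjective_pairing.
  have hU2 z : U2 (z.1 + a, z.2 + b) = U2 z by rewrite /U2 hW.
  have hU2' z : U2 (z.1 - a, z.2 - b) = U2 z by rewrite -hU2 /= !subrK -surjective_pairing.
  have hG' t x p : G (t + - a) (x + - b) p = G t x p by rewrite -hG !subrK.
  have hU'' z : U (z.1 - - a, z.2 - - b) = U z by rewrite !opprK hU.
  have hU2'' z : U2 (z.1 - - a, z.2 - - b) = U2 z by rewrite !opprK hU2.
  have hT (c x : R) : setT (x - c) <-> setT x by [].
  move=> z; split=> //; apply/eqP; rewrite eq_le; apply/andP; split; last first.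
    by apply: (perron_shift bU b2 U12 sub1).
  have := perron_shift bU b2 U12 sub1 hG' (hT _) hU'' hU2'' (z.1 + a, z.2 + b).
  by rewrite /= !addrK -surjective_pairing; apply.
Qed.

End Limit.
End Existence.

(** * Correctors and the homogenized Hamiltonian *)

Section Cell.
Context {R : realType}.
Implicit Types (u v w U V W phi chi : R * R -> R) (z : R * R).
Implicit Types (G H Ha : R -> R -> R -> R) (al lam : R) (Om D : set R).

Definition slope_bounded H := forall M : R, exists B : R,
  forall t x p, `|p| <= M -> `|H t x p| <= B.

Definition slope_unif H := forall M e : R, 0 < e -> exists d : R, 0 < d /\
  forall t x p p', `|p| <= M -> `|p - p'| <= d -> `|H t x p - H t x p'| <= e.

Definition periodic3 H := forall (k j : int) t x p,
  H (t + k%:~R) (x + j%:~R) p = H t x p.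

Lemma shift01 (t : R) : exists k : int, 0 <= t + k%:~R <= 1.
Proof.
exists (- Num.floor t); rewrite mulrNz.
by have := floor_le t; have := floorD1_gt t; rewrite intrD; lra.
Qed.

Lemma compact_cube (M : R) :
  compact ((`[0, 1]%classic `*` `[0, 1]%classic) `*` `[- M, M]%classic : set (R * R * R)).
Proof. by do ! apply: compact_setX; exact: segment_compact. Qed.

Lemma cont_bounded_cube H (M a b : R) : assA0 H -> a <= b -> exists B : R,
  forall t x p, 0 <= t <= 1 -> a <= x <= b -> `|p| <= M -> `|H t x p| <= B.
Proof.
move=> cH ab; have [M0|M0] := ltP M 0.
  by exists 0 => t x p _ _ /le_lt_trans /(_ M0); rewrite normr_lt0.
pose K := (`[0, 1]%classic `*` `[a, b]%classic) `*` `[- M, M]%classic : set (R * R * R).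
have cK : compact K by do ! apply: compact_setX; exact: segment_compact.
have K0 : K !=set0.
  by exists ((0, a), 0); split; [split|]; rewrite /= in_itv /=; lra.
have [Z e e0|Z _ hZ] := @usc_compact_max _ _ _ (fun Z : R * R * R => `|H Z.1.1 Z.1.2 Z.2|) cK K0.
  have /cvgrPdist_lt /(_ e e0) := cH Z; apply: filterS => Y h.
  by rewrite -ltrBlDl; apply: le_lt_trans (lerB_dist _ _) _; rewrite distrC.
exists (`|H Z.1.1 Z.1.2 Z.2|) => t x p ht hx hp; apply: (hZ ((t, x), p)).
by split; [split|]; rewrite /= in_itv //= -ler_norml.
Qed.

Lemma periodic_slope_bounded H : assA0 H -> periodic3 H -> slope_bounded H.
Proof.
move=> cH pH M; have [B hB] := cont_bounded_cube M cH (ler01 : 0 <= 1 :> R).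
exists B => t x p hp; have [k hk] := shift01 t; have [j hj] := shift01 x.
by rewrite -(pH k j); exact: hB.
Qed.

Lemma periodic_slope_unif H : assA0 H -> periodic3 H -> slope_unif H.
Proof.
move=> cH pH M e e0.
have /compact_near_coveringP cv := @compact_cube M.
have [d [d0 hd]] : exists d : R, 0 < d /\ ((`[0, 1]%classic `*` `[0, 1]%classic) `*` `[- M, M]%classic : set (R * R * R))
    `<=` [set Z | forall p', `|Z.2 - p'| <= d -> `|H Z.1.1 Z.1.2 Z.2 - H Z.1.1 Z.1.2 p'| <= e].
  have FF : Filter (0 : R)^'+ by typeclasses eauto.
  have hcv := cv _ (0 : R)^'+ (fun d Z => forall p', `|Z.2 - p'| <= d -> `|H Z.1.1 Z.1.2 Z.2 - H Z.1.1 Z.1.2 p'| <= e) FF.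
  have hpos : \forall d \near (0 : R)^'+, 0 < d by exact: nbhs_right_gt.
  have [|d [q1 q2]] := filter_ex (filterI hpos (hcv _)); last by exists d.
  move=> Z _; have e2 : 0 < e / 2 by lra.
  have /cvgrPdist_lt /(_ _ e2) /nbhs_ballP [r /= r0 hr] := cH Z.
  have r2 : 0 < r / 2 by lra.
  exists (ball Z (r / 2), [set d | d < r / 2]) => /=.
    by split; [exact: nbhsx_ballx|exact: nbhs_right_lt].
  move=> [[[t x] p] d] /= [[[b1 b2] b3] dr] p' hp'.
  move: b1 b2 b3; rewrite -!ball_normE /= => b1 b2 b3.
  have h1 : `|H Z.1.1 Z.1.2 Z.2 - H t x p| < e / 2.
    by apply: (hr ((t, x), p)); split; [split|]; rewrite -ball_normE /=; lra.
  have h2 : `|H Z.1.1 Z.1.2 Z.2 - H t x p'| < e / 2.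
    apply: (hr ((t, x), p')); split; [split|]; rewrite -ball_normE /=; try lra.
    by move: b3 hp'; rewrite ltr_norml ler_norml ltr_norml => /andP[? ?] /andP[? ?]; lra.
  by move: h1 h2; rewrite !ltr_norml ler_norml => /andP[? ?] /andP[? ?]; lra.
exists d; split => // t x p p' hp hpp'.
have [k hk] := shift01 t; have [j hj] := shift01 x.
rewrite -(pH k j t x p) -(pH k j t x p').
apply: (hd ((t + k%:~R, x + j%:~R), p)) => //.
by split; [split|]; rewrite /= in_itv //= -ler_norml.
Qed.

Lemma bounded_below H : slope_bounded H -> assA3 H ->
  exists C0 : R, forall t x p, - C0 <= H t x p.
Proof.
move=> bH h3; have [K hK] := h3 0; have [B hB] := bH K.
exists `|B| => t x p; have [h|h] := leP K `|p|.
  by apply: le_trans (hK t x p h); rewrite oppr_le0.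
by have := hB t x p (ltW h); rewrite ler_norml; have := ler_norm B; lra.
Qed.

Lemma star_addc u (c : R) z : locally_bdd u -> star (fun z => u z + c) z = star u z + c.
Proof.
move=> bu; have bc := locally_bdd_addc c bu.
apply/eqP; rewrite eq_le; apply/andP; split; apply/ler_addgt0Pr => e e0.
  have [r r0 h] := star_lt z bu e0.
  by apply: (star_le bc r0) => y /h; lra.
have [r r0 h] := star_lt z bc e0.
suff : star u z <= star (fun z => u z + c) z + e - c by lra.
by apply: (star_le bu r0) => y /h; lra.
Qed.

(** Since [al * u >= - C1], dropping the discount leaves a sub-solution at level [C1], so the
    oscillation bound is independent of [al]. Subtracting [u (0, 0)] turns its discount into the
    bounded level [- (al * c)]. *)
Lemma discount_normalized Om al G (C0 C1 K : R) : 0 < al -> assA0 G ->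
  (forall t x p, - C0 <= G t x p) -> (forall t x, G t x 0 <= C1) ->
  0 < K -> (forall t x p, K <= `|p| -> C1 < G t x p) ->
  (forall t x p, G (t + 1) x p = G t x p) ->
  (forall x, Om x -> exists2 r : R, 0 < r & forall y, `|y - x| < r -> Om y) ->
  (forall x y, Om x -> Om y -> exists a b, [/\ a < x < b, a < y < b & forall x', a < x' < b -> Om x']) ->
  exists (c : R) (w : R * R -> R), [/\ - C1 <= al * c <= C0,
     usc w /\ locally_bdd w, vsub Om al G (- (al * c)) w,
     vsub setT al (Gneg G) (al * c) (star (neg w))
    & w (0, 0) = 0] /\
  [/\ forall z z', Om z.2 -> Om z'.2 -> w z - w z' <= K * `|z.2 - z'.2| + (`|C1 + C0| + 1),
      forall z, ~ Om z.2 -> w z = C0 / al - c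
   & forall a b, (forall t x p, G (t + a) (x + b) p = G t x p) ->
     (forall x, Om (x + b) <-> Om x) -> forall z, w (z.1 + a, z.2 + b) = w z].
Proof.
move=> al0 cG hC0 hC1 K0 hK pG oOm cOm.
have [u [[uu bu out su Su] inv]] := discount al0 cG hC0 hC1 oOm.
have alb z : - C1 <= al * u z <= C0.
  have /andP[h1 h2] := bu z; rewrite ler_pdivrMr // in h1; rewrite ler_pdivlMr // in h2.
  by rewrite mulrC h1 h2.
have lbu : locally_bdd u by apply: (locally_bdd_between (locally_bdd_cst (- C1 / al)) (locally_bdd_cst (C0 / al))) => z; exact: bu.
have pu : t_periodic u.
  move=> t x; have := inv 1 0 _ _ (t, x); rewrite /= addr0; apply => //.
    by move=> t' x' p; rewrite addr0 pG.
  by move=> x'; rewrite addr0.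
have lbn := locally_bddN lbu.
exists (u (0, 0)), (fun z => u z + - u (0, 0)); split; split.
- exact: alb.
- by split; [exact: usc_addc|exact: locally_bdd_addc].
- move=> z Oz; have := vsub_at_addc (c := - u (0, 0)) (su z Oz).
  by rewrite add0r mulrN.
- have -> : star (neg (fun z => u z + - u (0, 0))) = (fun z => star (neg u) z + u (0, 0)).
    apply/funext => z; rewrite -star_addc //; congr star; apply/funext => y.
    by rewrite /neg opprD opprK.
  by move=> z zT; have := vsub_at_addc (c := u (0, 0)) (Su z zT); rewrite add0r.
- by rewrite subrr.
- move=> z z' Oz Oz'; have [a [b [h1 h2 h3]]] := cOm _ _ Oz Oz'.
  have := sub_osc uu pu K0 _ hK hC0 z.1 z'.1 h1 h2; rewrite -!surjective_pairing => h.
  rewrite (_ : _ - _ = u z - u z'); last by ring.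
  apply: h => y hy.
  rewrite -[C1]add0r; apply: vsub_at_undiscount; first exact: su (h3 _ hy).
  by case/andP: (alb y).
- by move=> z /out ->.
- by move=> a b ha hb z; rewrite inv.
Qed.

Section Periodic.
Variable Ha : R -> R -> R -> R.
Hypotheses (cH : assA0 Ha) (pH : periodic3 Ha) (h2 : assA2 Ha) (h3 : assA3 Ha).

Let bH : slope_bounded Ha. Proof. exact: periodic_slope_bounded. Qed.
Let uH : slope_unif Ha. Proof. exact: periodic_slope_unif. Qed.

(** Vanishing discount with [Om] the whole line, where the constraint is void. Invariance under
    integer translations survives the limit and turns the oscillation bound into boundedness. *)
Lemma cell_values_ex (p : R) : cell_values Ha p !=set0.
Proof.
pose G t x q := Ha t x (p + q).
have cG : assA0 G.
  move=> z; apply: (@cvg_cont3 _ _ _ _ _ _ Ha z.1.1 z.1.2 (p + z.2)) => //.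
  - by apply: (@continuous_comp _ _ _ fst fst); exact: cvg_fst.
  - by apply: (@continuous_comp _ _ _ fst snd); [exact: cvg_fst|exact: cvg_snd].
  - by apply: cvgD; [exact: cvg_cst|exact: cvg_snd].
have [C0 hC0] := bounded_below bH h3.
have hC0' t x q : - C0 <= G t x q by exact: hC0.
have [C1 hC1] := bH `|p|.
have hC1' t x : G t x 0 <= C1.
  by have := hC1 t x p (lexx _); rewrite /G addr0 ler_norml => /andP[].
have [K' hK'] := h3 (C1 + 1).
set K := `|K'| + `|p| + 1.
have K0 : 0 < K by rewrite ltr_wpDl // addr_ge0.
have hK t x q : K <= `|q| -> C1 < G t x q.
  move=> h; suff : C1 + 1 <= G t x q by lra.
  apply: hK'; have := lerB_normD q p; rewrite (addrC q) /K in h *.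
  by have := ler_norm K'; lra.
have pG (k j : int) t x q : G (t + k%:~R) (x + j%:~R) q = G t x q by exact: pH.
have al0 n : 0 < (n.+1%:R^-1 : R) by rewrite invr_gt0.
have oT (x : R) : setT x -> exists2 r : R, 0 < r & forall y : R, `|y - x| < r -> setT y by exists 1.
have cT (x y : R) : setT x -> setT y -> exists a b : R, [/\ a < x < b, a < y < b & forall x', a < x' < b -> setT x'].
  move=> _ _; exists (- (`|x| + `|y| + 1)), (`|x| + `|y| + 1).
  have := ler_norm x; have := ler_norm (- x); have := ler_norm y; have := ler_norm (- y).
  by rewrite !normrN; split => //; lra.
have pG1 t x q : G (t + 1) x q = G t x q by have := pG 1 0 t x q; rewrite addr0.
have ex n : exists cw : R * (R * R -> R), [/\ - C1 <= n.+1%:R^-1 * cw.1 <= C0,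
     usc cw.2 /\ locally_bdd cw.2, vsub setT n.+1%:R^-1 G (- (n.+1%:R^-1 * cw.1)) cw.2,
     vsub setT n.+1%:R^-1 (Gneg G) (n.+1%:R^-1 * cw.1) (star (neg cw.2))
    & cw.2 (0, 0) = 0] /\
  [/\ forall z z', setT z.2 -> setT z'.2 -> cw.2 z - cw.2 z' <= K * `|z.2 - z'.2| + (`|C1 + C0| + 1),
      forall z, ~ setT z.2 -> cw.2 z = C0 / n.+1%:R^-1 - cw.1
   & forall a b : R, (forall t x p, G (t + a) (x + b) p = G t x p) ->
     (forall x, setT (x + b) <-> setT x) -> forall z, cw.2 (z.1 + a, z.2 + b) = cw.2 z].
  have [c [w h]] := discount_normalized (al0 n) cG hC0' hC1' K0 hK pG1 oT cT.
  by exists (c, w).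
have [cw hcw] := choice ex; have [F UF oF] := ultra_oo.
have PF : ProperFilter F by exact: ultra_proper.
have FT (P : nat -> Prop) : (forall n, P n) -> F [set n | P n].
  by move=> h; apply: filterS filterT => n _; exact: h.
have [lam _ clam] : exists2 l : R, - C0 <= l <= C1 & - (n.+1%:R^-1 * (cw n).1) @[n --> F] --> l.
  apply: (ultra_lim UF); apply: FT => n; have [[h _ _ _ _] _] := hcw n.
  by case/andP: h => q1 q2; apply/andP; split; [rewrite lerN2|rewrite lerNl].
have cal : n.+1%:R^-1 @[n --> F] --> (0 : R).
  by have h := @cvg_harmonic R; exact: (cvg_oo_sub oF h).
have [|||||||||U [u [[uU sU oU Uu su] [_ inv]]]] := @relaxed_limit R F (fun n => (cw n).2) (fun=> setT)
    (fun n => n.+1%:R^-1) (fun n => - (n.+1%:R^-1 * (cw n).1)) G lam K (`|C1 + C0| + 1) UF cG (ltW K0).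
- by move=> n; have [[_ [_ ?] _ _ _] _] := hcw n.
- by move=> n; have [[_ [? _] _ _ _] _] := hcw n.
- by move=> n; have [[_ _ ? _ _] _] := hcw n.
- by move=> n; have [[_ _ _ ? _] _] := hcw n; rewrite opprK.
- exact: cal.
- exact: clam.
- by move=> x; exists 1 => //; exact: FT.
- by move=> n; have [_ [? _ _]] := hcw n.
- by move=> n; have [[_ _ _ _ ?] _] := hcw n.
have invZ (k j : int) z : U (z.1 + k%:~R, z.2 + j%:~R) = U z /\ u (z.1 + k%:~R, z.2 + j%:~R) = u z.
  apply: inv => [t x q|n y]; first exact: pG.
  by have [_ [_ _ h]] := hcw n; apply: h.
exists lam, u; split => //.
  exists (`|U (0, 0)| + K + 4 * (`|C1 + C0| + 1)) => z.
  have [j hj] := shift01 z.2; have [Ej _] := invZ 0 j z.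
  have := oU (z.1 + 0%:~R, z.2 + j%:~R) (0, 0); have := oU (0, 0) (z.1 + 0%:~R, z.2 + j%:~R).
  rewrite Ej /= subr0 sub0r normrN (ger0_norm (x := z.2 + _)); last by lra.
  have : K * (z.2 + j%:~R) <= K by apply: ler_piMr; [exact: ltW|lra].
  have := Uu z; have := ler_norm (U (0, 0)); have := ler_norm (- U (0, 0)).
  by rewrite normrN ler_norml; lra.
by move=> k j t x; have [_] := invZ k j (t, x).
Qed.

Lemma cellP (p lam : R) : cell_values Ha p lam -> exists V W (M : R),
  [/\ usc V /\ usc W, Z2_periodic V /\ Z2_periodic W,
      forall z, `|V z| <= M /\ `|W z| <= M,
      vsub setT 0 (fun t x q => Ha t x (p + q)) lam V
    & vsub setT 0 (Gneg (fun t x q => Ha t x (p + q))) (- lam) W].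
Proof.
move=> [v [[M hM] pv [subv supv]]].
have bv : locally_bdd v by case: subv.
have bn := locally_bddN bv.
have pst u : locally_bdd u -> Z2_periodic u -> Z2_periodic (star u).
  move=> bu pu k j t x; have kk : 1 * 1 = 1 :> R by rewrite mulr1.
  have := star_aff k%:~R j%:~R (t, x) kk bu; rewrite /aff /= mul1r => <-.
  by congr star; apply/funext => z; rewrite /= mul1r pu -surjective_pairing.
exists (star v), (star (neg v)), M; split.
- by split; exact: usc_star.
- split; first exact: pst.
  by apply: pst => // k j t x; rewrite /neg pv.
- have bd u z : locally_bdd u -> (forall z, `|u z| <= M) -> `|star u z| <= M.
    move=> bu hu; rewrite ler_norml; apply/andP; split.
      by apply: le_trans (le_star z bu); have := hu z; rewrite ler_norml => /andP[].
    by apply: (star_le bu ltr01) => y _; have := hu y; rewrite ler_norml => /andP[].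
  by move=> z; split; apply: bd => // y; rewrite /neg normrN.
- exact/(subsolutionP _ _ bv).
- exact/(supersolutionP _ _ bv).
Qed.

Lemma periodic_max V : usc V -> Z2_periodic V -> exists z, forall y, V y <= V z.
Proof.
move=> uV pV.
have c0 : continuous (fun _ : R * R => 0 : R) by move=> ?; exact: cvg_cst.
have [z [_ _ hz]] := usc_rect_max uV c0 (ler01 : 0 <= 1 :> R) (ler01 : 0 <= 1 :> R).
exists z => -[t x]; have [k hk] := shift01 t; have [j hj] := shift01 x.
by have := hz _ _ hk hj; rewrite pV !subr0.
Qed.

(** A periodic semicontinuous function attains its maximum, and a constant is a test function
    there. *)
Lemma cell_test (p lam : R) : cell_values Ha p lam ->
  (exists t x, Ha t x p <= lam) /\ (exists t x, lam <= Ha t x p).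
Proof.
move=> /cellP [V [W [M [[uV uW] [pV pW] _ sV sW]]]]; split.
  have [z hz] := periodic_max uV pV; exists z.1, z.2.
  have [cc tc xc] := C1_cst (V z).
  have := sV z I _ cc (erefl _); rewrite tc xc mul0r !add0r addr0; apply.
  by exists 1.
have [z hz] := periodic_max uW pW; exists z.1, z.2.
have [cc tc xc] := C1_cst (W z).
have := sW z I _ cc (erefl _); rewrite tc xc mul0r !add0r /Gneg oppr0 addr0.
move=> h; rewrite -lerN2; apply: h; by exists 1.
Qed.

Lemma cell_slope (p lam : R) : cell_values Ha p lam -> exists V W (M : R),
  [/\ usc V /\ usc W, t_periodic V /\ t_periodic W,
      forall z, `|V z - p * z.2| <= M /\ `|W z + p * z.2| <= M,
      vsub setT 0 Ha lam V & vsub setT 0 (Gneg Ha) (- lam) W].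
Proof.
move=> /cellP [V [W [M [[uV uW] [pV pW] hM sV sW]]]].
have lin (c : R) U : usc U -> usc (fun z => c * z.2 + U z).
  move=> uU z e e0; have e2 : 0 < e / 2 by lra.
  have [r r0 hr] := uU z _ e2.
  have cl : continuous (fun z : R * R => c * z.2).
    by move=> y; apply: cvgM; [exact: cvg_cst|exact: cvg_snd].
  have [s s0 hs] := cont_box z cl e2.
  exists (Num.min r s); first exact: minr_gt0.
  move=> y By; have Br : box z r y by apply: box_sub By; rewrite ge_min lexx.
  have Bs : box z s y by apply: box_sub By; rewrite ge_min lexx orbT.
  by have := hr y Br; have := hs y Bs; rewrite ltr_norml => /andP[? ?] ?; lra.
have tp U : Z2_periodic U -> t_periodic U.
  by move=> pU t x; have := pU 1 0 t x; rewrite addr0.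
exists (fun z => p * z.2 + V z), (fun z => - p * z.2 + W z), M; split.
- by split; exact: lin.
- by split=> t x /=; rewrite tp.
- by move=> z; rewrite addrC addKr mulNr addrAC addNr add0r.
- by move=> z zT; apply: vsub_at_slope; exact: sV.
- move=> z zT; apply: vsub_at_slope; have := sW z zT.
  congr (vsub_at _ _ _ _ _); apply/funext => t; apply/funext => x; apply/funext => q.
  by rewrite /Gneg opprD opprK.
Qed.

Definition para (a d c x : R) : R := a * x + d * (x - c) ^+ 2.

Definition para' (a d c x : R) : R := a + d * (2 * (x - c)).

Lemma is_derive_para (a d c x : R) : is_derive x 1 (para a d c) (para' a d c x).
Proof.
apply: is_deriveD; first by rewrite -[X in is_derive _ _ _ X]mulr1; apply: is_deriveZ.
by apply: is_deriveZ; exact: is_derive_sqr.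
Qed.

Lemma cont_para' (a d c : R) : continuous (para' a d c).
Proof.
move=> x; apply: cvgD; first exact: cvg_cst.
exact: (cont_scale (cont_scale (@cont_shift _ c))).
Qed.

(** The corrector of slope [p], as a sub-solution, is compared with that of slope [p'], as a
    super-solution, [para] absorbing the difference of slopes. For [p = p'] this is uniqueness of
    the cell value; in general it gives continuity of [Hbar]. *)
Lemma cell_cmp (P eta : R) : 0 < eta -> exists de : R, 0 < de /\
  forall p p' la lb, `|p| <= P -> `|p - p'| <= de ->
    cell_values Ha p la -> cell_values Ha p' lb -> lb <= la + eta.
Proof.
move=> eta0; have [B hB] := bH P; have [C0 hC0] := bounded_below bH h3.
have e2 : 0 < eta / 2 by lra.
have [K hK] := comparison (`|B| + `|C0| + 1) `|B| cH h2 h3 e2.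
have [d0 [d00 hd0]] := uH K e2.
exists (d0 / 2); split; first lra.
move=> p p' la lb hp hpp' ca cb.
have [[t1 [x1 hla1]] [t2 [x2 hla2]]] := cell_test ca.
have laB : `|la| <= `|B|.
  have := hB t1 x1 p hp; have := hB t2 x2 p hp; rewrite !ler_norml.
  by have := ler_norm B; lra.
have [V [W0 [M [[uV uW0] [pV pW0] hV sV sW0]]]] := cell_slope ca.
have [V0 [W [M' [[uV0 uW] [pV0 pW] hW sV0 sW]]]] := cell_slope cb.
have M0 : 0 <= M by have [h _] := hV (0, 0); apply: le_trans h.
have M'0 : 0 <= M' by have [_ h] := hW (0, 0); apply: le_trans h.
(* The choice gives [d * j ^+ 2 = 2 * (M + M' + 1)], which outweighs the bounded parts at the ends,
   while the parabola changes the gradient by at most [2 * d * j = d0 / 2]. *)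
set j := (8 * (M + M' + 1)) / d0.
have j0 : 0 < j by apply: divr_gt0 => //; lra.
have jd : d0 * j = 8 * (M + M' + 1) by rewrite /j mulrC divfK // gt_eqF.
set d := d0 / (4 * j).
have d_gt0 : 0 < d by apply: divr_gt0 => //; lra.
have dj : d * j = d0 / 4 by rewrite /d; field; rewrite gt_eqF.
clearbody d; have jab : - j <= 0 <= j by lra.
have oscV t s x : - j <= x <= j -> V (t, x) - V (s, x) <= `|B| + `|C0| + 1.
  move=> _; apply: le_trans (time_osc uV pV ltr01 (fun z _ => sV z I) hC0 t s) _.
  by rewrite lerD2r; apply: le_trans (ler_normD _ _) _; lra.
have [|||t [s [x [q [hx _ hq]]]]] := hK V W 0 la lb (- j) j (para (p - p') d 0) (para' (p - p') d 0) 0 0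
   uV uW pV pW (lexx 0) (is_derive_para _ _ _) (@cont_para' _ _ _) (fun z _ => sV z I) (fun z _ => sW z I) jab.
- move=> t s x hx; rewrite /para !mulr0 !subr0 expr0n /= mulr0 addr0.
  have [h1 _] := hV (t, x); have [_ k1] := hW (s, x).
  have [k2 _] := hV (0, 0); have [_ k3] := hW (0, 0).
  move: h1 k1 k2 k3; rewrite /= !mulr0 subr0 addr0 !ler_norml subr0.
  have -> : d * x ^+ 2 = 2 * (M + M' + 1).
    have -> : x ^+ 2 = j * j by case: hx => ->; ring.
    rewrite mulrA dj; lra.
  lra.
- by apply: le_trans (ler_norm _) laB.
- exact: oscV.
rewrite mul0r add0r => hle.
suff : `|Ha s x (q + para' (p - p') d 0 x) - Ha s x q| <= eta / 2.
  by rewrite ler_norml; lra.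
apply: hd0 => //; rewrite addrC addKr /para' subr0.
apply: le_trans (ler_normD _ _) _.
suff : `|d * (2 * x)| <= d0 / 2 by lra.
rewrite normrM normrM (gtr0_norm d_gt0) ger0_norm //.
have xj : `|x| <= j by rewrite ler_norml; lra.
have : d * `|x| <= d * j by apply: ler_wpM2l => //; exact: ltW.
by rewrite dj; lra.
Qed.

Lemma HbarP (p : R) : cell_values Ha p (Hbar Ha p).
Proof. by have [lam h] := cell_values_ex p; exact: (xgetPex 0 (ex_intro _ lam h)). Qed.

Lemma Hbar_cont : continuous (Hbar Ha).
Proof.
move=> p; apply/cvgrPdist_le => e e0.
have [d [d0 hd]] := cell_cmp (`|p| + 1) e0.
have m0 : 0 < Num.min d 1 by rewrite lt_min d0 ltr01.
apply/nbhs_ballP; exists (Num.min d 1) => //= p'; rewrite /= lt_min => /andP[h1 h2'].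
have hp' : `|p'| <= `|p| + 1.
  by rewrite -[p'](subKr p); apply: le_trans (ler_normB _ _) _; lra.
have k1 := hd p p' _ _ (_ : `|p| <= `|p| + 1) (ltW h1) (HbarP p) (HbarP p').
have h1' : `|p' - p| <= d by rewrite distrC ltW.
have k2 := hd p' p _ _ hp' h1' (HbarP p') (HbarP p).
have {}k1 : Hbar Ha p' <= Hbar Ha p + e by apply: k1; lra.
by rewrite ler_norml; lra.
Qed.

Lemma Hbar_coercive (M : R) : exists K : R, forall p, K <= `|p| -> M <= Hbar Ha p.
Proof.
have [K hK] := h3 M; exists K => p hp.
by have [[t [x h]] _] := cell_test (HbarP p); apply: le_trans h; exact: hK.
Qed.

(** On a long window where [U] has nearly the mean slope [q] on both halves, subtracting the
    corrector of slope [q] and a parabola leaves a function whose value at the centre beats those at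
    the ends. Comparison applies inside, and the gradient error of the parabola is small. *)
Lemma window_level U (la lam q X K C : R) : usc U -> t_periodic U ->
  (forall z, X < z.2 -> vsub_at 0 Ha la U z) ->
  (forall t s x y, U (t, x) - U (s, y) <= K * `|x - y| + C) ->
  cell_values Ha q lam ->
  (forall eta J : R, 0 < eta -> exists j x1, [/\ J <= j, X < x1,
     `|U (0, x1 + j) - U (0, x1) - q * j| <= eta * j + 1
   & `|U (0, x1 + 2 * j) - U (0, x1) - 2 * q * j| <= 2 * eta * j + 1]) ->
  lam <= la.
Proof.
move=> uU pU sU oU cq hwin; rewrite leNgt; apply/negP => lt.
set e := (lam - la) / 2; have e0 : 0 < e by rewrite /e; lra.
have C0 : 0 <= C by have := oU 0 0 0 0; rewrite !subrr normr0 mulr0 add0r.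
have [Kc hK] := comparison C la cH h2 h3 e0.
have e2 : 0 < e / 2 by lra.
have [de [de0 hde]] := uH Kc e2.
have [V0 [W [M [[uV0 uW] [pV0 pW] hW sV0 sW]]]] := cell_slope cq.
have M0 : 0 <= M by have [_ h] := hW (0, 0); apply: le_trans h.
(* The parabola satisfies [d * j = 8 * eta]: it gains [8 * eta * j] at the ends, more than slope
   errors and bounded terms together, and changes the gradient by at most [16 * eta = de]. *)
set eta := de / 16; have eta0 : 0 < eta by rewrite /eta; lra.
set J := (C + 2 * M + 3) / eta.
have J0 : 0 < J by apply: divr_gt0 => //; lra.
have [j [x1 [Jj Xx1 w1 w2]]] := hwin eta J eta0.
have j0 : 0 < j by exact: lt_le_trans Jj.
have jeta : C + 2 * M + 3 <= eta * j.
  by rewrite [eta * j]mulrC -ler_pdivrMr.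
set d := 8 * eta / j.
have d0 : 0 < d by apply: divr_gt0 => //; lra.
have dj : d * j = 8 * eta by rewrite /d divfK // gt_eqF.
have djj : d * (j * j) = 8 * (eta * j) by rewrite [LHS]mulrA dj -mulrA.
clearbody d.
have cab : x1 <= x1 + j <= x1 + 2 * j by lra.
have [||||t [s [x [p [hx _ hp]]]]] := hK U W 0 la lam x1 (x1 + 2 * j) (para 0 d (x1 + j)) (para' 0 d (x1 + j)) 0 (x1 + j)
   uU uW pU pW (lexx 0) (is_derive_para _ _ _) (@cont_para' _ _ _) _ (fun z _ => sW z I) cab.
- by move=> z hz; apply: sU; lra.
- move=> t s x hx; rewrite /para !mul0r !add0r subrr expr0n /= mulr0 subr0.
  have [_ k1] := hW (s, x); have [_ k2] := hW (0, x1 + j); move: k1 k2 => /=.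
  have -> : d * (x - (x1 + j)) ^+ 2 = 8 * (eta * j).
    by rewrite -djj; case: hx => ->; ring.
  have := oU t 0 x x; rewrite subrr normr0 mulr0 add0r.
  move: w1 w2; rewrite !ler_norml; case: hx => -> *; nra.
- by [].
- by move=> t s x _; have := oU t s x x; rewrite subrr normr0 mulr0 add0r.
rewrite mul0r add0r => hle.
suff : `|Ha s x (p + para' 0 d (x1 + j) x) - Ha s x p| <= e / 2.
  have : 2 * e = lam - la by rewrite /e; field.
  by rewrite ler_norml; lra.
apply: hde => //; rewrite addrC addKr /para' add0r normrM (gtr0_norm d0) normrM ger0_norm //.
have xj : `|x - (x1 + j)| <= j by rewrite ler_norml; lra.
have : d * `|x - (x1 + j)| <= d * j by apply: ler_wpM2l => //; exact: ltW.
by rewrite dj /eta; lra.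
Qed.

End Periodic.
End Cell.

(** * Mean slopes at infinity and level sets of coercive functions *)

Section Growth.
Context {R : realType}.
Implicit Types (g f : R -> R).

(** Fekete-type argument: [q] is the largest mean slope of [g] over long
    intervals, and intervals where it is almost attained have almost that mean
    slope on both halves. *)
Lemma growth_slope g (X K C : R) : 0 <= K -> 0 <= C ->
  (forall x y, g x - g y <= K * `|x - y| + C) ->
  exists q : R, (forall e : R, 0 < e -> exists X' C' : R, forall x, X' <= x -> g x <= (q + e) * x + C') /\
   (forall eta J : R, 0 < eta -> exists j x1, [/\ J <= j, X < x1,
     `|g (x1 + j) - g x1 - q * j| <= eta * j + 1
   & `|g (x1 + 2 * j) - g x1 - 2 * q * j| <= 2 * eta * j + 1]).
Proof.
move=> K0 C0 osc.
pose S (k : nat) := [set g (x + k%:R) - g x | x in [set x | X < x]].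
have gb (k : nat) x : `|g (x + k%:R) - g x| <= K * k%:R + C.
  have := osc (x + k%:R) x; have := osc x (x + k%:R).
  have -> : x + k%:R - x = k%:R by ring.
  have -> : x - (x + k%:R) = - k%:R by ring.
  by rewrite normrN normr_nat ler_norml; lra.
have hs k : has_sup (S k).
  split; first by exists (g (X + 1 + k%:R) - g (X + 1)), (X + 1) => //=; lra.
  by exists (K * k%:R + C) => _ [x _ <-]; exact: le_trans (ler_norm _) (gb k x).
pose F k := sup (S k).
have leF k x : X < x -> g (x + k%:R) - g x <= F k.
  by move=> Xx; apply: sup_upper_bound => //; exists x.
have Fb k : - (K * k%:R + C) <= F k.
  have h : X < X + 1 by lra.
  have := leF k _ h; have := gb k (X + 1); rewrite ler_norml; lra.
have subadd a b : F (a + b)%N <= F a + F b.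
  apply: ge_sup; first by case: (hs (a + b)%N).
  move=> _ [x Xx <-]; have h : X < x + a%:R by apply: lt_le_trans Xx _; rewrite lerDl.
  by have := leF a x Xx; have := leF b _ h; rewrite natrD addrA; lra.
have subm i k : F (i.+1 * k)%N <= i.+1%:R * F k.
  elim: i => [|i IH]; first by rewrite mul1n mul1r.
  rewrite mulSn -[i.+2%:R]natr1 mulrDl mul1r addrC.
  by apply: le_trans (subadd _ _) _; rewrite lerD2l.
pose Q := [set F k.+1 / k.+1%:R | k in [set: nat]].
have hi : has_inf Q.
  split; first by exists (F 1%N / 1%:R), 0%N.
  exists (- (K + C)) => _ [k _ <-]; rewrite ler_pdivlMr //.
  apply: le_trans (Fb k.+1); rewrite mulNr lerN2 mulrDl lerD2l ler_peMr //.
  by rewrite ler1n.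
set q := inf Q.
have Fq k : (0 < k)%N -> q * k%:R <= F k.
  case: k => // k _; rewrite -ler_pdivlMr //; apply: ge_inf; first by case: hi.
  by exists k.
have adh (e : R) : 0 < e -> exists k, (0 < k)%N /\ F k <= (q + e) * k%:R.
  move=> e0; have [_ [k _ <-] h] := inf_adherent e0 hi; exists k.+1; split => //.
  by rewrite -ler_pdivrMr // ltW.
exists q; split.
  move=> e e0; have [k [k0 hk]] := adh e e0.
  have kR : 0 < k%:R :> R by rewrite ltr0n.
  set x0 := X + 1; have Xx0 : X < x0 by rewrite /x0; lra.
  exists (x0 + k%:R), (g x0 + K * k%:R + C + `|q + e| * (`|x0| + k%:R)) => x hx.
  (* From [x0], [i] steps of length [k] arrive within [k] of [x]; the remainder is paid for with
     [osc]. *)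
  set i := Num.truncn ((x - x0) / k%:R).
  have q0 : 0 <= (x - x0) / k%:R by rewrite divr_ge0 //; lra.
  have i1 : i%:R * k%:R <= x - x0 by rewrite -ler_pdivlMr //; have := truncn_itv q0; case/andP.
  have i2 : x - x0 < i.+1%:R * k%:R by rewrite -ltr_pdivrMr //; exact: truncnS_gt.
  have ipos : (0 < i)%N.
    rewrite lt0n; apply/eqP => E; move: i2; rewrite E mul1r; lra.
  have h1 := leF (i * k)%N x0 Xx0; have h2 : F (i * k)%N <= i%:R * F k.
    by have := subm i.-1 k; rewrite prednK.
  have h3 : i%:R * F k <= i%:R * ((q + e) * k%:R) by apply: ler_wpM2l.
  have h4 := osc x (x0 + (i * k)%:R); rewrite natrM in h1 h4.
  have h5 : `|x - (x0 + i%:R * k%:R)| <= k%:R.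
    by rewrite ger0_norm; [move: i2; rewrite -natr1; lra|lra].
  have h6 : K * `|x - (x0 + i%:R * k%:R)| <= K * k%:R by apply: ler_wpM2l.
  have h7 : (q + e) * (i%:R * k%:R) <= (q + e) * x + `|q + e| * (`|x0| + k%:R).
    have -> : (q + e) * (i%:R * k%:R) = (q + e) * x + (q + e) * (i%:R * k%:R - x) by ring.
    rewrite lerD2l; apply: le_trans (ler_norm _) _; rewrite normrM ler_wpM2l //.
    rewrite (_ : i%:R * k%:R - x = - x0 - (x - (x0 + i%:R * k%:R))); last by ring.
    by apply: le_trans (ler_normB _ _) _; rewrite normrN lerD2l.
  have h8 : i%:R * ((q + e) * k%:R) = (q + e) * (i%:R * k%:R) by ring.
  lra.
move=> eta J eta0; have [k [k0 hk]] := adh eta eta0.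
have kR : 1 <= k%:R :> R by rewrite ler1n.
pose i := Num.truncn `|J|; pose m := (i.+1 * k)%N.
have mJ : J <= m%:R.
  have := truncnS_gt `|J|; rewrite -/i => h.
  apply: le_trans (ler_norm _) _; apply: le_trans (ltW h) _.
  by rewrite /m natrM ler_peMr.
have m0 : (0 < m)%N by rewrite /m muln_gt0.
have Fm : F m <= (q + eta) * m%:R.
  apply: le_trans (subm i k) _; rewrite /m natrM mulrCA.
  by apply: ler_wpM2l => //; rewrite mulrC.
have F2m : F (m + m)%N <= 2 * ((q + eta) * m%:R) by have := subadd m m; lra.
have q2m := Fq (m + m)%N (ltn_addr m m0).
(* The increment over [2 * m] from [x1] is at least [2 * q * m - 1]. Each half is at most
   [(q + eta) * m], so neither falls below [(q - eta) * m - 1]. *)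
have [_ [x1 Xx1 <-] hx1] := sup_adherent ltr01 (hs (m + m)%N).
have h1 := leF m x1 Xx1.
have Xx2 : X < x1 + m%:R by apply: lt_le_trans Xx1 _; rewrite lerDl.
have h2 := leF m _ Xx2; have h3 := leF (m + m)%N x1 Xx1.
rewrite -/(F (m + m)%N) in hx1.
move: q2m hx1 h3; rewrite natrD => q2m hx1 h3.
have E2 : x1 + m%:R + m%:R = x1 + (m%:R + m%:R) by rewrite addrA.
rewrite E2 in h2.
exists m%:R, x1; rewrite (_ : 2 * m%:R = m%:R + m%:R); last by ring.
by split => //; rewrite ler_norml; lra.
Qed.

Lemma cont_at_lt f (x A : R) : continuous f -> f x < A ->
  exists r : R, 0 < r /\ forall y, `|y - x| < r -> f y < A.
Proof.
move=> cf fx; have e0 : 0 < A - f x by lra.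
have /cvgrPdist_lt /(_ _ e0) /nbhs_ballP [r /= r0 hr] := cf x.
exists r; split => // y hy; have : `|f x - f y| < A - f x.
  by apply: hr; rewrite -ball_normE /= distrC.
by rewrite ltr_norml; lra.
Qed.

Lemma cont_at_gt f (x A : R) : continuous f -> A < f x ->
  exists r : R, 0 < r /\ forall y, `|y - x| < r -> A < f y.
Proof.
move=> cf fx.
have cN : continuous (fun x => - f x) by move=> y; apply: cvgN; exact: cf.
have [|r [r0 hr]] := @cont_at_lt (fun x => - f x) x (- A) cN; first by rewrite ltrN2.
by exists r; split => // y /hr; rewrite ltrN2.
Qed.

Definition coercive f := forall M : R, exists K : R, forall p, K <= `|p| -> M <= f p.

Lemma sublevel_max f (p0 A : R) : continuous f -> coercive f -> f p0 <= A ->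
  exists m, [/\ f m = A, p0 <= m & forall q, f q <= A -> q <= m].
Proof.
move=> cf cof h0; have [K hK] := cof (A + 1).
pose S := [set q | f q <= A].
have bS : ubound S K.
  move=> q Sq; rewrite leNgt; apply/negP => hq.
  have := hK q (le_trans (ltW hq) (ler_norm q)); move: Sq; rewrite /S /=; lra.
have hs : has_sup S by split; [exists p0|exists K].
exists (sup S).
have ub q : f q <= A -> q <= sup S by move=> h; exact: sup_upper_bound.
split => //; last exact: ub.
apply/eqP; rewrite eq_le; apply/andP; split; rewrite leNgt; apply/negP => h.
  have [r [r0 hr]] := cont_at_gt cf h.
  have [q Sq hq] := sup_adherent r0 hs; have := ub q Sq => qs.
  by have := hr q; rewrite ltr_norml => hlt; move: Sq; rewrite /S /= leNgt hlt //; lra.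
have [r [r0 hr]] := cont_at_lt cf h.
have h1 : `|sup S + r / 2 - sup S| < r by rewrite addrC addKr ger0_norm; lra.
by have := ub _ (ltW (hr _ h1)); lra.
Qed.

(** On the compact interval [b + e, K] the minimum of [f] exceeds [A], and coercivity handles the
    rest. Slopes known only at level [A + eta] can thus be bounded by the end of the level set of
    [A]. *)
Lemma sublevel_upper f (b A e : R) : continuous f -> coercive f ->
  (forall q, f q <= A -> q <= b) -> 0 < e ->
  exists eta : R, 0 < eta /\ forall q, f q <= A + eta -> q <= b + e.
Proof.
move=> cf cof hb e0; have [K hK] := cof (A + 2).
have [Kb|Kb] := leP K (b + e).
  exists 1; split => // q hq; rewrite leNgt; apply/negP => h.
  have := hK q (le_trans (le_trans Kb (ltW h)) (ler_norm q)); lra.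
have [c cin hc] := @EVT_min R f (b + e) K (ltW Kb) (continuous_subspaceT cf).
have fc : A < f c.
  rewrite ltNge; apply/negP => /hb; move: cin; rewrite in_itv /=; lra.
exists (Num.min ((f c - A) / 2) 1); split; first by rewrite lt_min ltr01 andbT; lra.
move=> q hq; rewrite leNgt; apply/negP => h.
have [hqK|hqK] := leP K q.
  have := hK q (le_trans hqK (ler_norm q)).
  have : Num.min ((f c - A) / 2) 1 <= 1 by rewrite ge_min lexx orbT.
  lra.
have := hc q; rewrite in_itv /= (ltW h) (ltW hqK) => /(_ isT).
have : Num.min ((f c - A) / 2) 1 <= (f c - A) / 2 by rewrite ge_min lexx.
lra.
Qed.

Lemma continuous_opp_arg f : continuous f -> continuous (fun p => f (- p)).
Proof. by move=> cf x; apply: (@continuous_comp _ _ _ -%R f); [exact: opp_continuous|exact: cf]. Qed.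

Lemma coercive_opp_arg f : coercive f -> coercive (fun p => f (- p)).
Proof. by move=> cof M; have [K hK] := cof M; exists K => p hp; apply: hK; rewrite normrN. Qed.

(** There are two regimes for the smaller end. If [A] is the minimum of [f], the level set is the
    whole argmin, on both sides of [p0], and [pmin] bounds the sublevel set below. If [A] is larger,
    [pmin] is the first crossing of [A] to the right of [p0], and [f < A] on the slopes from [p0] up
    to it: these are the slopes usable for corrector barriers. *)
Lemma level_ends f (p0 A : R) : continuous f -> coercive f -> argmin f p0 -> f p0 <= A ->
  exists pmin pmax, [/\ is_min (levelR f p0 A) pmin, is_max (levelR f p0 A) pmax,
    forall q, f q <= A -> q <= pmax
   & (forall q, f q <= A -> pmin <= q) \/
     (p0 < pmin /\ forall q, p0 <= q -> q < pmin -> f q < A)].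
Proof.
move=> cf cof hmin h0.
have [pmax [fmax p0max ubmax]] := sublevel_max cf cof h0.
have lev q : levelR f p0 A q -> f q = A by case.
have maxin : levelR f p0 A pmax.
  split => //; rewrite /nondecr_part; case: ifP => // h.
  by have -> : p0 = pmax by apply/eqP; rewrite eq_le p0max h.
have hmaxi : is_max (levelR f p0 A) pmax by split => // q /lev h; apply: ubmax; rewrite h.
move: h0; rewrite le_eqVlt => /predU1P[E|lt].
  have hE : f (- - p0) <= A by rewrite opprK E.
  have [m [fm mp0 ubm]] := sublevel_max (p0 := - p0) (A := A) (continuous_opp_arg cf) (coercive_opp_arg cof)
    hE.
  have lbm q : f q <= A -> - m <= q by move=> h; rewrite lerNl; apply: ubm; rewrite opprK.
  exists (- m), pmax; split => //; last by left.
  split; last by move=> q /lev h; apply: lbm; rewrite h.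
  split => //; rewrite /nondecr_part fm; case: ifP => // _; exact: E.
pose T := [set q | p0 <= q /\ A <= f q].
have hi : has_inf T.
  split; last by exists p0 => q [].
  by exists pmax; split => //; rewrite fmax.
set m := inf T.
have lbT q : T q -> m <= q by move=> h; apply: ge_inf => //; case: hi.
have p0m : p0 <= m by apply: lb_le_inf; [case: hi|move=> q []].
have below q : p0 <= q -> q < m -> f q < A.
  by move=> h1 h2; rewrite ltNge; apply/negP => h3; have := lbT q (conj h1 h3); lra.
have fm : f m = A.
  apply/eqP; rewrite eq_le; apply/andP; split; rewrite leNgt; apply/negP => h.
    have [r [r0 hr]] := cont_at_gt cf h.
    have pm : p0 < m.
      rewrite lt_neqAle p0m andbT; apply/eqP => E; move: h; rewrite -E; lra.
    pose y := Num.max p0 (m - r / 2).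
    have y1 : p0 <= y by rewrite le_max lexx.
    have y2 : m - r / 2 <= y by rewrite le_max lexx orbT.
    have y3 : y < m by rewrite gt_max pm; lra.
    have := below y y1 y3; have := hr y; rewrite ltr_norml => h5.
    have : A < f y by apply: h5; lra.
    lra.
  have [r [r0 hr]] := cont_at_lt cf h.
  have [q Tq hq] := inf_adherent r0 hi; have := lbT q Tq => mq.
  have := hr q; rewrite ltr_norml -/m in hq * => h5.
  have : f q < A by apply: h5; lra.
  by case: Tq => _; lra.
have pm : p0 < m by rewrite lt_neqAle p0m andbT; apply/eqP => E; move: fm; rewrite -E; lra.
exists m, pmax; split => //; last by right.
split; first by split => //; rewrite /nondecr_part leNgt pm.
move=> q [h1 h2]; apply: lbT; split; last by rewrite h2.
rewrite leNgt; apply/negP => h3; move: h1; rewrite /nondecr_part (ltW h3) h2; lra.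
Qed.

End Growth.

(** * The limit Hamiltonians and the growth of sub-solutions *)

Section Tail.
Context {R : realType}.
Implicit Types (H HR : R -> R -> R -> R) (U W : R * R -> R).

Definition tail H HR := forall e : R, 0 < e -> exists X : R,
  forall t x p, X <= x -> `|H t x p - HR t x p| < e.

(** The Hamiltonian of the equation satisfied by [u (t, - x)]; it reduces the behaviour at minus
    infinity to that at plus infinity. *)
Definition refl H : R -> R -> R -> R := fun t x p => H t (- x) (- p).

Lemma floor_frac (x : R) : 0 <= x - (Num.floor x)%:~R <= 1.
Proof. by have := floor_le x; have := floorD1_gt x; rewrite intrD; lra. Qed.

Lemma tail_right H HL HR : assA1 H -> assA5 H HL HR -> tail H HR.
Proof.
move=> h1 [_ hR _ pR] e e0; have [N hN] := hR e e0; exists N%:~R => t x p hx.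
have [k hk] := shift01 t; have := floor_frac x; set j := Num.floor x => hj.
have Nj : (N <= j)%R by rewrite -ltzD1 -(ltr_int R); apply: le_lt_trans hx (floorD1_gt _).
have := hN j Nj (t + k%:~R) (x - j%:~R) p hk hj.
rewrite subrK h1 -(pR k (- j) t x p).
by rewrite mulrNz.
Qed.

Lemma tail_left H HL HR : assA1 H -> assA5 H HL HR -> tail (refl H) (refl HL).
Proof.
move=> h1 [hL _ pL _] e e0; have [N hN] := hL e e0; exists (- N%:~R) => t x p hx.
have [k hk] := shift01 t; have := floor_frac (- x); set j := Num.floor (- x) => hj.
have Nj : (j <= N)%R.
  rewrite -(ler_int R); apply: le_trans (floor_le _) _; lra.
have := hN j Nj (t + k%:~R) (- x - j%:~R) (- p) hk hj.
rewrite subrK h1 /refl -(pL k (- j) t (- x) (- p)).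
by rewrite mulrNz.
Qed.

Lemma periodic3_refl H : periodic3 H -> periodic3 (refl H).
Proof.
move=> h k j t x p; rewrite /refl opprD -(h k (- j) t (- x)).
by rewrite mulrNz.
Qed.

Lemma cont3_comp H (f g h : R * R * R -> R) z : assA0 H ->
  {for z, continuous f} -> {for z, continuous g} -> {for z, continuous h} ->
  {for z, continuous (fun z => H (f z) (g z) (h z))}.
Proof. by move=> cH cf cg ch; exact: (cvg_cont3 _ cH cf cg ch). Qed.

Lemma cont_11 (z : R * R * R) : {for z, continuous (fun z : R * R * R => z.1.1)}.
Proof. by apply: (@continuous_comp _ _ _ fst fst); exact: cvg_fst. Qed.

Lemma cont_12 (z : R * R * R) : {for z, continuous (fun z : R * R * R => z.1.2)}.
Proof. by apply: (@continuous_comp _ _ _ fst snd); [exact: cvg_fst|exact: cvg_snd]. Qed.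

Lemma assA0_refl H : assA0 H -> assA0 (refl H).
Proof.
move=> cH z; apply: (cont3_comp cH); first exact: cont_11.
- by apply: cvgN; exact: cont_12.
- by apply: cvgN; exact: cvg_snd.
Qed.

Lemma assA2_refl H : assA2 H -> assA2 (refl H).
Proof. by move=> [om [h1 h2]]; exists om; split => // t s x p; exact: h2. Qed.

Lemma assA3_refl H : assA3 H -> assA3 (refl H).
Proof. by move=> h M; have [K hK] := h M; exists K => t x q hq; apply: hK; rewrite normrN. Qed.

Section Limit.
Variables (H HR : R -> R -> R -> R).
Hypotheses (tH : tail H HR) (pR : periodic3 HR).

(** Integer translates of [H] approximate [HR] uniformly on a half-line, which is how the structural
    assumptions pass to [HR]. *)
Lemma tail_shift (e x0 : R) : 0 < e -> exists k : int, forall t x p, x0 <= x ->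
  `|H t (x + k%:~R) p - HR t x p| < e.
Proof.
move=> e0; have [X hX] := tH e0; exists (Num.ceil (X - x0)) => t x p hx.
rewrite -[HR t x p](pR 0 (Num.ceil (X - x0))) addr0; apply: hX.
by have := ceil_ge (X - x0); lra.
Qed.

Lemma tail_A0 : assA0 H -> assA0 HR.
Proof.
move=> cH z; apply/cvgrPdist_lt => e e0; have e3 : 0 < e / 3 by lra.
have [k hk] := tail_shift (z.1.2 - 1) e3.
have cs : {for z, continuous (fun z : R * R * R => H z.1.1 (z.1.2 + k%:~R) z.2)}.
  apply: (cont3_comp cH); first exact: cont_11.
    by apply: cvgD; [exact: cont_12|exact: cvg_cst].
  exact: cvg_snd.
have n1 : \forall y \near z, `|H z.1.1 (z.1.2 + k%:~R) z.2 - H y.1.1 (y.1.2 + k%:~R) y.2| < e / 3.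
  by move/cvgrPdist_lt : cs; exact.
have n2 : \forall y \near z, `|z.1.2 - y.1.2| < 1.
  by move/cvgrPdist_lt : (@cont_12 z); apply; exact: ltr01.
apply: filterS (filterI n1 n2) => y [h1].
rewrite ltr_norml => h2.
have z1 : z.1.2 - 1 <= z.1.2 by lra.
have z2 : z.1.2 - 1 <= y.1.2 by lra.
have := hk z.1.1 _ z.2 z1; have := hk y.1.1 _ y.2 z2; move: h1.
by rewrite !ltr_norml; lra.
Qed.

Lemma tail_A3 : assA3 H -> assA3 HR.
Proof.
move=> h M; have [K hK] := h (M + 1); exists K => t x q hq.
have [k hk] := tail_shift x ltr01.
by have := hk t x q (lexx _); have := hK t (x + k%:~R) q hq; rewrite ltr_norml; lra.
Qed.

(** An error of at most 1 on [HR] inside the modulus at most doubles [1 + Num.max (HR s x p) 0],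
    whence the new modulus [om (2 * r)]. *)
Lemma tail_A2 : assA2 H -> assA2 HR.
Proof.
move=> [om [[om0 omH om_cvg] hom]]; exists (fun r => om (2 * r)); split; first split.
- by rewrite mulr0.
- move=> r s; rewrite !in_itv /= !andbT => r0 s0 rs; apply: omH; rewrite ?in_itv /= ?andbT; lra.
- apply/cvgrPdist_le => e e0.
  have [r1 [q1 q2]] : exists r1, 0 < r1 /\ `|0 - om r1| < e.
    have a1 : \forall r \near (0 : R)^'+, `|0 - om r| < e by move/cvgrPdist_lt : om_cvg; exact.
    have a2 : \forall r \near (0 : R)^'+, 0 < r by exact: nbhs_right_gt.
    by have [r [? ?]] := filter_ex (filterI a2 a1); exists r.
  have a1 : \forall r \near (0 : R)^'+, 0 < r by exact: nbhs_right_gt.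
  have r12 : 0 < r1 / 2 by lra.
  have a2 : \forall r \near (0 : R)^'+, r <= r1 / 2 by exact: nbhs_right_le.
  apply: filterS (filterI a1 a2) => r [h1 h2].
  have m1 : om 0 <= om (2 * r) by apply: omH; rewrite ?in_itv /= ?andbT; lra.
  have m2 : om (2 * r) <= om r1 by apply: omH; rewrite ?in_itv /= ?andbT; lra.
  move: q2; rewrite !sub0r !normrN om0 in m1 *; rewrite !ger0_norm; lra.
- move=> t s x p; apply/ler_addgt0Pr => e e0.
  set d := Num.min (e / 2) 1; have d0 : 0 < d by apply: minr_gt0; lra.
  have [d1 d2] : d <= e / 2 /\ d <= 1 by rewrite !ge_min !lexx orbT.
  have [k hk] := tail_shift x d0.
  have := hk t x p (lexx _); have := hk s x p (lexx _); rewrite !ltr_norml => k1 k2.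
  have := hom t s (x + k%:~R) p.
  set r1 := `|t - s| * _; set r2 := `|t - s| * _ => h.
  have m0 : 0 <= Num.max (HR s x p) 0 by rewrite le_max lexx orbT.
  have m1 : HR s x p <= Num.max (HR s x p) 0 by rewrite le_max lexx.
  have r12 : r1 <= 2 * r2.
    rewrite /r1 /r2 mulrCA; apply: ler_wpM2l => //.
    have : Num.max (H s (x + k%:~R) p) 0 <= Num.max (HR s x p) 0 + 1.
      by rewrite ge_max; apply/andP; split; lra.
    lra.
  have r10 : 0 <= r1 by rewrite /r1 mulr_ge0 // addr_ge0 // le_max lexx orbT.
  have : om r1 <= om (2 * r2) by apply: omH; rewrite ?in_itv /= ?andbT; lra.
  lra.
Qed.

(** Far to the right, [U] is a sub-solution for [HR] at level [A + eta]. [growth_slope] gives the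
    largest mean slope when applied to [U], the opposite of the smallest one when applied to [- U],
    and [window_level] places both in a sublevel of [Hbar HR]. *)
Lemma sub_growth_right A U (K C eta : R) : assA0 H -> assA2 H -> assA3 H ->
  usc U -> t_periodic U -> vsub setT 0 H A U -> 0 <= K -> 0 < eta ->
  (forall t s x y, U (t, x) - U (s, y) <= K * `|x - y| + C) ->
  (exists q, Hbar HR q <= A + eta /\ forall e : R, 0 < e ->
     exists X C', forall x, X <= x -> U (0, x) <= (q + e) * x + C') /\
  (exists q, Hbar HR q <= A + eta /\ forall e : R, 0 < e ->
     exists X C', forall x, X <= x -> (q - e) * x - C' <= U (0, x)).
Proof.
move=> cH h2 h3 uU pU sU K0 eta0 osc.
have C0 : 0 <= C by have := osc 0 0 0 0; rewrite !subrr normr0 mulr0 add0r.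
have [X hX] := tH eta0.
have sR z : X < z.2 -> vsub_at 0 HR (A + eta) U z.
  move=> hz phi cp E tch; have := sU z I phi cp E tch.
  by have := hX z.1 z.2 (dx phi z) (ltW hz); rewrite ltr_norml; lra.
have cR := tail_A0 cH; have R2 := tail_A2 h2; have R3 := tail_A3 h3.
have win := window_level cR pR R2 R3 uU pU sR osc.
split.
  have [q [gq wq]] := @growth_slope _ (fun x => U (0, x)) X K C K0 C0 (fun x y => osc 0 0 x y).
  exists q; split; [exact: win (HbarP cR pR R3 q) wq|exact: gq].
have [|q [gq wq]] := @growth_slope _ (fun x => - U (0, x)) X K C K0 C0.
  by move=> x y; rewrite opprK addrC distrC; exact: osc.
exists (- q); split.
  apply: win (HbarP cR pR R3 (- q)) _ => e J e0.
  have [j [x1 [j1 j2 j3 j4]]] := wq e J e0; exists j, x1; split => //.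
    by move: j3; rewrite !ler_norml; lra.
  by move: j4; rewrite !ler_norml; lra.
move=> e e0; have [X' [C' h]] := gq e e0; exists X', C' => x hx.
by have := h x hx; lra.
Qed.

End Limit.
End Tail.

(** * Discounted solutions as barriers *)

Section Barriers.
Context {R : realType}.
Implicit Types (u v w U V W : nat -> R * R -> R) (z : R * R).
Implicit Types (G H HL HR : R -> R -> R -> R).

Lemma tails_slope_bounded H HL HR : assA0 H -> assA1 H -> assA3 H -> assA5 H HL HR ->
  slope_bounded H.
Proof.
move=> cH h1 h3 h5; have [_ _ pL pR] := h5.
have tR := tail_right h1 h5; have tL := tail_left h1 h5.
have bR : slope_bounded HR by apply: periodic_slope_bounded => //; exact: (tail_A0 tR pR cH).
have bL : slope_bounded (refl HL).
  apply: periodic_slope_bounded; last exact: periodic3_refl.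
  by apply: (tail_A0 tL) => //; [exact: periodic3_refl|exact: assA0_refl].
move=> M; have [B1 hB1] := bR M; have [B2 hB2] := bL M.
have [X1 hX1] := tR 1 ltr01; have [X2 hX2] := tL 1 ltr01.
pose X := `|X1| + `|X2|.
have XX : - X <= X by rewrite /X; have := normr_ge0 X1; have := normr_ge0 X2; lra.
have [B hB] := cont_bounded_cube M cH XX.
exists (`|B| + `|B1| + `|B2| + 1) => t x p hp.
have n1 := ler_norm B; have n2 := ler_norm B1; have n3 := ler_norm B2.
have m1 := normr_ge0 B; have m2 := normr_ge0 B1; have m3 := normr_ge0 B2.
have x1 := ler_norm X1; have x2 := ler_norm X2.
have y1 := normr_ge0 X1; have y2 := normr_ge0 X2.
have [a|a] := leP X1 x.
  have := hX1 t x p a; have := hB1 t x p hp.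
  by rewrite !ler_norml ltr_norml; lra.
have [b|b] := leP X2 (- x).
  have hp' : `|- p| <= M by rewrite normrN.
  have := hX2 t (- x) (- p) b; have := hB2 t (- x) (- p) hp'.
  by rewrite /refl !opprK !ler_norml ltr_norml; lra.
have [k hk] := shift01 t; rewrite -(h1 k).
have hx : - X <= x <= X by rewrite /X; lra.
by have := hB (t + k%:~R) x p hk hx hp; lra.
Qed.

Definition rho (n : nat) : R := n.+2%:R.

(** The scaling meets two opposite needs: the values outside the strip are at least [rho n ^+ 2],
    beyond affine growth, while inside, where [w n] grows at most affinely, the discount term is of
    order [1 / rho n]. *)
Definition dis (n : nat) : R := (rho n ^+ 2)^-1.

Lemma rho_gt1 n : 1 < rho n. Proof. by rewrite /rho ltr1n. Qed.

Lemma rho_gt0 n : 0 < rho n. Proof. by rewrite /rho ltr0n. Qed.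

Lemma dis_gt0 n : 0 < dis n. Proof. by rewrite invr_gt0 exprn_gt0 // rho_gt0. Qed.

Lemma rho_ge (c : R) : \forall n \near \oo, c <= rho n.
Proof.
have [N _ hN] := nbhs_infty_ger c; exists N => // n hn.
by apply: le_trans (hN n hn) _; rewrite /rho ler_nat -addn2 leq_addr.
Qed.

Lemma rho_quad (c e : R) : 0 < e -> \forall n \near \oo, c * (rho n + 1) < e * rho n ^+ 2.
Proof.
move=> e0; apply: filterS (rho_ge (2 * (`|c| + 1) / e)) => n; rewrite ler_pdivrMr // => h.
have r1 := rho_gt1 n; have := ler_norm c; have := normr_ge0 c => c0 c1.
have k1 : c * (rho n + 1) <= `|c| * (rho n + 1) by apply: ler_wpM2r => //; lra.
have k2 : `|c| * (rho n + 1) <= `|c| * (2 * rho n) by apply: ler_wpM2l => //; lra.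
have k3 : (2 * (`|c| + 1)) * rho n <= (rho n * e) * rho n by apply: ler_wpM2r => //; lra.
have -> : e * rho n ^+ 2 = rho n * e * rho n by rewrite expr2; ring.
lra.
Qed.

Lemma dis_cvg : dis n @[n --> \oo] --> (0 : R).
Proof.
apply/cvgrPdist_lt => e e0; have e2 : 0 < e^-1 by rewrite invr_gt0.
apply: filterS (rho_quad 1 e0) => n h.
rewrite sub0r normrN ger0_norm ?ltW ?dis_gt0 // /dis invf_plt ?posrE ?exprn_gt0 ?rho_gt0 //.
have := rho_gt1 n; move: h; rewrite mul1r -(ltr_pdivrMl _ _ e0) => h1 h2.
by apply: lt_trans h1; rewrite ltr_pMr ?invr_gt0 //; lra.
Qed.

(** This is what the comparison arguments retain of the [w n]. [W n] stands for the upper envelope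
    of [- w n], hence for a super-solution on the whole plane. The bundle is stable under
    reflection. *)
Definition barriers H (K D : R) (F : set_system nat) w W (lam : nat -> R) (lamb : R) :=
  [/\ lam n @[n --> F] --> lamb,
      forall n, usc (W n) /\ t_periodic (W n),
      forall n, vsub setT (dis n) (Gneg H) (- lam n) (W n),
      forall n z, - w n z <= W n z
    & forall n z, (rho n < `|z.2| -> W n z <= - rho n ^+ 2) /\
        (`|z.2| <= rho n -> - (K * `|z.2| + D) <= W n z <= K * (`|z.2| + 1) + D)].

Lemma barriers_refl H K D F w W lam lamb : barriers H K D F w W lam lamb ->
  barriers (refl H) K D F (fun n => w n \o aff (-1) 0 0) (fun n => W n \o aff (-1) 0 0) lam lamb.
Proof.
have kk : -1 * -1 = 1 :> R by rewrite mulrNN mulr1.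
have n2 z : `|(aff (-1) 0 0 z).2| = `|z.2| by rewrite /aff /= addr0 mulN1r normrN.
move=> [h1 h2 h3 h4 h5]; split => //.
- by move=> n; have [a b] := h2 n; split; [exact: usc_aff|exact: t_periodic_aff].
- move=> n z _; have := vsub_at_aff kk (h3 n (aff (-1) 0 0 z) I).
  congr vsub_at; apply/funext => t; apply/funext => x; apply/funext => p.
  by rewrite /Gneg /refl !addr0 !mulN1r.
- by move=> n z; exact: h4.
- by move=> n z; have := h5 n (aff (-1) 0 0 z); rewrite n2.
Qed.

Section Use.
Variables (H : R -> R -> R -> R) (K D lamb : R) (F : set_system nat).
Variables (w W : nat -> R * R -> R) (lam : nat -> R).
Hypotheses (PF : ProperFilter F) (oF : \oo `<=` F) (K0 : 0 <= K) (D0 : 0 <= D).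
Hypotheses (cH : assA0 H) (h2 : assA2 H) (h3 : assA3 H).
Hypothesis bar : barriers H K D F w W lam lamb.

(** The interval reaches past the strip, where the size of [W n] makes the right boundary condition
    automatic. The point produced by [comparison] thus lies in the strip, where the discount is too
    small to bridge the gap between the levels. *)
Lemma barrier_cmp (la K' C' D' : R) : la < lamb ->
  F [set n | forall (U : R * R -> R) (a : R), usc U -> t_periodic U ->
    - (rho n + 1) <= a <= rho n ->
    (forall z, a < z.2 < rho n + 1 -> vsub_at 0 H la U z) ->
    (forall t x, a <= x <= rho n + 1 -> U (t, x) <= K' * `|x| + C') ->
    (forall t s x, a <= x <= rho n + 1 -> U (t, x) - U (s, x) <= C') ->
    (forall t s, U (t, a) + W n (s, a) <= - D') ->
    forall t x, a <= x <= rho n + 1 -> U (t, x) + W n (t, x) <= - D'].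
Proof.
(* A gap of [4 * e] leaves room for three errors of size [e]: on [lam n], in [comparison], and in
   the discount. *)
move=> lalb; set e := (lamb - la) / 4; have e0 : 0 < e by rewrite /e; lra.
have [lamc hW sW _ bdW] := bar.
have [Kc hK] := comparison C' la cH h2 h3 e0.
have n1 : F [set n | `|lamb - lam n| < e] by move/cvgrPdist_lt : lamc; exact.
have n2 := oF (rho_quad (`|K'| + `|C'| + `|D'|) ltr01).
have n3 := oF (rho_quad (K + D) e0).
apply: filterS (filterI n1 (filterI n2 n3)) => n [/= q1 [q2 q3]] U a uU pU ha sU gU oU bdU t0 x0 x0ab.
have r1 := rho_gt1 n; have r0 := rho_gt0 n.
have far t s x : rho n < `|x| -> a <= x <= rho n + 1 -> U (t, x) + W n (s, x) <= - D'.
  move=> hx hab; have [h _] := bdW n (s, x).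
  have := h hx; have := gU t x hab => g1 g2.
  have xr : `|x| <= rho n + 1 by rewrite ler_norml; lra.
  have : K' * `|x| <= `|K'| * (rho n + 1).
    apply: le_trans (ler_wpM2r (normr_ge0 x) (ler_norm K')) _.
    exact: ler_wpM2l.
  have : C' <= `|C'| * (rho n + 1).
    by apply: le_trans (ler_norm _) _; rewrite ler_peMr //; lra.
  have : D' <= `|D'| * (rho n + 1).
    by apply: le_trans (ler_norm _) _; rewrite ler_peMr //; lra.
  move: q2; rewrite mul1r !mulrDl; lra.
rewrite leNgt; apply/negP => hlt; have [uW pW] := hW n.
have d0 (x : R) : is_derive x 1 (fun _ : R => 0 : R) ((fun _ : R => 0 : R) x) by exact: is_derive_cst.
have c0 : continuous (fun _ : R => 0 : R) by move=> x; exact: cvg_cst.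
have [|t [s [x [p [hx hv _ hfin]]]]] := hK U (W n) (dis n) la (lam n) a (rho n + 1) _ _ t0 x0
    uU uW pU pW (ltW (dis_gt0 n)) d0 c0 sU (fun z _ => sW n z I) x0ab _ (lexx _) oU.
  move=> t s x hx; rewrite !subr0; apply: le_lt_trans hlt; case: hx => ->; first exact: bdU.
  by apply: far; [rewrite ger0_norm; lra|lra].
have hxr : `|x| <= rho n.
  rewrite leNgt; apply/negP => h; move: hv; rewrite !subr0.
  have hx' : a <= x <= rho n + 1 by lra.
  have := far t s x h hx'; lra.
have [_ /(_ hxr) /andP[hl _]] := bdW n (s, x).
move: hfin; rewrite addr0 => hfin.
have : dis n * - W n (s, x) <= e.
  have : dis n * - W n (s, x) <= dis n * (K * rho n + D).
    apply: ler_wpM2l; first exact/ltW/dis_gt0.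
    by have : K * `|x| <= K * rho n by [apply: ler_wpM2l]; move: hl => /=; lra.
  have : dis n * (K * rho n + D) <= e.
    rewrite /dis ler_pdivrMl ?exprn_gt0 // [X in _ <= X]mulrC; move: q3; rewrite mulrDr mulr1 mulrDl.
    have : 0 <= D * rho n by rewrite mulr_ge0 // ltW.
    move: K0 D0; lra.
  lra.
move: q1; rewrite ltr_norml /e in e0 hfin *; rewrite /e; lra.
Qed.

(** A periodic sub-solution of level [la < lamb] would lie below late [w n], by any prescribed
    margin, on an interval containing the strip. At the origin, where [w n] vanishes, this is
    absurd; and [u] attains the infimum. *)
Lemma flux_limiter_eq (u : R * R -> R) : solution H lamb u -> t_periodic u ->
  (forall n, w n (0, 0) = 0) -> (exists C0 : R, forall t x p, - C0 <= H t x p) ->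
  flux_limiter H = lamb.
Proof.
move=> su pu w0 [C0 hC0].
set S := [set lam | exists v : R * R -> R, subsolution H lam v /\ t_periodic v].
have Sl : S lamb by exists u; split => //; case: su.
have lbS : lbound S lamb.
  move=> la [v [sv pv]]; rewrite leNgt; apply/negP => lt.
  have bv : locally_bdd v by case: sv.
  set U := star v; have uU : usc U by exact: usc_star.
  have sU : vsub setT 0 H la U by apply/subsolutionP.
  have kk : 1 * 1 = 1 :> R by rewrite mulr1.
  have pU : t_periodic U.
    move=> t x; have := star_aff 1 0 (t, x) kk bv; rewrite /aff /= mul1r addr0 /U => <-.
    by congr star; apply/funext => -[t' x']; rewrite /= mul1r addr0 pv.
  have [K1 hK1] := h3 (la + 1); set K' := `|K1| + 1.
  have K'0 : 0 < K' by rewrite ltr_wpDl.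
  have hK' t x p : K' <= `|p| -> la < H t x p.
    move=> hp; have hp' : K1 <= `|p| by have := ler_norm K1; move: hp; rewrite /K'; lra.
    by have := hK1 t x p hp'; lra.
  have osc t s x y : U (t, x) - U (s, y) <= K' * `|x - y| + (`|la + C0| + 1).
    pose b := `|x| + `|y| + 1.
    have := normr_ge0 x; have := normr_ge0 y; have := ler_norm x; have := ler_norm (- x).
    have := ler_norm y; have := ler_norm (- y); rewrite !normrN => *.
    by apply: (sub_osc (a := - b) (b := b) uU pU K'0 (fun z _ => sU z I) hK' hC0); rewrite /b; lra.
  set C1 := `|la + C0| + 1 in osc.
  (* With this margin [D'], the ordering at the origin would give [U (0, 0) <= - |U (0, 0)| - 1]. *)
  set C' := C1 + `|U (0, 0)|; set D' := `|U (0, 0)| + 1.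
  have hF := barrier_cmp K' C' D' lt.
  have hF2 := oF (rho_quad (K' + C' + D') ltr01).
  have [n [hn hq]] := filter_ex (filterI hF hF2).
  have [_ _ _ wW bdW] := bar; have r1 := rho_gt1 n.
  have C'0 : 0 <= C' by rewrite /C' /C1; have := normr_ge0 (U (0, 0)); have := normr_ge0 (la + C0); lra.
  have D'0 : 0 <= D' by rewrite /D'; have := normr_ge0 (U (0, 0)); lra.
  have gU t x : U (t, x) <= K' * `|x| + C'.
    by have := osc t 0 x 0; rewrite subr0 /C'; have := ler_norm (U (0, 0)); lra.
  have a1 : - (rho n + 1) <= - (rho n + 1) <= rho n by lra.
  have bd t s : U (t, - (rho n + 1)) + W n (s, - (rho n + 1)) <= - D'.
    have nr : `|- (rho n + 1)| = rho n + 1 by rewrite normrN ger0_norm //; lra.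
    have [h _] := bdW n (s, - (rho n + 1)); have := gU t (- (rho n + 1)).
    have : W n (s, - (rho n + 1)) <= - rho n ^+ 2 by apply: h; rewrite /= nr; lra.
    rewrite nr; move: hq; rewrite /= mul1r (mulrDl _ D') (mulrDl K').
    have : C' <= C' * (rho n + 1) by rewrite ler_peMr //; lra.
    have : D' <= D' * (rho n + 1) by rewrite ler_peMr //; lra.
    lra.
  have oU t s x : - (rho n + 1) <= x <= rho n + 1 -> U (t, x) - U (s, x) <= C'.
    move=> _; have := osc t s x x; rewrite subrr normr0 mulr0 add0r /C'.
    by have := normr_ge0 (U (0, 0)); lra.
  have := hn U _ uU pU a1 (fun z _ => sU z I) (fun t x _ => gU t x) oU bd 0 0.
  have := wW n (0, 0); rewrite w0 /D' => k1 k2.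
  have : U (0, 0) + W n (0, 0) <= - (`|U (0, 0)| + 1) by apply: k2; lra.
  by have := ler_norm (- U (0, 0)); rewrite normrN; lra.
apply/eqP; rewrite eq_le; apply/andP; split; last first.
  by apply: lb_le_inf => //; exists lamb.
by apply: ge_inf => //; exists lamb.
Qed.

Section Right.
Variables (HR : R -> R -> R -> R) (U : R * R -> R).
Hypotheses (tH : tail H HR) (pR : periodic3 HR).
Hypothesis Uge : forall z c, F [set n | c <= w n z] -> c <= U z.

(** Far to the right, the corrector of slope [p] is a sub-solution for [H] at a level still below
    [lamb]; a lowered copy lies below late [w n], hence below [U]. *)
Lemma slope_lower_right (p : R) : Hbar HR p < lamb ->
  exists X C' : R, forall t x, X <= x -> p * x - C' <= U (t, x).
Proof.
move=> hp; have cR := tail_A0 tH pR cH; have R3 := tail_A3 tH pR h3.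
set e := (lamb - Hbar HR p) / 2; have e0 : 0 < e by rewrite /e; lra.
have [V [V' [M [[uV _] [pV _] hM sV _]]]] := cell_slope (HbarP cR pR R3 p).
have [X0 hX0] := tH e0; set X := `|X0|.
have X00 : X0 <= X := ler_norm _; have Xge : 0 <= X := normr_ge0 _.
have hMa z : - M <= V z - p * z.2 <= M by rewrite -ler_norml; case: (hM z).
(* Lowering by [D1] orders the corrector and [w n] at the left end [X], where both are bounded
   independently of [n]. *)
set D1 := `|p| * X + M + K * (X + 1) + D.
have la : Hbar HR p + e < lamb by rewrite /e; lra.
have hF := barrier_cmp `|p| (2 * `|M| + `|D1|) 0 la.
exists X, (M + D1) => t x hx; apply: Uge.
apply: filterS (filterI hF (filterI (oF (rho_ge X)) (oF (rho_ge x)))) => n [/= hn [rX rx]].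
have [_ _ _ wW bdW] := bar; have r1 := rho_gt1 n.
have nM := ler_norm M; have nD := ler_norm (- D1); rewrite normrN in nD.
have px (y : R) : p * y <= `|p| * `|y| by rewrite -normrM ler_norm.
clear V' hM; pose V' z := V z - D1.
have uV' : usc V' by exact: usc_addc.
have pV' : t_periodic V' by move=> t' x'; rewrite /V' pV.
have a1 : - (rho n + 1) <= X <= rho n by lra.
have sV' z : X < z.2 < rho n + 1 -> vsub_at 0 H (Hbar HR p + e) V' z.
  move=> /andP[h _].
  have s1 : vsub_at 0 H (Hbar HR p + e) V z.
    move=> phi cp E tch; have := sV z I phi cp E tch.
    have hz : X0 <= z.2 by lra.
    by have := hX0 z.1 z.2 (dx phi z) hz; rewrite ltr_norml; lra.
  by have := vsub_at_addc (c := - D1) s1; rewrite mul0r addr0.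
have g1 t' x' : X <= x' <= rho n + 1 -> V' (t', x') <= `|p| * `|x'| + (2 * `|M| + `|D1|).
  by move=> _; have := hMa (t', x'); have := px x'; have := normr_ge0 M; rewrite /V' /=; lra.
have o1 t' s' x' : X <= x' <= rho n + 1 -> V' (t', x') - V' (s', x') <= 2 * `|M| + `|D1|.
  move=> _; have := hMa (t', x'); have := hMa (s', x'); have := normr_ge0 D1.
  by rewrite /V' /=; lra.
have b1 t' s' : V' (t', X) + W n (s', X) <= - 0.
  have nX : `|X| = X by exact: ger0_norm.
  have [_] := bdW n (s', X); rewrite /= nX => /(_ rX) /andP[_ hW].
  by have := hMa (t', X); have := px X; rewrite nX /V' /= /D1; lra.
have hx' : X <= x <= rho n + 1 by lra.
have := hn V' X uV' pV' a1 sV' g1 o1 b1 t x hx'.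
by have := wW n (t, x); have := hMa (t, x); rewrite /V' /=; lra.
Qed.

(** The upper bound comes from the largest mean slope. The smallest mean slope settles the lower
    bound when [lamb] is the minimum of [Hbar HR]; otherwise sublevel slopes exist below [pmin], and
    correctors of slope just under [pmin] serve as barriers. *)
Lemma right_side (p0 K1 C1 : R) : usc U -> t_periodic U -> vsub setT 0 H lamb U ->
  0 <= K1 -> (forall t s x y, U (t, x) - U (s, y) <= K1 * `|x - y| + C1) ->
  argmin (Hbar HR) p0 -> exists pmin pmax : R,
  [/\ is_min (levelR (Hbar HR) p0 lamb) pmin, is_max (levelR (Hbar HR) p0 lamb) pmax
   & forall e : R, 0 < e -> exists X C' : R, forall x, X <= x ->
      (pmin - e) * x - C' <= U (0, x) <= (pmax + e) * x + C'].
Proof.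
move=> uU pU sU K10 osc hmin.
have cR := tail_A0 tH pR cH; have R3 := tail_A3 tH pR h3; have R2 := tail_A2 tH pR h2.
have cf := Hbar_cont cR pR R2 R3; have cof : coercive (Hbar HR) := Hbar_coercive cR pR R3.
have grow eta := @sub_growth_right _ H HR tH pR lamb U K1 C1 eta cH h2 h3 uU pU sU K10.
have fp0 : Hbar HR p0 <= lamb.
  apply/ler_addgt0Pr => e e0; have [[q [hq _]] _] := grow e e0 osc.
  exact: le_trans (hmin q) hq.
have [pmin [pmax [hpmin hpmax ub lb]]] := level_ends cf cof hmin fp0.
exists pmin, pmax; split => // e e0; have e2 : 0 < e / 2 by lra.
have [X1 [C2 up]] : exists X C' : R, forall x, X <= x -> U (0, x) <= (pmax + e) * x + C'.
  have [eta [eta0 heta]] := sublevel_upper cf cof ub e2.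
  have [[q [hq gq]] _] := grow eta eta0 osc; have [X [C' h]] := gq _ e2.
  exists `|X|, C' => x hx; have := h x (le_trans (ler_norm _) hx).
  have x0 : 0 <= x := le_trans (normr_ge0 _) hx.
  have : (q + e / 2) * x <= (pmax + e) * x.
    by apply: ler_wpM2r => //; have := heta q hq; lra.
  lra.
have [X2 [C3 lo]] : exists X C' : R, forall x, X <= x -> (pmin - e) * x - C' <= U (0, x).
  case: lb => [lb|[p0m lb]].
    have lbN q : Hbar HR (- q) <= lamb -> q <= - pmin by move=> /lb; lra.
    have [eta [eta0 heta]] := sublevel_upper (continuous_opp_arg cf) (coercive_opp_arg cof) lbN e2.
    have [_ [q [hq gq]]] := grow eta eta0 osc; have [X [C' h]] := gq _ e2.
    exists `|X|, C' => x hx; have := h x (le_trans (ler_norm _) hx).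
    have x0 : 0 <= x := le_trans (normr_ge0 _) hx.
    have : (pmin - e) * x <= (q - e / 2) * x.
      apply: ler_wpM2r => //; have := heta (- q); rewrite opprK => /(_ hq); lra.
    lra.
  pose q := Num.max p0 (pmin - e).
  have q1 : p0 <= q by rewrite le_max lexx.
  have q2 : pmin - e <= q by rewrite le_max lexx orbT.
  have q3 : q < pmin by rewrite gt_max p0m; lra.
  have [X [C' h]] := slope_lower_right (lb q q1 q3).
  exists `|X|, C' => x hx; have := h 0 x (le_trans (ler_norm _) hx).
  have x0 : 0 <= x := le_trans (normr_ge0 _) hx.
  have : (pmin - e) * x <= q * x by apply: ler_wpM2r.
  lra.
exists (Num.max X1 X2), (Num.max C2 C3) => x; rewrite ge_max => /andP[a b].
have : C2 <= Num.max C2 C3 by rewrite le_max lexx.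
have : C3 <= Num.max C2 C3 by rewrite le_max lexx orbT.
by have := up x a; have := lo x b; lra.
Qed.

End Right.
End Use.
End Barriers.

(** * Construction of the solution and of its blow-down *)

Section Pipeline.
Context {R : realType}.
Implicit Types (z : R * R) (H HL HR Ha G : R -> R -> R -> R).

(** At a maximum of [U - k * x ^+ 2] over [|x| <= 1] one has [U >= 0], and the test function is
    constant in time, so the equation gives [H <= lam] there. This lower bound on the levels keeps
    the values outside the strip large. *)
Lemma sub_level H (al lam C0 k : R) (U : R * R -> R) : usc U -> t_periodic U ->
  0 <= al -> (forall z, `|z.2| < 1 -> vsub_at al H lam U z) ->
  (forall t x p, - C0 <= H t x p) ->
  (forall t x, `|x| <= 1 -> U (t, x) < k) -> 0 <= k -> 0 <= U (0, 0) -> - C0 <= lam.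
Proof.
move=> uU pU al0 sU hH Uk k0 U0.
have d0 (x : R) : is_derive x 1 (fun=> 0 : R) ((fun=> 0 : R) x) by exact: is_derive_cst.
have dq (x : R) : is_derive x 1 (fun x : R => k * (x - 0) ^+ 2) ((fun x => k * (2 * (x - 0))) x).
  by apply: is_deriveZ; exact: is_derive_sqr.
have cq : continuous (fun x : R => k * (2 * (x - 0))).
  exact: (cont_scale (cont_scale (@cont_shift _ 0))).
have [c1 t1 x1] := C1_sep d0 dq (fun x => @cvg_cst _ _ _ _ _) cq.
have h11 : -1 <= 1 :> R by lra.
have [z [_ z2 hz]] := usc_rect_max uU (C1_cont c1) (ler01 : 0 <= 1 :> R) h11.
have h00 : 0 <= U z - k * z.2 ^+ 2.
  have := hz 0 0; rewrite !subr0 expr0n /= mulr0 !add0r subr0 => h.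
  by apply: le_trans U0 (h _ _); rewrite ?lexx ?ler01 //; lra.
have z1 : `|z.2| < 1.
  rewrite lt_neqAle ler_norml z2 andbT; apply/eqP => E.
  have : z.2 ^+ 2 = 1 by rewrite -real_normK ?num_real // E expr1n.
  move=> E2; move: h00; rewrite E2 mulr1; have := Uk z.1 z.2; rewrite E lexx => /(_ isT).
  by rewrite -surjective_pairing; lra.
have [cc tc xc] := C1_cst (U z - k * z.2 ^+ 2).
have [cs ts xs] := C1_add c1 cc.
have := sU z z1 _ cs; rewrite ts xs t1 x1 tc xc !add0r !addr0 => h.
have hU : 0 <= al * U z.
  apply: mulr_ge0 => //; apply: le_trans h00 _.
  by rewrite gerBl mulr_ge0 // sqr_ge0.
apply: le_trans (hH z.1 z.2 (k * (2 * (z.2 - 0)))) _; apply: le_trans _ (h _ _).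
- by rewrite lerDr.
- by rewrite /= subr0; ring.
exists (1 - `|z.2|); first by rewrite subr_gt0.
move=> y [_ y2]; have y1 : -1 <= y.2 <= 1.
  rewrite -ler_norml -[y.2](subrK z.2); apply: le_trans (ler_normD _ _) _; lra.
have [j hj] := shift01 y.1.
have := hz _ _ hj y1; rewrite (periodic_int pU) -surjective_pairing /= !subr0; lra.
Qed.

Lemma t_periodic_star (v : R * R -> R) : locally_bdd v -> t_periodic v -> t_periodic (star v).
Proof.
move=> bv pv t x; have kk : 1 * 1 = 1 :> R by rewrite mulr1.
have := star_aff 1 0 (t, x) kk bv; rewrite /aff /= mul1r addr0 => <-.
by congr star; apply/funext => -[t' x']; rewrite /= mul1r addr0 pv.
Qed.

(** Contraction towards the axis [x = 0] enters the open strip. It gives the lower bound on [W n] at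
    the edge, where [w n] itself already takes its large value. *)
Lemma approx_inside (z : R * R) (r s : R) : `|z.2| <= s -> 0 < s -> 0 < r ->
  exists y, [/\ box z r y, `|y.2| < s & `|y.2| <= `|z.2|].
Proof.
move=> zs s0 r0; set d := `|z.2| + r; have d0 : 0 < d by rewrite ltr_wpDl.
have q1 : 0 < r / d by rewrite divr_gt0.
have q2 : r / d <= 1 by rewrite ler_pdivrMr // mul1r lerDr.
exists (z.1, (1 - r / d) * z.2) => /=.
have E : `|(1 - r / d) * z.2| = (1 - r / d) * `|z.2| by rewrite normrM ger0_norm //; lra.
split.
- split; rewrite /= ?subrr ?normr0 // mulrBl mul1r addrC addKr normrN normrM ger0_norm ?ltW //.
  rewrite mulrAC ltr_pdivrMr // /d mulrDr; have : 0 < r * r by exact: mulr_gt0.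
  lra.
- rewrite E; apply: le_lt_trans (_ : _ <= (1 - r / d) * s) _.
    by apply: ler_wpM2l => //; lra.
  by rewrite mulrBl mul1r gtrBl mulr_gt0.
- by rewrite E ler_piMl //; lra.
Qed.

Lemma discount_limit H (C0' C1 K : R) : assA0 H -> (forall t x p, H (t + 1) x p = H t x p) ->
  (forall t x p, - C0' <= H t x p) -> (forall t x, H t x 0 <= C1) ->
  0 < K -> (forall t x p, K <= `|p| -> C1 < H t x p) ->
  exists (D : R) (F : set_system nat) w W (lam : nat -> R) (lamb : R) U u,
  [/\ [/\ 0 <= D, UltraFilter F, \oo `<=` F, barriers H K D F w W lam lamb
        & forall n, w n (0, 0) = 0],
      [/\ usc U, t_periodic U, vsub setT 0 H lamb U,
        forall z z', U z - U z' <= K * `|z.2 - z'.2| + D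
      & forall z c, F [set n | c <= w n z] -> c <= U z],
      forall z, U z <= u z <= U z + D, t_periodic u & solution H lamb u].
Proof.
(* Since [lam n >= - C0'], the extra 1 makes the value outside the strip, [(C0 + lam n) / dis n], at
   least [rho n ^+ 2]. *)
move=> cH pH hC0 hC1 K0 hK; set C0 := C0' + 1.
have hC0' t x p : - C0 <= H t x p by have := hC0 t x p; rewrite /C0; lra.
have [F UF oF] := ultra_oo; have PF : ProperFilter F by exact: ultra_proper.
pose Om n : set R := [set x : R | `|x| < rho n].
have oOm n x : Om n x -> exists2 r : R, 0 < r & forall y, `|y - x| < r -> Om n y.
  rewrite /Om /= => hx; exists (rho n - `|x|); first by rewrite subr_gt0.
  by move=> y hy; rewrite -[y](subrK x); apply: le_lt_trans (ler_normD _ _) _; lra.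
have cOm n x y : Om n x -> Om n y -> exists a b : R,
    [/\ a < x < b, a < y < b & forall x', a < x' < b -> Om n x'].
  by rewrite /Om /= !ltr_norml => hx hy; exists (- rho n), (rho n); split => // x'; rewrite ltr_norml.
have [c hc] := choice (fun n => discount_normalized (dis_gt0 n) cH hC0' hC1 K0 hK pH (@oOm n) (@cOm n)).
have [w hcw] := choice hc.
pose lam n := - (dis n * c n).
pose W n := star (neg (w n)).
have clam n : - C0 <= lam n <= C1 by have [[h _ _ _ _] _] := hcw n; rewrite /lam; lra.
have uw n : usc (w n) by have [[_ [h _] _ _ _] _] := hcw n.
have bw n : locally_bdd (w n) by have [[_ [_ h] _ _ _] _] := hcw n.
have sw n : vsub (Om n) (dis n) H (lam n) (w n) by have [[_ _ h _ _] _] := hcw n.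
have sW n : vsub setT (dis n) (Gneg H) (- lam n) (W n).
  by rewrite opprK; have [[_ _ _ h _] _] := hcw n.
have w0 n : w n (0, 0) = 0 by have [[_ _ _ _ h] _] := hcw n.
set D := `|C1 + C0| + 1; have D0 : 0 <= D by rewrite addr_ge0.
have osc n z z' : Om n z.2 -> Om n z'.2 -> w n z - w n z' <= K * `|z.2 - z'.2| + D.
  by have [_ [h _ _]] := hcw n; exact: h.
have wout n z : ~ Om n z.2 -> w n z = C0 / dis n - c n by have [_ [_ h _]] := hcw n; exact: h.
have wper n z : w n (z.1 + 1, z.2 + 0) = w n z.
  by have [_ [_ _ h]] := hcw n; apply: h => [t x p|x]; rewrite addr0.
have pw n : t_periodic (w n) by move=> t x; rewrite -[RHS](wper n (t, x)) /= addr0.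
have Om0 n : Om n 0 by rewrite /Om /= normr0 rho_gt0.
have wle n z : Om n z.2 -> - (K * `|z.2| + D) <= w n z <= K * `|z.2| + D.
  move=> Oz; have := osc n z (0, 0) Oz (Om0 n); have := osc n (0, 0) z (Om0 n) Oz.
  by rewrite w0 /= !sub0r !subr0 normrN; lra.
have lamC n : - C0' <= lam n.
  apply: (@sub_level H (dis n) (lam n) C0' (K + D + 1) (w n)) => //.
  - exact/ltW/dis_gt0.
  - by move=> z hz; apply: sw; rewrite /Om /=; have := @rho_gt1 R n; lra.
  - move=> t x hx; have Ox : Om n (t, x).2 by rewrite /Om /=; have := @rho_gt1 R n; lra.
    have := wle n _ Ox; have : K * `|x| <= K by rewrite ler_piMr // ltW.
    by move=> /= h1 h2; lra.
  - by rewrite addr_ge0 // addr_ge0 // ltW.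
  - by rewrite w0.
have wfar n z : ~ Om n z.2 -> rho n ^+ 2 <= w n z.
  move=> Oz; rewrite wout //; have -> : C0 / dis n - c n = (C0 + lam n) / dis n.
    by rewrite /lam; field; rewrite gt_eqF ?dis_gt0.
  rewrite /dis invrK ler_peMl //; first by rewrite sqr_ge0.
  by have := lamC n; rewrite /C0; lra.
have [lamb _ lamc] : exists2 l : R, - C0 <= l <= C1 & lam n @[n --> F] --> l.
  by apply: ultra_lim; apply: filterS filterT => n _; exact: clam.
have Wb n z : (rho n < `|z.2| -> W n z <= - rho n ^+ 2) /\
    (`|z.2| <= rho n -> - (K * `|z.2| + D) <= W n z <= K * (`|z.2| + 1) + D).
  have bn := locally_bddN (bw n); have r0 := @rho_gt0 R n; split.
    move=> h; have r1 : 0 < `|z.2| - rho n by rewrite subr_gt0.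
    apply: (star_le bn r1) => y [_ y2]; rewrite /neg lerN2; apply: wfar; rewrite /Om /=.
    have := lerB_dist z.2 y.2; rewrite (distrC z.2); lra.
  move=> h; apply/andP; split.
    apply: (star_ge bn) => r r1; have [y [By y2 y3]] := approx_inside h r0 r1.
    exists y => //; have := wle n y y2; have : K * `|y.2| <= K * `|z.2|.
      by apply: ler_wpM2l => //; exact: ltW.
    by rewrite /neg; lra.
  apply: (star_le bn ltr01) => y [_ y2]; rewrite /neg.
  have y3 : `|y.2| <= `|z.2| + 1.
    by rewrite -[y.2](subrK z.2) addrC; apply: le_trans (ler_normD _ _) _; lra.
  have y4 : K * `|y.2| <= K * (`|z.2| + 1) by apply: ler_wpM2l => //; exact: ltW.
  have [Oy|Oy] := ltP `|y.2| (rho n); first by have := wle n y Oy; lra.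
  have : rho n ^+ 2 <= w n y by apply: wfar; rewrite /Om /= ltNge Oy.
  have := sqr_ge0 (@rho R n); have := mulr_ge0 (ltW K0) (normr_ge0 y.2); lra.
have exh x : exists2 r : R, 0 < r & F [set n | forall y, `|y - x| < r -> Om n y].
  exists 1 => //; apply: filterS (oF _ (rho_ge (`|x| + 1))) => n h y hy.
  by rewrite /Om /= -[y](subrK x); apply: le_lt_trans (ler_normD _ _) _; lra.
have sWO n : vsub (Om n) (dis n) (Gneg H) (- lam n) (star (neg (w n))) by move=> z _; exact: sW.
have [U [u [[uU sU oU Uu su] [Uge inv]]]] := relaxed_limit UF cH (ltW K0) bw uw sw sWO
  (cvg_oo_sub oF dis_cvg) lamc exh osc w0.
have pH' t x p : H (t + 1) (x + 0) p = H t x p by rewrite addr0.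
have {}inv := inv 1 0 pH' wper.
have K2 : K * 0 + D <= 2 * D by lra.
exists (2 * D), F, w, W, lam, lamb, U, u; split => //; last 1 first.
- by move=> t x; rewrite -[RHS](inv (t, x)).2 /= addr0.
- split => //; first by lra.
  split => //.
  + by move=> n; split; [apply: usc_star; exact: locally_bddN|
      apply: t_periodic_star; [exact: locally_bddN|by move=> t x; rewrite /neg pw]].
  + by move=> n z; apply: (le_star z (locally_bddN (bw n))).
  + by move=> n z; have [h1 h2] := Wb n z; split => // h; have := h2 h; lra.
- by split => //; move=> t x; rewrite -[RHS](inv (t, x)).1 /= addr0.
Qed.

Lemma solution_refl G (lam : R) (v : R * R -> R) : solution G lam v ->
  solution (refl G) lam (v \o aff (-1) 0 0).
Proof.
have kk : -1 * -1 = 1 :> R by rewrite mulrNN mulr1.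
move=> [sv Sv]; have bv : locally_bdd v by case: sv.
have bn := locally_bddN bv; have ba := locally_bdd_aff 0 0 kk bv.
have Es (u : R * R -> R) : locally_bdd u -> star (u \o aff (-1) 0 0) = star u \o aff (-1) 0 0.
  by move=> bu; apply/funext => z; rewrite star_aff.
have key G' lam' u : vsub setT 0 G' lam' u -> vsub setT 0 (refl G') lam' (u \o aff (-1) 0 0).
  move=> su z _; have := vsub_at_aff kk (su (aff (-1) 0 0 z) I).
  congr vsub_at; apply/funext => t; apply/funext => x; apply/funext => p.
  by rewrite /refl !addr0 !mulN1r.
split; first by apply/(subsolutionP _ _ ba); rewrite Es //; apply: key; exact/subsolutionP.
apply/(supersolutionP _ _ ba).
have -> : neg (v \o aff (-1) 0 0) = neg v \o aff (-1) 0 0 by [].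
have -> : Gneg (refl G) = refl (Gneg G) by [].
by rewrite Es //; apply: key; exact/supersolutionP.
Qed.

Lemma cell_values_refl_sub Ha (p lam : R) :
  cell_values Ha (- p) lam -> cell_values (refl Ha) p lam.
Proof.
move=> [v [[M hM] pv sv]]; exists (v \o aff (-1) 0 0); split.
- by exists M => z; exact: hM.
- move=> k j t x; rewrite /aff /= !addr0 !mulN1r opprD -(pv k (- j) t (- x)).
  by rewrite mulrNz.
- have := solution_refl sv; congr solution.
  by apply/funext => t; apply/funext => x; apply/funext => q; rewrite /refl opprD.
Qed.

Lemma Hbar_refl Ha (p : R) : Hbar (refl Ha) p = Hbar Ha (- p).
Proof.
rewrite /Hbar; congr xget; apply/seteqP; split=> lam; last exact: cell_values_refl_sub.
rewrite -{1}[p]opprK => /cell_values_refl_sub.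
congr cell_values; apply/funext => t; apply/funext => x; apply/funext => q.
by rewrite /refl !opprK.
Qed.

Lemma level_refl (f : R -> R) (p0 A p : R) :
  levelL f p0 A (- p) <-> levelR (fun q => f (- q)) (- p0) A p.
Proof.
rewrite /levelL /levelR /= /nonincr_part /nondecr_part opprK ltrNl.
by case: (leP p (- p0)); case: ltP => //; lra.
Qed.

Definition hn (n : nat) : R := n.+1%:R^-1.

Lemma hn_gt0 n : 0 < hn n. Proof. by rewrite invr_gt0 ltr0n. Qed.

Lemma hn_cvg : hn n @[n --> \oo] --> (0 : R).
Proof. exact: cvg_harmonic. Qed.

Lemma limit_slope (F : set_system nat) (g : R -> R) (a b y L : R) : ProperFilter F -> \oo `<=` F ->
  0 < y -> (forall e : R, 0 < e -> exists X C' : R, forall x, X <= x ->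
    (a - e) * x - C' <= g x <= (b + e) * x + C') ->
  hn n * g ((hn n)^-1 * y) @[n --> F] --> L -> a * y <= L <= b * y.
Proof.
move=> PF oF y0 hg cL.
have key e : 0 < e -> (a - e) * y <= L <= (b + e) * y.
  move=> e0; have [X [C' h]] := hg e e0.
  have hC : hn n * C' @[n --> F] --> 0 * C'.
    by apply: cvgM; [exact: cvg_oo_sub hn_cvg|exact: cvg_cst].
  have big : F [set n | X <= (hn n)^-1 * y].
    apply: oF; apply: filterS (nbhs_infty_ger (X / y)) => n /= hnn.
    rewrite -ler_pdivrMr //; apply: le_trans hnn _.
    by rewrite /hn invrK ler_nat.
  have E n (k : R) : hn n * (k * ((hn n)^-1 * y)) = k * y.
    by rewrite [k * _]mulrC -mulrA mulVKf ?gt_eqF ?hn_gt0 // mulrC.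
  apply/andP; split.
    have : (a - e) * y - 0 * C' <= L.
      apply: le_lim (cvgB (cvg_cst ((a - e) * y)) hC) cL _.
      apply: filterS big => n /= /h /andP[h1 _]; rewrite -(E n) -mulrBr.
      by apply: ler_wpM2l => //; exact/ltW/hn_gt0.
    by rewrite mul0r subr0.
  have : L <= (b + e) * y + 0 * C'.
    apply: le_lim cL (cvgD (cvg_cst ((b + e) * y)) hC) _.
    apply: filterS big => n /= /h /andP[_ h1]; rewrite -(E n) -mulrDr.
    by apply: ler_wpM2l => //; exact/ltW/hn_gt0.
  by rewrite mul0r addr0.
apply/andP; split; apply/ler_addgt0Pr => e e0; have d0 : 0 < e / y by exact: divr_gt0.
  have /andP[h _] := key _ d0; move: h; rewrite mulrBl divfK ?gt_eqF //; lra.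
have /andP[_ h] := key _ d0; move: h; rewrite mulrDl divfK ?gt_eqF //; lra.
Qed.

(** Rescaling turns the additive constant of the oscillation bound into [hn n * C], which vanishes:
    the limit is Lipschitz in [x] and does not see [t]. *)
Lemma rescale_limit (F : set_system nat) (u : R * R -> R) (K C : R) : UltraFilter F -> \oo `<=` F ->
  0 <= K -> 0 <= C -> (forall z z', u z - u z' <= K * `|z.2 - z'.2| + C) ->
  exists W : R -> R, [/\ forall y, hn n * u (0, (hn n)^-1 * y) @[n --> F] --> W y, W 0 = 0
   & exists eps : nat -> R, [/\ forall n, 0 < eps n, eps n @[n --> \oo] --> (0 : R)
     & {family compact, (fun n => rescale u (eps n)) @ \oo --> (fun z : R * R => W z.2)}]].
Proof.
move=> UF oF K0 C0 osc; have PF : ProperFilter F by exact: ultra_proper.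
have hF : hn n @[n --> F] --> (0 : R) := cvg_oo_sub oF hn_cvg.
have h1 n : hn n <= 1 by rewrite invf_le1 ?ltr0n // ler1n.
have rsc n z z' : rescale u (hn n) z - rescale u (hn n) z' <= K * `|z.2 - z'.2| + hn n * C.
  rewrite /rescale -mulrBr; have := osc ((hn n)^-1 * z.1, (hn n)^-1 * z.2) ((hn n)^-1 * z'.1, (hn n)^-1 * z'.2).
  rewrite /= -mulrBr normrM gtr0_norm ?invr_gt0 ?hn_gt0 // => /(ler_wpM2l (ltW (hn_gt0 n))).
  move=> /le_trans; apply; rewrite mulrDr lerD2r mulrCA mulVKf ?gt_eqF ?hn_gt0 //.
pose f n y := hn n * u (0, (hn n)^-1 * y).
have fE n y : f n y = rescale u (hn n) (0, y) by rewrite /rescale /= mulr0.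
have fb n y : `|f n y| <= K * `|y| + C + `|u (0, 0)|.
  have E0 : `|f n 0| <= `|u (0, 0)|.
    by rewrite /f mulr0 normrM gtr0_norm ?hn_gt0 // ler_piMl.
  have hC : hn n * C <= C by rewrite ler_piMl.
  have := rsc n (0, y) (0, 0); have := rsc n (0, 0) (0, y); rewrite -!fE /= !sub0r !subr0 normrN.
  by move: E0; rewrite !ler_norml; lra.
have exW y : exists L : R, f n y @[n --> F] --> L.
  have [|L _ h] := @ultra_lim _ _ F (fun n => f n y) (- (K * `|y| + C + `|u (0, 0)|)) (K * `|y| + C + `|u (0, 0)|) UF.
    by apply: filterS filterT => n _ /=; rewrite -ler_norml; exact: fb.
  by exists L.
have [W hW] := choice exW.
have hC : hn n * C @[n --> F] --> (0 : R).
  by rewrite -[X in _ --> X](mul0r C); apply: cvgM => //; exact: cvg_cst.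
have lipW y y' : W y - W y' <= K * `|y - y'|.
  rewrite -[leRHS]addr0; apply: le_lim (cvgB (hW y) (hW y')) (cvgD (cvg_cst _) hC) _.
  by apply: filterS filterT => n _ /=; have := rsc n (0, y) (0, y'); rewrite -!fE.
have W0 : W 0 = 0.
  have : f n 0 @[n --> F] --> 0 * u (0, 0).
    by rewrite /f; under eq_fun do rewrite mulr0; apply: cvgM => //; exact: cvg_cst.
  by rewrite mul0r => h; exact: (cvg_unique _ (hW 0) h).
exists W; split => //.
(* Compactness and the oscillation bound upgrade pointwise limits along [F] to uniform ones for
   [|x| <= m], at all times at once. *)
have unif (m : nat) : F [set n | forall z, `|z.2| <= m%:R -> `|rescale u (hn n) z - W z.2| <= hn m].
  have /compact_near_coveringP cv := @segment_compact R (- m%:R) m%:R.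
  have cov := cv _ F (fun n y => forall t, `|rescale u (hn n) (t, y) - W y| <= hn m) PF.
  have : \forall n \near F, `[- m%:R, m%:R]%classic `<=` [set y | forall t, `|rescale u (hn n) (t, y) - W y| <= hn m].
    apply: cov => y _; set e := hn m / 4; have e0 : 0 < e by rewrite divr_gt0 ?hn_gt0.
    have K1 : 0 < K + 1 by rewrite ltr_wpDl.
    have d0 : 0 < e / (K + 1) by exact: divr_gt0.
    have n1 : F [set n | `|W y - f n y| < e] by move/cvgrPdist_lt : (hW y); exact.
    have n2 : F [set n | `|0 - hn n * C| < e] by move/cvgrPdist_lt : hC; exact.
    exists (ball y (e / (K + 1)), [set n | `|W y - f n y| < e] `&` [set n | `|0 - hn n * C| < e]).
      by split; [exact: nbhsx_ballx|exact: filterI].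
    move=> [y' n] [/= By [k1 k2]] t.
    have yy : K * `|y' - y| <= e.
      have : `|y' - y| <= e / (K + 1) by rewrite distrC; move: By; rewrite -ball_normE /= => /ltW.
      move=> /(ler_wpM2l K0) /le_trans; apply; rewrite mulrCA ger_pMr // ler_pdivrMr // mul1r lerDl //.
    have := rsc n (t, y') (0, y); have := rsc n (0, y) (t, y'); rewrite -!fE /=.
    have := lipW y y'; have := lipW y' y; rewrite (distrC y).
    move: k1 k2; rewrite !ltr_norml ler_norml /e in yy *; rewrite /e; lra.
  apply: filterS => n h [t x] hx /=; apply: h; rewrite /= in_itv /= -ler_norml; exact: hx.
(* As [F] contains the cofinite sets, some index beyond [m] achieves the accuracy [hn m]; this
   extracts a genuine sequence from the ultrafilter. *)
have pick m : exists n, (m <= n)%N /\ forall z, `|z.2| <= m%:R -> `|rescale u (hn n) z - W z.2| <= hn m.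
  have hm : F [set n | (m <= n)%N] by apply: oF; exists m.
  by have [n [a b]] := filter_ex (filterI hm (unif m)); exists n.
have [nu hnu] := choice pick.
exists (fun m => hn (nu m)); split => [n||]; first exact: hn_gt0.
  apply/cvgrPdist_lt => e e0; have : \forall n \near \oo, `|0 - hn n| < e.
    by move/cvgrPdist_lt : hn_cvg; exact.
  apply: filterS => n; rewrite !sub0r !normrN !gtr0_norm ?hn_gt0 //; apply: le_lt_trans.
  by have [h _] := hnu n; rewrite lef_pV2 ?posrE ?ltr0n // ler_nat.
apply/fam_cvgP => A cA P /uniform_nbhs [E [entE EP]].
move: entE; rewrite -entourage_ballE => -[e /= e0 eE].
have bA : \forall n \near \oo, A `<=` [set z : R * R | `|z.2| <= n%:R].
  move/compact_near_coveringP : cA => cA; apply: cA => z _.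
  exists (box z 1, [set n : nat | `|z.2| + 1 <= n%:R]).
    split; last exact: nbhs_infty_ger.
    by apply/near_box; exists 1.
  move=> [y n] [/= [_ y2] h]; apply: le_trans h.
  by rewrite -[y.2](subrK z.2) addrC; apply: le_trans (ler_normD _ _) _; lra.
have he : \forall n \near \oo, `|0 - hn n| < e by move/cvgrPdist_lt : hn_cvg; exact.
apply: filterS (filterI bA he) => m [/= m1 m2]; apply: EP => z Az; apply: eE.
rewrite /= -ball_normE /= distrC; have [_ h] := hnu m; apply: le_lt_trans (h z (m1 z Az)) _.
by move: m2; rewrite sub0r normrN gtr0_norm ?hn_gt0.
Qed.

End Pipeline.

Theorem theorem1p9 (R : realType) (H HL HR : R -> R -> R -> R) (p0L p0R : R)
    (hA0 : assA0 H) (hA1 : assA1 H) (hA2 : assA2 H) (hA3 : assA3 H)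
    (hA4 : assA4 H) (hA5 : assA5 H HL HR)
    (hB : (assBi HL /\ assBi HR) \/ (assBii HL /\ assBii HR))
    (hp0L : argmin (Hbar HL) p0L) (hp0R : argmin (Hbar HR) p0R) :
  let A := flux_limiter H in
  let ER := levelR (Hbar HR) p0R A in
  let EL := levelL (Hbar HL) p0L A in
  exists pbarR phatR pbarL phatL : R,
    [/\ is_min ER pbarR, is_max ER phatR, is_max EL pbarL & is_min EL phatL] /\
    exists w : R * R -> R,
      [/\ solution H A w, t_periodic w
        & exists (eps : nat -> R) (W : R -> R),
          [/\ forall n, 0 < eps n,
              eps n @[n --> \oo] --> (0 : R),
              {family compact, (fun n => rescale w (eps n)) @ \oo -->
                (fun z : R * R => W z.2)},
              W 0 = 0
            & forall x : R,
                pbarR * x * (0 < x)%R%:R + pbarL * x * (x < 0)%R%:R <= W x /\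
                W x <= phatR * x * (0 < x)%R%:R + phatL * x * (x < 0)%R%:R]].
Proof.
have bH := tails_slope_bounded hA0 hA1 hA3 hA5.
(* Growth bounds on [U] pass to [u], which exceeds it by at most [D]. *)
have shift (a b c d D v : R) : a <= v <= a + D -> b - d <= a <= c + d ->
  b - (d + D) <= v <= c + (d + D) by lra.
have [C0 hC0] := bounded_below bH hA3; have [C1 hC1] := bH 0.
have hC1' t x : H t x 0 <= C1.
  by apply: le_trans (ler_norm _) (hC1 t x 0 _); rewrite normr0.
have [K1 hK1] := hA3 (C1 + 1); set K := `|K1| + 1.
have K0 : 0 < K by rewrite ltr_wpDl.
have hK t x p : K <= `|p| -> C1 < H t x p.
  move=> hp; have /(hK1 t x) : K1 <= `|p| by have := ler_norm K1; move: hp; rewrite /K; lra.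
  lra.
have pH t x p : H (t + 1) x p = H t x p by exact: (hA1 1).
have [D [F [w [W [lam [lamb [U [u [[D0 UF oF bar w0] [uU pU sU oU Uge] Uu pu su]]]]]]]]] :=
  discount_limit hA0 pH hC0 hC1' K0 hK.
have PF : ProperFilter F by exact: ultra_proper.
have EA : flux_limiter H = lamb.
  by apply: (flux_limiter_eq PF oF (ltW K0) D0 hA0 hA2 hA3 bar su pu w0); exists C0.
have [_ _ pL pR] := hA5.
have kk : -1 * -1 = 1 :> R by rewrite mulrNN mulr1.
have [pmin [pmax [minR maxR growR]]] := right_side PF oF (ltW K0) D0 hA0 hA2 hA3 bar
  (tail_right hA1 hA5) pR Uge uU pU sU (ltW K0) (fun t s x y => oU (t, x) (s, y)) hp0R.
have EH : Hbar (refl HL) = (fun p => Hbar HL (- p)) by apply/funext => p; exact: Hbar_refl.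
have hp0L' : argmin (Hbar (refl HL)) (- p0L) by move=> p; rewrite EH opprK; exact: hp0L.
have sU' : vsub setT 0 (refl H) lamb (U \o aff (-1) 0 0).
  move=> z _; have := vsub_at_aff kk (sU (aff (-1) 0 0 z) I).
  congr vsub_at; apply/funext => t; apply/funext => x; apply/funext => p.
  by rewrite /refl !addr0 !mulN1r.
have oU' t s x y : (U \o aff (-1) 0 0) (t, x) - (U \o aff (-1) 0 0) (s, y) <= K * `|x - y| + D.
  have := oU (aff (-1) 0 0 (t, x)) (aff (-1) 0 0 (s, y)).
  have -> : (aff (-1) 0 0 (t, x)).2 - (aff (-1) 0 0 (s, y)).2 = y - x by rewrite /aff /=; ring.
  by rewrite distrC.
have [qmin [qmax [minL maxL growL]]] := right_side PF oF (ltW K0) D0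
  (assA0_refl hA0) (assA2_refl hA2) (assA3_refl hA3) (barriers_refl bar)
  (tail_left hA1 hA5) (periodic3_refl pL) (fun z c h => Uge (aff (-1) 0 0 z) c h)
  (usc_aff 0 0 kk uU) (t_periodic_aff (-1) 0 pU) sU' (ltW K0) oU' hp0L'.
have osc_u z z' : u z - u z' <= K * `|z.2 - z'.2| + (D + D).
  by have := oU z z'; have := Uu z; have := Uu z'; lra.
have [Wl [cW W0 [eps [eps0 epsc epsW]]]] := rescale_limit UF oF (ltW K0) (addr_ge0 D0 D0) osc_u.
(* Slopes change sign under reflection: the smallest one, [qmin], yields [- qmin], the maximum of
   [EL]. *)
rewrite /= EA; exists pmin, pmax, (- qmin), (- qmax); split.
  move: minL maxL; rewrite EH => -[lev1 lb1] [lev2 ub2]; split => //.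
    split; first exact/level_refl.
    by move=> p; rewrite -[p]opprK => /level_refl /lb1; rewrite lerN2.
  split; first exact/level_refl.
  by move=> p; rewrite -[p]opprK => /level_refl /ub2; rewrite lerN2.
exists u; split => //; exists eps, Wl; split => // x.
case: (ltgtP 0 x) => [x0|x0|<-].
- rewrite !mulr1 !mulr0 !addr0; suff : pmin * x <= Wl x <= pmax * x by case/andP.
  apply: (@limit_slope _ F (fun y => u (0, y)) _ _ _ _ PF oF x0 _ (cW x)) => e e0.
  have [X [C' h]] := growR e e0; exists X, (C' + D) => y /h.
  exact: shift (Uu (0, y)).
- rewrite !mulr1 !mulr0 !add0r; have x0' : 0 < - x by lra.
  suff : qmin * - x <= Wl x <= qmax * - x by rewrite !mulrN !mulNr; case/andP.
  apply: (@limit_slope _ F (fun y => u (0, - y)) _ _ _ _ PF oF x0') => [e e0|].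
    have [X [C' h]] := growL e e0; exists X, (C' + D) => y /h.
    by rewrite /aff /= !addr0 mulN1r; exact: shift (Uu (0, - y)).
  by under eq_fun do rewrite mulrN opprK; exact: cW.
- by rewrite !mulr0 ?mul0r W0 ?addr0 lexx.
Qed.
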